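(* Let $m\in\mathbb N$, $\sigma>0$, $\delta_1>0$, $\delta>0$, $q\in[1,\infty]$, and set $d:=1$ if $m=1$ and $d:=\lfloor m/q\rfloor+1$ if $m>1$ (with $m/\infty:=0$). Let $\Omega=\{X_\nu\}_{\nu=1}^\infty\subset\mathbb R^m$ be a countable set and let $f\in B_{\sigma,m}$. Then: (a) There is a constant $C(m,q)>0$ depending only on $m,q$ such that if $\Omega$ is a $(\delta_1,N)$-packing net for $\mathbb R^m$ for some $N\in\mathbb Z_+$ and $q\in[1,\infty)$, then $$\Big(\sum_{\nu=1}^\infty|f(X_\nu)|^q\Big)^{1/q}\le C_1\|f\|_{L_q(\mathbb R^m)},\qquad C_1\le (\delta_1/2)^{-m/q}(N+1)^{1/q}\big(1+C(m,q)\max\{\delta_1\sigma,(\delta_1\sigma)^d\}\big)$$ (the right-hand side may be $+\infty$). (b) There are constants $c_0(m,q)>0$ and $C(m,q)>0$ depending only on $m,q$ such that the following holds for $q\in[1,\infty)$: if $\Omega$ is a $\delta$-covering net for $\mathbb R^m$ with $\delta\sigma\le c_0(m,q)$, and $\big(\sum_{\nu}|f(X_\nu)|^q\big)^{1/q}<\infty$, then $1-C(m,q)\max\{(\delta\sigma)^q,(\delta\sigma)^{dq}\}>0$, $f\in L_q(\mathbb R^m)$, and $$\Big(\sum_{\nu=1}^\infty|f(X_\nu)|^q\Big)^{1/q}\ge C_2\|f\|_{L_q(\mathbb R^m)},\qquad C_2\ge(4\delta)^{-m/q}2^{1/q-1}\big(1-C(m,q)\max\{(\delta\sigma)^q,(\delta\sigma)^{dq}\}\big)^{1/q}>0.$$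 (c) If $\Omega$ is a $\delta$-covering net for $\mathbb R^m$ with $11m^{3/2}\delta\sigma\le 1$ and $\sup_{\nu}|f(X_\nu)|<\infty$, then $f$ is bounded on $\mathbb R^m$ and $$\sup_{\nu\in\mathbb N}|f(X_\nu)|\ge(1-m\delta\sigma)\|f\|_{L_\infty(\mathbb R^m)}.$$
   Context: For $x\in\mathbb R^m$: $\|x\|_\infty=\max_j|x_j|$. For $x\in\mathbb R^m$, $h>0$: $Q^m_h(x)=\{y:\|y-x\|_\infty\le h\}$ and $\mathring Q^m_h(x)=\{y:\|y-x\|_\infty<h\}$. For $\sigma>0$, $B_{\sigma,m}$ is the set of entire functions $f:\mathbb C^m\to\mathbb C$ of exponential type $\sigma$: for every $\varepsilon>0$ there is $C_0(\varepsilon,f)$ with $|f(z)|\le C_0(\varepsilon,f)\exp(\sigma(1+\varepsilon)\sum_{j=1}^m|z_j|)$ for all $z\in\mathbb C^m$; $f$ is identified with its restriction to $\mathbb R^m$, and $\|f\|_{L_q(\mathbb R^m)}$ is the usual (possibly infinite) $L_q$ norm. A countable set $\Omega=\{X_\nu\}\subset\mathbb R^m$ is a $\delta$-covering net if for every $x\in\mathbb R^m$ there is $X_\nu$ with $\|x-X_\nu\|_\infty<\delta$; it is a $\delta_1$-packing net if $\inf_{\nu\ne\mu}\|X_\nu-X_\mu\|_\infty\ge\delta_1$; it is a $(\delta_1,N)$-packing net ($N\in\mathbb Z_+$) if $\sup_\nu\operatorname{card}(\Omega\cap\mathring Q^m_{\delta_1/2}(X_\nu))\le N+1$. *)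

(* Defs.v *)
From HB Require Import structures.
From mathcomp Require Import all_boot all_order all_algebra.
From mathcomp Require Import complex.
From mathcomp Require Import all_classical all_reals all_analysis.
Import Order.TTheory GRing.Theory Num.Theory.
Set Implicit Arguments. Unset Strict Implicit. Unset Printing Implicit Defensive.
Local Open Scope ring_scope.
Local Open Scope complex_scope.

Section Defs.
Context {R : realType}.

Definition cabs (z : R[i]) : R :=
  Num.sqrt (complex.Re z ^+ 2 + complex.Im z ^+ 2).

Definition linf_dist (m : nat) (x y : m.-tuple R) : R :=
  \big[Num.max/0]_(j < m) `|tnth x j - tnth y j|.

Definition clinf_dist (m : nat) (z w : m.-tuple R[i]) : R :=
  \big[Num.max/0]_(j < m) cabs (tnth z j - tnth w j).

Definition embedC (m : nat) (x : m.-tuple R) : m.-tuple R[i] :=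
  map_tuple (fun r => r%:C) x.

Definition shift_coord (m : nat) (z : m.-tuple R[i]) (j : 'I_m) (h : R[i])
  : m.-tuple R[i] :=
  [tuple (if i == j then tnth z i + h else tnth z i) | i < m].

(** entire function on C^m: continuous and holomorphic in each variable
    separately (Osgood's definition of holomorphy in several variables) *)
Definition entire (m : nat) (f : m.-tuple R[i] -> R[i]) : Prop :=
  (forall z (e : R), 0 < e -> exists2 dl : R, 0 < dl &
     forall w, clinf_dist z w < dl -> cabs (f w - f z) < e) /\
  (forall z (j : 'I_m), exists L : R[i], forall e : R, 0 < e ->
     exists2 dl : R, 0 < dl & forall h : R[i], h != 0 -> cabs h < dl ->
       cabs ((f (shift_coord z j h) - f z) / h - L) < e).

Definition exp_type (m : nat) (sigma : R) (f : m.-tuple R[i] -> R[i]) : Prop :=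
  entire f /\
  forall e : R, 0 < e -> exists C0 : R, forall z : m.-tuple R[i],
    cabs (f z) <= C0 * expR (sigma * (1 + e) * \sum_(j < m) cabs (tnth z j)).

(** Lebesgue integral over R^m of a nonnegative function, as iterated
    one-dimensional Lebesgue integrals (Tonelli) *)
Fixpoint iter_integral (m : nat) : (m.-tuple R -> \bar R) -> \bar R :=
  match m return (m.-tuple R -> \bar R) -> \bar R with
  | 0%N => fun g => g [tuple]
  | m'.+1 => fun g =>
      (\int[@lebesgue_measure R]_(x in [set: R])
          iter_integral (fun t : m'.-tuple R => g [tuple of x :: t]))%E
  end.

Definition Lq_norm (m : nat) (q : R) (f : m.-tuple R[i] -> R[i]) : \bar R :=
  ((iter_integral (fun x : m.-tuple R => ((cabs (f (embedC x))) `^ q)%:E))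
     `^ q^-1)%E.

Definition sample_lq_norm (m : nat) (q : R) (f : m.-tuple R[i] -> R[i])
  (X : nat -> m.-tuple R) : \bar R :=
  ((\sum_(0 <= nu <oo) ((cabs (f (embedC (X nu)))) `^ q)%:E) `^ q^-1)%E.

Definition covering_net (m : nat) (delta : R) (X : nat -> m.-tuple R) : Prop :=
  forall x : m.-tuple R, exists nu, linf_dist x (X nu) < delta.

Definition packing_net (m : nat) (delta1 : R) (N : nat) (X : nat -> m.-tuple R)
  : Prop :=
  forall nu (s : seq nat), uniq s ->
    all (fun mu => linf_dist (X mu) (X nu) < delta1 / 2) s ->
    (size s <= N.+1)%N.

Definition dexp (m : nat) (q : R) : nat :=
  if m == 1%N then 1%N else (Num.truncn (m%:R / q)).+1.

End Defs.

(* Main.v *)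
(** For a function bounded on R^m, Bernstein's inequality holds in difference form,
    |f (x + u) - f x| <= e s |u|_1 sup |f|. It is obtained one coordinate at a time
    from the maximum principle, applied to (g (x + z) - g (x - z)) / z on a square
    after the Phragmen-Lindelof bound |g (x + i y)| <= M e^(s' |y|); Cauchy's theorem
    enters only through Goursat's lemma for w |-> h (z0 + e^w) on rectangles, whose
    horizontal sides cancel by periodicity. By duality the inequality extends to
    l_q families (f (x + Y_i))_i, uniformly in x, and so to families whose points are
    moved independently by at most d: the l_q distance is at most
    (1 + 2 e s m d)^m - 1 times the supremum over the translates. Comparing the
    samples with points of a cubical grid at which |f| is close to its extreme values
    on the cells turns this into both integral estimates. Boundedness of f, needed to
    start, comes from a net on which f is bounded, by damping f with a Gaussian and
    applying the same difference inequality near an almost-maximum point. *)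
Require Import Defs.
From HB Require Import structures.
From mathcomp Require Import all_boot all_order all_algebra.
From mathcomp Require Import complex.
From mathcomp Require Import all_classical all_reals all_analysis.
From mathcomp Require Import measurable_realfun.
From mathcomp Require Import ring lra.
Import Order.TTheory GRing.Theory Num.Theory.
Import numFieldNormedType.Exports.
Set Implicit Arguments. Unset Strict Implicit. Unset Printing Implicit Defensive.
Local Open Scope ring_scope.
Local Open Scope complex_scope.
Local Open Scope classical_set_scope.

(** Bernstein's inequality is kept in difference form, so that neither derivatives nor integral
    formulas for [f] are needed; the price is the constant e instead of 1. In (c), where constants
    matter, a second difference centred at [x] has error [(e t)^2] times the supremum, with
    [t = m delta sigma], and [11 t <= 1] together with e^2 < 11 turns this into [t]. The power 3/2
    of [m] there serves boundedness: the Gaussian has to dominate [m] coordinates at once, which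
    costs a factor [sqrt m] in the type, and the path to the net has [m] steps.

    The obstacle in l_q is that every sample point moves by its own vector, so the displaced family
    is not a translate of the given one. Hence all bounds are taken over every translate of a
    family, and individual shifts are compared along one common grid.

    The exponent [dexp] comes from large [delta1 * sigma] in (a): the packing parameter is lowered
    there, and the loss [(delta1 sigma)^(m/q)] has to be absorbed. In (b) the factor
    [4^(-m/q) 2^(1/q-1)] leaves enough room for [C = 1/2]. *)

Section ComplexModulus.
Context {R : realType}.
Implicit Types (z w : R[i]) (x y : R).

Lemma cabsE z : cabs z = Normc.normc z.
Proof. by case: z. Qed.

Lemma cabs_ge0 z : 0 <= cabs z.
Proof. exact: sqrtr_ge0. Qed.

Lemma cabs0 : cabs (0 : R[i]) = 0.
Proof. by rewrite cabsE Normc.normc0. Qed.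

Lemma cabs1 : cabs (1 : R[i]) = 1.
Proof. by rewrite cabsE Normc.normc1. Qed.

Lemma cabs_eq0 z : cabs z = 0 -> z = 0.
Proof. by rewrite cabsE => /Normc.eq0_normc. Qed.

Lemma cabs_gt0 z : z != 0 -> 0 < cabs z.
Proof.
move=> z0; rewrite lt_neqAle cabs_ge0 andbT eq_sym.
by apply: contra_neq z0; apply: cabs_eq0.
Qed.

Lemma cabsM z w : cabs (z * w) = cabs z * cabs w.
Proof. by rewrite !cabsE Normc.normcM. Qed.

Lemma cabsN z : cabs (- z) = cabs z.
Proof. by rewrite !cabsE normcN. Qed.

Lemma cabsD z w : cabs (z + w) <= cabs z + cabs w.
Proof. by rewrite !cabsE le_normcD. Qed.

Lemma cabsB z w : cabs (z - w) <= cabs z + cabs w.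
Proof. by rewrite -[in leRHS](cabsN w) cabsD. Qed.

Lemma cabsC z w : cabs (z - w) = cabs (w - z).
Proof. by rewrite -cabsN opprB. Qed.

Lemma cabs_tri (w z u : R[i]) : cabs (z - u) <= cabs (z - w) + cabs (w - u).
Proof. by rewrite (le_trans _ (cabsD _ _))// addrA subrK. Qed.

Lemma cabsV z : cabs z^-1 = (cabs z)^-1.
Proof.
have [->|z0] := eqVneq z 0; first by rewrite invr0 cabs0 invr0.
have h : cabs z != 0 by rewrite gt_eqF// cabs_gt0.
by apply: (mulIf h); rewrite -cabsM !mulVf// cabs1.
Qed.

Lemma cabs_real x : cabs x%:C = `|x|.
Proof. by rewrite /cabs /= expr0n addr0 sqrtr_sqr. Qed.

Lemma cabs_sum (I : Type) (r : seq I) (P : pred I) (F : I -> R[i]) :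
  cabs (\sum_(i <- r | P i) F i) <= \sum_(i <- r | P i) cabs (F i).
Proof.
elim/big_rec2: _ => [|i y1 y2 _ h]; first by rewrite cabs0.
by rewrite (le_trans (cabsD _ _))// lerD2l.
Qed.

Lemma abs_Re_le z : `|complex.Re z| <= cabs z.
Proof. by rewrite -sqrtr_sqr ler_wsqrtr// lerDl sqr_ge0. Qed.

Lemma abs_Im_le z : `|complex.Im z| <= cabs z.
Proof. by rewrite -sqrtr_sqr ler_wsqrtr// lerDr sqr_ge0. Qed.

Lemma cabs_le_ReIm z : cabs z <= `|complex.Re z| + `|complex.Im z|.
Proof.
rewrite -[leRHS]ger0_norm ?addr_ge0// -sqrtr_sqr ler_wsqrtr//.
by rewrite sqrrD !real_normK ?num_real// -addrA lerD2l lerDr mulrn_wge0// mulr_ge0.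
Qed.

Lemma cabs_sqr z : cabs z ^+ 2 = complex.Re z ^+ 2 + complex.Im z ^+ 2.
Proof. by rewrite sqr_sqrtr// addr_ge0// sqr_ge0. Qed.

Lemma cabs_conj z : cabs z^* = cabs z.
Proof. by case: z => a b; rewrite /cabs /= sqrrN. Qed.

Lemma mulc_conj z : z * z^* = (cabs z ^+ 2)%:C.
Proof. by rewrite cabs_sqr; case: z => a b; simpc; congr (_ +i* _); ring. Qed.

Lemma ReD z w : complex.Re (z + w) = complex.Re z + complex.Re w.
Proof. by case: z; case: w. Qed.

Lemma ImD z w : complex.Im (z + w) = complex.Im z + complex.Im w.
Proof. by case: z; case: w. Qed.

Lemma ReN z : complex.Re (- z) = - complex.Re z.
Proof. by case: z. Qed.

Lemma ImN z : complex.Im (- z) = - complex.Im z.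
Proof. by case: z. Qed.

Lemma ReM z w :
  complex.Re (z * w) = complex.Re z * complex.Re w - complex.Im z * complex.Im w.
Proof. by case: z; case: w. Qed.

Lemma ImM z w :
  complex.Im (z * w) = complex.Re z * complex.Im w + complex.Im z * complex.Re w.
Proof. by case: z; case: w => a b c d /=. Qed.

End ComplexModulus.

(** * Continuity and differentiability in one complex variable *)

Section ComplexContinuity.
Context {R : realType}.
Implicit Types (h g : R[i] -> R[i]) (z w : R[i]).

Definition ccont h z := forall e : R, 0 < e ->
  exists2 d : R, 0 < d & forall w, cabs (w - z) < d -> cabs (h w - h z) < e.

Lemma ccont_cst (c : R[i]) z : ccont (fun=> c) z.
Proof. by move=> e e0; exists 1 => // w _; rewrite subrr cabs0. Qed.

Lemma ccont_id z : ccont id z.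
Proof. by move=> e e0; exists e. Qed.

Lemma ccontD h g z : ccont h z -> ccont g z -> ccont (fun w => h w + g w) z.
Proof.
move=> ch cg e e0; have e2 : 0 < e / 2 by lra.
have [d1 d10 h1] := ch _ e2; have [d2 d20 h2] := cg _ e2.
exists (Num.min d1 d2) => [|w]; first by rewrite lt_min d10.
rewrite lt_min => /andP[/h1 k1 /h2 k2].
have -> : h w + g w - (h z + g z) = (h w - h z) + (g w - g z) by ring.
by rewrite (le_lt_trans (cabsD _ _))//; lra.
Qed.

Lemma ccontM h g z : ccont h z -> ccont g z -> ccont (fun w => h w * g w) z.
Proof.
move=> ch cg e e0.
pose K := cabs (h z) + cabs (g z) + 1.
have hz := cabs_ge0 (h z); have gz := cabs_ge0 (g z).
have K1 : 1 <= K by rewrite /K; lra.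
have K0 : 0 < K by lra.
pose t := Num.min 1 (e / (2 * K)).
have t0 : 0 < t by rewrite lt_min ltr01 divr_gt0// mulr_gt0.
have [d1 d10 h1] := ch _ t0; have [d2 d20 h2] := cg _ t0.
exists (Num.min d1 d2) => [|w]; first by rewrite lt_min d10.
rewrite lt_min => /andP[/h1 k1 /h2 k2].
have -> : h w * g w - h z * g z = (h w - h z) * (g w - g z) +
  (h w - h z) * g z + h z * (g w - g z) by ring.
rewrite (le_lt_trans (cabsD _ _))//.
rewrite (le_lt_trans (lerD (cabsD _ _) (lexx _)))// !cabsM.
move: k1 k2; set a := cabs (h w - h z); set b := cabs (g w - g z) => k1 k2.
have a0 : 0 <= a by exact: cabs_ge0.
have b0 : 0 <= b by exact: cabs_ge0.
have tK : t * K <= e / 2.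
  rewrite -ler_pdivlMr// -mulrA -invfM.
  by rewrite /t ge_min lexx orbT.
have t1 : t <= 1 by rewrite ge_min lexx.
have : a * b + a * cabs (g z) + cabs (h z) * b <= t * K.
  rewrite /K; have : a * b <= t * 1 by apply: ler_pM => //; lra.
  have : a * cabs (g z) <= t * cabs (g z) by apply: ler_wpM2r => //; lra.
  have : cabs (h z) * b <= cabs (h z) * t by apply: ler_wpM2l => //; lra.
  lra.
lra.
Qed.

Lemma ccontN h z : ccont h z -> ccont (fun w => - h w) z.
Proof.
move=> ch e e0; have [d d0 hd] := ch _ e0; exists d => // w /hd.
by rewrite -opprD cabsN.
Qed.

Lemma ccontB h g z : ccont h z -> ccont g z -> ccont (fun w => h w - g w) z.
Proof. by move=> ch cg; apply: ccontD => //; apply: ccontN. Qed.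

Lemma ccont_comp h g z : ccont h z -> ccont g (h z) -> ccont (fun w => g (h w)) z.
Proof.
move=> ch cg e e0; have [d d0 hd] := cg _ e0; have [d' d'0 hd'] := ch _ d0.
by exists d' => // w /hd'/hd.
Qed.

Lemma ccont_near h g z (r : R) : 0 < r ->
  (forall w, cabs (w - z) < r -> h w = g w) -> ccont h z -> ccont g z.
Proof.
move=> r0 hg ch e e0; have [d d0 hd] := ch _ e0.
exists (Num.min d r) => [|w]; first by rewrite lt_min d0.
rewrite lt_min => /andP[wd wr].
by rewrite -!hg ?subrr ?cabs0//; apply: hd.
Qed.

Lemma ccontV z : z != 0 -> ccont (fun w => w^-1) z.
Proof.
move=> z0 e e0; have a0 := cabs_gt0 z0; set a := cabs z in a0.
exists (Num.min (a / 2) (e * a ^+ 2 / 2)) => [|w].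
  by rewrite lt_min divr_gt0//= divr_gt0// mulr_gt0// exprn_gt0.
rewrite lt_min => /andP[w1 w2].
have wa : a / 2 < cabs w.
  have := cabs_tri w z 0; rewrite !subr0 (cabsC z) -/a; lra.
have w0 : w != 0.
  by apply/eqP => w0; move: wa; rewrite w0 cabs0; lra.
have -> : w^-1 - z^-1 = (z - w) / (w * z).
  by field; rewrite z0 w0.
rewrite cabsM cabsV cabsM cabsC -/a ltr_pdivrMr; last first.
  by rewrite mulr_gt0//; lra.
apply: (lt_le_trans w2).
rewrite -mulrA ler_pM2l// mulrC expr2 mulrA ler_pM2r//; lra.
Qed.

Lemma Re_cont (F : R[i] -> R[i]) (p : R -> R[i]) :
  (forall z, ccont F z) ->
  (forall x y, cabs (p x - p y) <= `|x - y|) ->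
  continuous (fun x : R => complex.Re (F (p x))).
Proof.
move=> cF pl x; apply/cvgrPdist_lt => e e0.
have [d d0 hd] := cF (p x) _ e0.
apply/nbhs_ballP; exists d => // y xy.
rewrite distrC -ReN -ReD (le_lt_trans (abs_Re_le _))// hd//.
by apply: (le_lt_trans (pl _ _)); rewrite distrC.
Qed.

Lemma Im_cont (F : R[i] -> R[i]) (p : R -> R[i]) :
  (forall z, ccont F z) ->
  (forall x y, cabs (p x - p y) <= `|x - y|) ->
  continuous (fun x : R => complex.Im (F (p x))).
Proof.
move=> cF pl x; apply/cvgrPdist_lt => e e0.
have [d d0 hd] := cF (p x) _ e0.
apply/nbhs_ballP; exists d => // y xy.
rewrite distrC -ImN -ImD (le_lt_trans (abs_Im_le _))// hd//.
by apply: (le_lt_trans (pl _ _)); rewrite distrC.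
Qed.

End ComplexContinuity.

Section ComplexDifferentiability.
Context {R : realType}.
Implicit Types (h g : R[i] -> R[i]) (z w : R[i]).

(* Caratheodory's form of complex differentiability. *)
Definition cdiff h z := exists2 q : R[i] -> R[i], ccont q z &
  forall w, h w - h z = q w * (w - z).

Lemma cdiff_cont h z : cdiff h z -> ccont h z.
Proof.
move=> [q cq hq].
apply: (@ccont_near _ (fun w => h z + q w * (w - z)) _ _ 1) => //.
  by move=> w _; rewrite -hq addrC subrK.
apply: ccontD; first exact: ccont_cst.
by apply: ccontM => //; apply: ccontB; [exact: ccont_id|exact: ccont_cst].
Qed.

Lemma cdiff_cst (c : R[i]) z : cdiff (fun=> c) z.
Proof.
by exists (fun=> 0) => [|w]; [exact: ccont_cst|rewrite subrr mul0r].
Qed.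

Lemma cdiff_id z : cdiff id z.
Proof. by exists (fun=> 1) => [|w]; [exact: ccont_cst|rewrite mul1r]. Qed.

Lemma cdiffD h g z : cdiff h z -> cdiff g z -> cdiff (fun w => h w + g w) z.
Proof.
move=> [q cq hq] [p cp hp]; exists (fun w => q w + p w) => [|w].
  exact: ccontD.
by rewrite mulrDl -hq -hp; ring.
Qed.

Lemma cdiffM h g z : cdiff h z -> cdiff g z -> cdiff (fun w => h w * g w) z.
Proof.
move=> dh dg; have cg := cdiff_cont dg; case: dh dg => [q cq hq] [p cp hp].
exists (fun w => q w * g w + h z * p w) => [|w].
  by apply: ccontD; apply: ccontM => //; exact: ccont_cst.
by rewrite mulrDl -mulrA [g w * _]mulrC mulrA -hq -mulrA -hp; ring.
Qed.

Lemma cdiffN h z : cdiff h z -> cdiff (fun w => - h w) z.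
Proof.
move=> [q cq hq]; exists (fun w => - q w) => [|w]; first exact: ccontN.
by rewrite mulNr -hq; ring.
Qed.

Lemma cdiffB h g z : cdiff h z -> cdiff g z -> cdiff (fun w => h w - g w) z.
Proof. by move=> dh dg; apply: cdiffD => //; exact: cdiffN. Qed.

Lemma cdiff_comp h g z :
  cdiff h z -> cdiff g (h z) -> cdiff (fun w => g (h w)) z.
Proof.
move=> dh; have ch := cdiff_cont dh; case: dh => [q cq hq] [p cp hp].
exists (fun w => p (h w) * q w) => [|w]; last by rewrite -mulrA -hq hp.
by apply: ccontM => //; exact: ccont_comp.
Qed.

Lemma cdiff_sum n (F : 'I_n -> R[i] -> R[i]) z :
  (forall i, cdiff (F i) z) -> cdiff (fun w => \sum_(i < n) F i w) z.
Proof.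
elim: n F => [|n IH] F dF.
  have -> : (fun w => \sum_(i < 0) F i w) = fun=> 0.
    by apply/funext => w; rewrite big_ord0.
  exact: cdiff_cst.
have -> : (fun w => \sum_(i < n.+1) F i w) =
  fun w => \sum_(i < n) F (widen_ord (leqnSn n) i) w + F ord_max w.
  by apply/funext => w; rewrite big_ord_recr.
by apply: cdiffD => //; apply: (IH (fun i => F (widen_ord (leqnSn n) i))).
Qed.

Lemma cdiffV z : z != 0 -> cdiff (fun w => w^-1) z.
Proof.
move=> z0; have a0 := cabs_gt0 z0.
(* The identity has to hold at [w = 0] too; since [0^-1 = 0], the quotient must take the value
   [z^-1 * z^-1] there. *)
exists (fun w => if w == 0 then z^-1 * z^-1 else - (z^-1 * w^-1)) => [|w].
  apply: (@ccont_near _ (fun w => - (z^-1 * w^-1)) _ _ (cabs z)) => //.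
    by move=> w; case: eqP => // ->; rewrite sub0r cabsN ltxx.
  by apply: ccontN; apply: ccontM; [exact: ccont_cst|exact: ccontV].
have [->|w0] := eqVneq w 0; last by field; rewrite z0 w0.
by rewrite invr0; field.
Qed.

Lemma cdiffP h z (L : R[i]) :
  (forall e : R, 0 < e -> exists2 dl : R, 0 < dl & forall k : R[i], k != 0 ->
    cabs k < dl -> cabs ((h (z + k) - h z) / k - L) < e) -> cdiff h z.
Proof.
move=> H; exists (fun w => if w == z then L else (h w - h z) / (w - z)) => [e e0|w].
  have [d d0 hd] := H _ e0; exists d => // w wd; rewrite eqxx.
  case: eqVneq => [|wz]; first by rewrite subrr cabs0.
  have := hd (w - z); rewrite subr_eq0 wz [z + _]addrC subrK => /(_ isT); exact.
case: eqVneq => [->|wz]; first by rewrite !subrr mulr0.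
by rewrite divfK// subr_eq0.
Qed.

Lemma cdiff_approx h z : cdiff h z -> exists L : R[i], forall e : R, 0 < e ->
  exists2 d : R, 0 < d & forall w, cabs (w - z) < d ->
    cabs (h w - h z - L * (w - z)) <= e * cabs (w - z).
Proof.
move=> [q cq hq]; exists (q z) => e /cq[d d0 hd].
exists d => // w /hd wd; rewrite hq -mulrBl cabsM ler_wpM2r ?cabs_ge0//.
exact: ltW.
Qed.

End ComplexDifferentiability.

(** * The complex exponential *)

Section ComplexExponential.
Context {R : realType}.
Implicit Types z w : R[i].

Definition cexp z : R[i] :=
  (expR (complex.Re z) * cos (complex.Im z)) +i*
  (expR (complex.Re z) * sin (complex.Im z)).

Lemma cexpD z w : cexp (z + w) = cexp z * cexp w.
Proof.
case: z => a b; case: w => c d; rewrite /cexp /= expRD cosD sinD; simpc.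
by congr (_ +i* _); ring.
Qed.

Lemma cabs_cexp z : cabs (cexp z) = expR (complex.Re z).
Proof.
rewrite /cabs /cexp /= !exprMn -mulrDr cos2Dsin2 mulr1 sqrtr_sqr.
by rewrite ger0_norm// expR_ge0.
Qed.

Lemma cexp_neq0 z : cexp z != 0.
Proof.
apply/eqP => h; have := expR_gt0 (complex.Re z).
by rewrite -cabs_cexp h cabs0 ltxx.
Qed.

Lemma cexp_period z : cexp (z + (0 +i* (2 * pi))) = cexp z.
Proof.
case: z => a b; rewrite /cexp /= addr0 !mulr_natl.
by rewrite cosD2pi sinD2pi.
Qed.

Lemma is_derive_approx0 (f : R -> R) (l : R) : is_derive (0 : R) (1 : R) f l ->
  forall e : R, 0 < e -> exists2 d : R, 0 < d & forall x, `|x| < d ->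
    `|f x - f 0 - l * x| <= e * `|x|.
Proof.
move=> [df dl] e e0.
move/cvg_ex: (df) => [l' fl'].
have ll' : l' = l by rewrite -dl /derive; apply/esym/cvg_lim.
rewrite ll' {l' ll'} in fl'.
move/cvgrPdist_le : fl' => /(_ _ e0).
rewrite /dnbhs => /nbhs_ballP[d /= d0 hd].
exists d => // x xd.
have [->|x0] := eqVneq x 0; first by rewrite mulr0 !subr0 subrr normr0 mulr0.
have := hd x; rewrite /ball /= sub0r normrN => /(_ xd x0).
rewrite /shift /= addr0 [_%:A]mulr1 /GRing.scale /= => {}hd.
have -> : f x - f 0 - l * x = - (l - x^-1 * (f x - f 0)) * x by field.
by rewrite normrM normrN ler_wpM2r.
Qed.

Lemma cdiff_cexp z : cdiff cexp z.
Proof.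
apply: (@cdiffP _ _ _ (cexp z)) => e e0.
pose K := 2 * expR (complex.Re z).
have ez := expR_gt0 (complex.Re z).
pose t := Num.min 1 (e / (8 * expR (complex.Re z))).
have t0 : 0 < t by rewrite lt_min ltr01 divr_gt0// mulr_gt0.
have t1 : t <= 1 by rewrite ge_min lexx.
have te : t * (8 * expR (complex.Re z)) <= e.
  by rewrite -ler_pdivlMr ?mulr_gt0// /t ge_min lexx orbT.
clearbody t.
have [d1 d10 h1] := is_derive_approx0 (is_derive_expR 0) t0.
have [d2 d20 h2] := is_derive_approx0 (is_derive_cos 0) t0.
have [d3 d30 h3] := is_derive_approx0 (is_derive_sin 0) t0.
exists (Num.min (Num.min t d1) (Num.min d2 d3)) => [|k k0].
  by rewrite !lt_min t0 d10 d20.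
have ka := cabs_gt0 k0.
rewrite !lt_min => /andP[/andP[kt k1] /andP[k2 k3]].
have -> : (cexp (z + k) - cexp z) / k - cexp z = cexp z * (cexp k - 1 - k) / k.
  by rewrite cexpD; field.
rewrite !cabsM cabsV cabs_cexp ltr_pdivrMr//.
suff H : cabs (cexp k - 1 - k) <= 6 * t * cabs k.
  apply: (@le_lt_trans _ _ (expR (complex.Re z) * (6 * t * cabs k))).
    by rewrite ler_wpM2l// ltW.
  have -> : expR (complex.Re z) * (6 * t * cabs k) =
     (expR (complex.Re z) * 6 * t) * cabs k by ring.
  rewrite ltr_pM2r//; nra.
have kR := abs_Re_le k; have kI := abs_Im_le k.
move: ka kt k1 k2 k3 kR kI; case: k k0 => x y k0 /=.
set r := cabs _ => ka kt k1 k2 k3 kR kI.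
have {}h1 := h1 _ (le_lt_trans kR k1).
have {}h2 := h2 _ (le_lt_trans kI k2).
have {}h3 := h3 _ (le_lt_trans kI k3).
rewrite expR0 mul1r in h1.
rewrite cos0 sin0 oppr0 mul0r subr0 in h2.
rewrite sin0 cos0 mul1r subr0 in h3.
(* With [U = e^(iy)] the remainder is [(e^x - 1 - x) U + x (U - 1) + (U - 1 - iy)]; the three terms
   are at most [t r], [3 t r] and [2 t r], whence the factor 6. *)
pose U : R[i] := cos y +i* sin y.
have U1 : cabs U = 1 by rewrite /cabs /= cos2Dsin2 sqrtr1.
have -> : cexp (x +i* y) - 1 - (x +i* y) = (expR x - 1 - x)%:C * U +
   (x%:C * ((cos y - 1)%:C + (sin y - y)%:C * (0 +i* 1) + (0 +i* y))) +
   ((cos y - 1)%:C + (sin y - y)%:C * (0 +i* 1)).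
  by rewrite /cexp /U; simpc; congr (_ +i* _); ring.
have ci : cabs (0 +i* 1 : R[i]) = 1 by rewrite /cabs /= expr0n add0r expr1n sqrtr1.
have cy : cabs (0 +i* y : R[i]) = `|y|.
  by rewrite /cabs /= expr0n add0r sqrtr_sqr.
have S : cabs ((cos y - 1)%:C + (sin y - y)%:C * (0 +i* 1)) <= 2 * t * r.
  rewrite (le_trans (cabsD _ _))// cabsM ci mulr1 !cabs_real.
  have : t * `|y| <= t * r by rewrite ler_pM2l.
  lra.
rewrite (le_trans (cabsD _ _))//.
rewrite (le_trans (lerD (cabsD _ _) (lexx _)))// cabsM U1 mulr1 cabs_real.
rewrite [cabs (x%:C * _)]cabsM cabs_real.
set V := (cos y - 1)%:C + _ in S *.
have := cabsD V (0 +i* y); rewrite cy.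
set W := cabs (V + _) => HW.
have : t * `|x| <= t * r by rewrite ler_pM2l.
have W0 : 0 <= W by apply: cabs_ge0.
have : `|x| * W <= t * (3 * r).
  apply: ler_pM => //; first by rewrite (le_trans kR)// ltW.
  have : t * r <= 1 * r by apply: ler_wpM2r => //; exact: ltW.
  lra.
lra.
Qed.

End ComplexExponential.

(** * Segment integrals and Goursat's lemma on rectangles *)

Section SegmentIntegral.
Context {R : realType}.
Implicit Types (g : R -> R) (a b c : R).

Definition RI g a b : R := Rintegral (@lebesgue_measure R) `[a, b]%classic g.

Lemma RI_integrable g a b : continuous g ->
  (@lebesgue_measure R).-integrable `[a, b]%classic (EFin \o g).
Proof.
move=> cg; apply: continuous_compact_integrable; first exact: segment_compact.
exact: continuous_subspaceT.
Qed.

Lemma RI_split g a b c : continuous g -> a <= b -> b <= c ->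
  RI g a c = RI g a b + RI g b c.
Proof.
move=> cg ab bc; have ig := RI_integrable a c cg.
have := Rintegral_itvB ig; rewrite /RI => /(_ b).
rewrite !bnd_simp => /(_ ab bc) h.
rewrite -[X in _ = _ + X]Rintegral_itv_obnd_cbnd.
  by rewrite -h; ring.
apply: integrableS ig => //.
by apply: subset_itvr; rewrite bnd_simp.
Qed.

Lemma RI_sub g1 g2 a b : continuous g1 -> continuous g2 ->
  RI (fun t => g1 t - g2 t) a b = RI g1 a b - RI g2 a b.
Proof.
by move=> c1 c2; rewrite /RI RintegralB//; exact: RI_integrable.
Qed.

Lemma RI_le g a b M : continuous g -> a <= b ->
  (forall t, a <= t <= b -> g t <= M) -> RI g a b <= M * (b - a).
Proof.
move=> cg ab gM.
have -> : M * (b - a) = RI (fun=> M) a b.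
  rewrite /RI Rintegral_cst//= lebesgue_measure_itv /= lte_fin.
  case: ltP => ab' //=; have -> : a = b by apply/eqP; rewrite eq_le ab.
  by rewrite subrr.
apply: le_Rintegral => //; try exact: RI_integrable.
  by apply: RI_integrable => x; exact: cvg_cst.
Qed.

Lemma RI_ge g a b m : continuous g -> a <= b ->
  (forall t, a <= t <= b -> m <= g t) -> m * (b - a) <= RI g a b.
Proof.
move=> cg ab gM.
have -> : m * (b - a) = RI (fun=> m) a b.
  rewrite /RI Rintegral_cst//= lebesgue_measure_itv /= lte_fin.
  case: ltP => ab' //=; have -> : a = b by apply/eqP; rewrite eq_le ab.
  by rewrite subrr.
apply: le_Rintegral => //; try exact: RI_integrable.
  by apply: RI_integrable => x; exact: cvg_cst.
Qed.

End SegmentIntegral.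

Section Goursat.
Context {R : realType}.
Variable F : R[i] -> R[i].
Hypothesis cF : forall z, ccont F z.
Implicit Types (x y w h : R).

Local Notation A s := (fun t : R => complex.Re (F (s +i* t))).
Local Notation B s := (fun t : R => complex.Im (F (t +i* s))).

Lemma cabs_im_sub s x y : cabs ((s +i* x) - (s +i* y)) <= `|x - y|.
Proof. by rewrite /cabs /= subrr expr0n add0r sqrtr_sqr. Qed.

Lemma cabs_re_sub s x y : cabs ((x +i* s) - (y +i* s)) <= `|x - y|.
Proof. by rewrite /cabs /= subrr expr0n addr0 sqrtr_sqr. Qed.

Lemma contA s : continuous (A s).
Proof. exact: (Re_cont cF (cabs_im_sub s)). Qed.

Lemma contB s : continuous (B s).
Proof. exact: (Im_cont cF (cabs_re_sub s)). Qed.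

(* The imaginary part of the integral of [F] along the boundary of
   [x, x + w] x [y, y + h]. *)
Definition Lam x y w h : R :=
  RI (A (x + w)) y (y + h) - RI (A x) y (y + h)
  - RI (B (y + h)) x (x + w) + RI (B y) x (x + w).

Lemma Lam_split x y w h : 0 <= w -> 0 <= h ->
  Lam x y (w + w) (h + h) = Lam x y w h + Lam (x + w) y w h +
    Lam x (y + h) w h + Lam (x + w) (y + h) w h.
Proof.
move=> w0 h0; rewrite /Lam !addrA.
have yh : y <= y + h by lra.
have yhh : y + h <= y + h + h by lra.
have xw : x <= x + w by lra.
have xww : x + w <= x + w + w by lra.
rewrite !(RI_split (@contA _) yh yhh) !(RI_split (@contB _) xw xww).
ring.
Qed.

(** For the affine model [F p + L (z - p)] the integrands on opposite sides differ by [Re L * w] and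
    [Re L * h]; both integrate to [Re L * w * h] and cancel. What remains is the error, at most
    [2 K] for each pair of opposite points. *)
Lemma Lam_small x y w h (p L : R[i]) (K : R) : 0 <= w -> 0 <= h ->
  (forall a b, x <= a <= x + w -> y <= b <= y + h ->
    cabs (F (a +i* b) - F p - L * ((a +i* b) - p)) <= K) ->
  `|Lam x y w h| <= 2 * K * (w + h).
Proof.
move=> w0 h0 FK.
have xx : x <= x <= x + w by lra.
have xw : x <= x + w <= x + w by lra.
have yy : y <= y <= y + h by lra.
have yh : y <= y + h <= y + h by lra.
have H1 t : y <= t <= y + h ->
    `|A (x + w) t - A x t - complex.Re L * w| <= 2 * K.
  move=> ht; have := cabs_tri 0 (F ((x + w) +i* t) - F p - L * (((x + w) +i* t) - p))
    (F (x +i* t) - F p - L * ((x +i* t) - p)).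
  rewrite subr0 sub0r cabsN => /le_trans/(_ (lerD (FK _ _ xw ht) (FK _ _ xx ht))).
  move=> h1; have := le_trans (abs_Re_le _) h1.
  have -> : K + K = 2 * K by ring.
  congr (`|_| <= _); rewrite !(ReD, ReN, ImD, ImN, ReM) /=; ring.
have H2 t : x <= t <= x + w ->
    `|B (y + h) t - B y t - complex.Re L * h| <= 2 * K.
  move=> ht; have := cabs_tri 0 (F (t +i* (y + h)) - F p - L * ((t +i* (y + h)) - p))
    (F (t +i* y) - F p - L * ((t +i* y) - p)).
  rewrite subr0 sub0r cabsN => /le_trans/(_ (lerD (FK _ _ ht yh) (FK _ _ ht yy))).
  move=> h1; have := le_trans (abs_Im_le _) h1.
  have -> : K + K = 2 * K by ring.
  congr (`|_| <= _); rewrite !(ReD, ReN, ImD, ImN, ImM) /=; ring.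
have yyh : y <= y + h by lra.
have xxw : x <= x + w by lra.
have cA : continuous (fun t => A (x + w) t - A x t).
  by move=> t; apply: cvgB; exact: contA.
have cB : continuous (fun t => B (y + h) t - B y t).
  by move=> t; apply: cvgB; exact: contB.
have := RI_le (M := complex.Re L * w + 2 * K) cA yyh.
have := RI_ge (m := complex.Re L * w - 2 * K) cA yyh.
have := RI_le (M := complex.Re L * h + 2 * K) cB xxw.
have := RI_ge (m := complex.Re L * h - 2 * K) cB xxw.
rewrite !(RI_sub _ _ (@contA _) (@contA _), RI_sub _ _ (@contB _) (@contB _)) => I1 I2 I3 I4.
have {}I1 := I1 (fun t ht => ltac:(have := H2 _ ht; rewrite ler_norml; lra)).
have {}I2 := I2 (fun t ht => ltac:(have := H2 _ ht; rewrite ler_norml; lra)).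
have {}I3 := I3 (fun t ht => ltac:(have := H1 _ ht; rewrite ler_norml; lra)).
have {}I4 := I4 (fun t ht => ltac:(have := H1 _ ht; rewrite ler_norml; lra)).
rewrite ler_norml /Lam; nra.
Qed.

Lemma nested_intervals (a b : nat -> R) : (forall n, a n <= a n.+1) ->
  (forall n, b n.+1 <= b n) -> (forall n, a n <= b n) ->
  exists X, forall n, a n <= X <= b n.
Proof.
move=> ha hb ab.
have am n k : a n <= a (n + k)%N.
  by elim: k => [|k IH]; rewrite ?addn0// addnS (le_trans IH).
have bm n k : b (n + k)%N <= b n.
  by elim: k => [|k IH]; rewrite ?addn0// addnS (le_trans _ IH).
have amb n k : a n <= b k.
  rewrite (le_trans (am n k))// (le_trans (ab _))//.
  by rewrite addnC bm.
have hs k : ubound (range a) (b k) by move=> _ [n _ <-]; exact: amb.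
exists (sup (range a)) => n; apply/andP; split.
  by apply: ub_le_sup; [exists (b 0); exact: hs|exists n].
by apply: ge_sup; [exists (a 0), 0|exact: hs].
Qed.

(** Quartering argument: a nonzero integral exceeds [E (w + h)^2] for some [E > 0], and one of the
    four quarters inherits this bound with the same [E]. The nested rectangles shrink to a point,
    where differentiability contradicts it. *)
Lemma goursat x y w h : 0 <= w -> 0 <= h ->
  (forall a b, x <= a <= x + w -> y <= b <= y + h -> cdiff F (a +i* b)) ->
  Lam x y w h = 0.
Proof.
move=> w0 h0 dF; apply/eqP; apply: contraT => Lam0.
(* The choice makes the whole rectangle [bad]; the [+ 1] keeps the denominator positive for a
   degenerate rectangle. *)
pose E := `|Lam x y w h| / (2 * (w + h + 1) ^+ 2).
have N0 : 0 < `|Lam x y w h| by rewrite normr_gt0.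
have wh1 : 0 < (w + h + 1) ^+ 2 by apply: exprn_gt0; lra.
have E0 : 0 < E by rewrite divr_gt0// mulr_gt0.
have EL : E * (w + h) ^+ 2 < `|Lam x y w h|.
  have -> : `|Lam x y w h| = E * (2 * (w + h + 1) ^+ 2).
    by rewrite divfK// gt_eqF// mulr_gt0.
  by rewrite ltr_pM2l//; nra.
clearbody E.
pose wn n := w / 2 ^+ n; pose hn n := h / 2 ^+ n.
have wn0 n : 0 <= wn n by rewrite divr_ge0// exprn_ge0.
have hn0 n : 0 <= hn n by rewrite divr_ge0// exprn_ge0.
have half (v : R) n : v / 2 ^+ n = v / 2 ^+ n.+1 + v / 2 ^+ n.+1.
  by rewrite exprS; field; rewrite expf_neq0.
have wnS n : wn n = wn n.+1 + wn n.+1 by exact: half.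
have hnS n : hn n = hn n.+1 + hn n.+1 by exact: half.
pose bad n (p : R * R) := E * (wn n + hn n) ^+ 2 < `|Lam p.1 p.2 (wn n) (hn n)|.
(* The existential is informative because the sequence of quarters is built by recursion from it. *)
have step n p : bad n p -> {p' | bad n.+1 p' /\
   (p.1 <= p'.1 <= p.1 + wn n.+1 /\ p.2 <= p'.2 <= p.2 + hn n.+1)}.
  case: p => a b; rewrite /bad wnS hnS /= Lam_split// => H.
  apply: cid; have w1 := wn0 n.+1; have h1 := hn0 n.+1.
  apply: contrapT => nex.
  have K a' b' : a <= a' <= a + wn n.+1 -> b <= b' <= b + hn n.+1 ->
      `|Lam a' b' (wn n.+1) (hn n.+1)| <= E * (wn n.+1 + hn n.+1) ^+ 2.
    move=> ha hb; rewrite leNgt; apply/negP => bad'; apply: nex.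
    by exists (a', b').
  have e1 : a <= a <= a + wn n.+1 by lra.
  have e2 : a <= a + wn n.+1 <= a + wn n.+1 by lra.
  have f1 : b <= b <= b + hn n.+1 by lra.
  have f2 : b <= b + hn n.+1 <= b + hn n.+1 by lra.
  move: H (K _ _ e1 f1) (K _ _ e2 f1) (K _ _ e1 f2) (K _ _ e2 f2).
  rewrite !ler_norml; set L1 := Lam _ _ _ _; set L2 := Lam _ _ _ _.
  set L3 := Lam _ _ _ _; set L4 := Lam _ _ _ _.
  have -> : E * (wn n.+1 + wn n.+1 + (hn n.+1 + hn n.+1)) ^+ 2 =
    4 * (E * (wn n.+1 + hn n.+1) ^+ 2) by ring.
  set EE := E * _ => H ? ? ? ?; move: H; rewrite ltNge => /negP; apply.
  by rewrite ler_norml; lra.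
have bad0 : bad 0 (x, y) by rewrite /bad /wn /hn /= expr0 !divr1.
pose s := fix s n : {p | bad n p} := match n with
  | 0 => exist _ (x, y) bad0
  | n.+1 => exist _ (sval (step n _ (svalP (s n))))
              (svalP (step n _ (svalP (s n)))).1 end.
pose a n := (sval (s n)).1; pose b n := (sval (s n)).2.
have sS n : a n <= a n.+1 <= a n + wn n.+1 /\ b n <= b n.+1 <= b n + hn n.+1.
  by have := (svalP (step n _ (svalP (s n)))).2.
have [X hX] : exists X, forall n, a n <= X <= a n + wn n.
  apply: nested_intervals => n; last by rewrite lerDl.
    by have [/andP[]] := sS n.
  by have [/andP[_ ?] _] := sS n; have := wnS n; lra.
have [Y hY] : exists Y, forall n, b n <= Y <= b n + hn n.
  apply: nested_intervals => n; last by rewrite lerDl.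
    by have [_ /andP[]] := sS n.
  by have [_ /andP[_ ?]] := sS n; have := hnS n; lra.
have Xx : x <= X <= x + w by have := hX 0; rewrite /a /wn /= expr0 divr1.
have Yy : y <= Y <= y + h by have := hY 0; rewrite /b /hn /= expr0 divr1.
have [L HL] := cdiff_approx (dF _ _ Xx Yy).
(* The error [E / 2] compensates the factor 2 in [Lam_small], so that the resulting bound is exactly
   the negation of [bad n]. *)
have E2 : 0 < E / 2 by lra.
have [d d0 Hd] := HL _ E2.
have [n hn_] : exists n, wn n + hn n < d.
  exists (Num.bound ((w + h) / d)).
  rewrite /wn /hn -mulrDl ltr_pdivrMr ?exprn_gt0//.
  rewrite mulrC -ltr_pdivrMr//.
  apply: (lt_trans (archi_boundP _)); first by rewrite divr_ge0//; lra.
  by rewrite -natrX ltr_nat ltn_expl.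
have := svalP (s n); rewrite /bad -/(a n) -/(b n) ltNge => /negP[].
have := @Lam_small (a n) (b n) (wn n) (hn n) (X +i* Y) L
  (E / 2 * (wn n + hn n)) (wn0 n) (hn0 n).
have -> : 2 * (E / 2 * (wn n + hn n)) * (wn n + hn n) =
  E * (wn n + hn n) ^+ 2 by field.
apply => a' b' ha' hb'.
have dist : cabs ((a' +i* b') - (X +i* Y)) <= wn n + hn n.
  rewrite (le_trans (cabs_le_ReIm _))//= lerD// ler_norml.
    by have := hX n; lra.
  by have := hY n; lra.
rewrite (le_trans (Hd _ (le_lt_trans dist hn_)))//.
by rewrite ler_pM2l.
Qed.
End Goursat.

(** * The maximum principle on rectangles *)

Section MaximumPrinciple.
Context {R : realType}.
Implicit Types (h : R[i] -> R[i]) (z w p : R[i]).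

(* Goursat's theorem for [w |-> h (z0 + exp w)] on [a, ln r] x [0, 2 pi]: the
   horizontal sides cancel by periodicity, and the left side tends to
   [2 pi h z0] as [a] tends to -oo. *)
Lemma Re_mean_le h z0 (r B : R) : 0 < r -> (forall z, ccont h z) ->
  (forall z, z != z0 -> cabs (z - z0) <= r -> cdiff h z) ->
  (forall z, cabs (z - z0) = r -> complex.Re (h z) <= B) ->
  complex.Re (h z0) <= B.
Proof.
move=> r0 ch dh hB; rewrite leNgt; apply/negP => Bh.
pose e := (complex.Re (h z0) - B) / 2.
have e0 : 0 < e by rewrite /e; lra.
have [d d0 hd] := ch z0 _ e0.
(* On the circle of radius [s] the real part of [h] is at least [B + e]. As the integrals over both
   circles agree, this contradicts the bound [B] on the outer circle without a passage to the
   limit. *)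
pose s := Num.min d r / 2.
have m0 : 0 < Num.min d r by rewrite lt_min d0.
have s0 : 0 < s by rewrite /s; lra.
have sd : s < d.
  have : Num.min d r <= d by rewrite ge_min lexx.
  by rewrite /s; lra.
have sr : s < r.
  have : Num.min d r <= r by rewrite ge_min lexx orbT.
  by rewrite /s; lra.
pose F w := h (z0 + cexp w).
have cF w : ccont F w.
  apply: (ccont_comp (h := fun w => z0 + cexp w)); last exact: ch.
  by apply: ccontD; [exact: ccont_cst|exact/cdiff_cont/cdiff_cexp].
pose a := ln s; pose b := ln r.
have ab : a <= b by rewrite ler_ln ?posrE// ltW.
have expb : expR b = r by rewrite lnK ?posrE.
have expa : expR a = s by rewrite lnK ?posrE.
have pi0 := pi_gt0 R.
have := @goursat _ F cF a 0 (b - a) (2 * pi) _ _ _.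
rewrite /Lam !add0r [a + _]addrC subrK.
have -> : (fun t => complex.Im (F (t +i* (2 * pi)))) =
          (fun t => complex.Im (F (t +i* 0))).
  apply/funext => t; rewrite /F -(cexp_period (t +i* 0)); congr (complex.Im (h (_ + cexp _))).
  by simpc.
rewrite subrK => G.
have {G} : RI (fun t => complex.Re (F (b +i* t))) 0 (2 * pi) -
  RI (fun t => complex.Re (F (a +i* t))) 0 (2 * pi) = 0.
  apply: G; [lra|lra|move=> x y hx hy].
  apply: (cdiff_comp (h := fun w => z0 + cexp w)).
    by apply: cdiffD; [exact: cdiff_cst|exact: cdiff_cexp].
  apply: dh.
    by rewrite -subr_eq0 addrC addKr cexp_neq0.
  by rewrite addrC addKr cabs_cexp /= -expb ler_expR; lra.
have pp : 0 <= 2 * pi :> R by lra.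
have := RI_le (M := B) (@contA _ F cF b) pp.
have := RI_ge (m := B + e) (@contA _ F cF a) pp.
move=> I1 I2 I3.
have HA t : B + e <= complex.Re (F (a +i* t)).
  have := hd (z0 + cexp (a +i* t)); rewrite addrC addKr cabs_cexp /= expa.
  move=> /(_ sd)/(le_lt_trans (abs_Re_le _)); rewrite ReD ReN -/(F _) ltr_norml.
  move=> /andP[+ _].
  by rewrite /e; clear; lra.
have HB t : complex.Re (F (b +i* t)) <= B.
  by apply: hB; rewrite addrC addKr cabs_cexp.
have {}I1 := I1 (fun t _ => HA t).
have {}I2 := I2 (fun t _ => HB t).
have ep : 0 < e * (2 * pi) by apply: mulr_gt0 => //; rewrite mulr_gt0.
rewrite !subr0 in I1 I2; move: I1 I2 I3 ep.
move: (RI (fun t => complex.Re (F (a +i* t))) _ _) => U.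
move: (RI (fun t => complex.Re (F (b +i* t))) _ _) => V.
clear; move: (e) (B) (pi : R) => e' B' p'; lra.
Qed.

Lemma unimodular_conj z : exists2 c : R[i], cabs c = 1 & c * z = (cabs z)%:C.
Proof.
have [->|z0] := eqVneq z 0.
  by exists 1; rewrite ?cabs1// cabs0 mulr0.
have a0 : cabs z != 0 by rewrite gt_eqF// cabs_gt0.
exists (z^* * ((cabs z)^-1)%:C).
  by rewrite cabsM cabs_conj cabs_real ger0_norm ?invr_ge0 ?cabs_ge0// mulfV.
rewrite mulrAC [z^* * z]mulrC mulc_conj -rmorphM /=.
by rewrite expr2 -mulrA mulfV// mulr1.
Qed.

(** The point [p] is a possible removable singularity, where only continuity is assumed. An interior
    maximum of [|h| + E |z|^2] is refuted by comparing the value at the centre of a small circle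
    with the values on it. *)
Lemma max_principle h p (x1 x2 y1 y2 M : R) : x1 <= x2 -> y1 <= y2 ->
  (forall z, ccont h z) -> (forall z, z != p -> cdiff h z) ->
  (forall x, x1 <= x <= x2 -> cabs (h (x +i* y1)) <= M) ->
  (forall x, x1 <= x <= x2 -> cabs (h (x +i* y2)) <= M) ->
  (forall y, y1 <= y <= y2 -> cabs (h (x1 +i* y)) <= M) ->
  (forall y, y1 <= y <= y2 -> cabs (h (x2 +i* y)) <= M) ->
  forall x y, x1 <= x <= x2 -> y1 <= y <= y2 -> cabs (h (x +i* y)) <= M.
Proof.
move=> x12 y12 ch dh hy1 hy2 hx1 hx2 X Y hX hY; rewrite leNgt; apply/negP => MX.
pose D := (`|x1| + `|x2|) ^+ 2 + (`|y1| + `|y2|) ^+ 2 + 1.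
have D0 : 0 < D by rewrite /D ltr_wpDl// addr_ge0// sqr_ge0.
have sq (c d t : R) : c <= t <= d -> t ^+ 2 <= (`|c| + `|d|) ^+ 2.
  move=> ht; rewrite -[t ^+ 2]real_normK ?num_real// lerXn2r ?nnegrE ?addr_ge0//.
  rewrite ler_norml; have := ler_norm d; have := ler_norm (- c); rewrite normrN.
  by have := normr_ge0 c; have := normr_ge0 d; lra.
have DB a b : x1 <= a <= x2 -> y1 <= b <= y2 -> a ^+ 2 + b ^+ 2 <= D.
  by move=> /sq ha /sq hb; rewrite /D; lra.
clearbody D.
pose E := (cabs (h (X +i* Y)) - M) / (2 * D).
have E0 : 0 < E by rewrite divr_gt0 ?subr_gt0// mulr_gt0.
have ED : E * D < cabs (h (X +i* Y)) - M.
  have -> : cabs (h (X +i* Y)) - M = E * (2 * D).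
    by rewrite divfK// gt_eqF// mulr_gt0.
  by nra.
clearbody E.
(* The term [E |z|^2] makes the maximum strict on average; [E] is so small that [|h|] still exceeds
   [M] at the maximum point, which forces that point into the interior. *)
pose u (t : R * R) := cabs (h (t.1 +i* t.2)) + E * (t.1 ^+ 2 + t.2 ^+ 2).
have cu : continuous u.
  move=> t; apply: cvgD.
    apply/cvgrPdist_lt => e e0; have [d d0 hd] := ch (t.1 +i* t.2) _ e0.
    have d2 : 0 < d / 2 by lra.
    apply: filterS (nbhsx_ballx t _ d2) => s [/= s1 s2].
    have : cabs (s.1 +i* s.2 - t.1 +i* t.2) < d.
      rewrite (le_lt_trans (cabs_le_ReIm _))//=.
      move: s1 s2; rewrite /ball /= distrC => s1; rewrite distrC => s2; lra.
    move=> /hd; apply: le_lt_trans.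
    rewrite ler_norml; have := cabs_tri (h (s.1 +i* s.2)) (h (t.1 +i* t.2)) 0.
    have := cabs_tri (h (t.1 +i* t.2)) (h (s.1 +i* s.2)) 0.
    by rewrite !subr0 [cabs (h (t.1 +i* t.2) - _)]cabsC; lra.
  apply: cvgM; first exact: cvg_cst.
  by apply: cvgD; apply: cvgM; (exact: cvg_fst || exact: cvg_snd).
pose A := `[x1, x2]%classic `*` `[y1, y2]%classic.
have AXY : A (X, Y) by split => /=; rewrite in_itv.
have cA : compact A by apply: compact_setX; exact: segment_compact.
have [[a b] /set_mem[/=]] := compact_EVT_max (ex_intro _ _ AXY) cA (continuous_subspaceT cu).
rewrite !in_itv /= => ha hb umax.
have {}umax x y : x1 <= x <= x2 -> y1 <= y <= y2 -> u (x, y) <= u (a, b).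
  by move=> hx hy; apply: umax; apply/mem_set; split => /=; rewrite in_itv.
have uXY := umax _ _ hX hY.
have XY0 : 0 <= E * (X ^+ 2 + Y ^+ 2).
  by apply: mulr_ge0; [exact: ltW|rewrite addr_ge0// sqr_ge0].
have big : M < cabs (h (a +i* b)).
  have : E * (a ^+ 2 + b ^+ 2) <= E * D by rewrite ler_pM2l// DB.
  move: uXY; rewrite /u /=; lra.
have a1 : x1 < a.
  rewrite lt_neqAle; case/andP: (ha) => -> _; rewrite andbT; apply/eqP => e.
  by move: big; rewrite -e ltNge hx1.
have a2 : a < x2.
  rewrite lt_neqAle; case/andP: (ha) => _ ->; rewrite andbT; apply/eqP => e.
  by move: big; rewrite e ltNge hx2.
have b1 : y1 < b.
  rewrite lt_neqAle; case/andP: (hb) => -> _; rewrite andbT; apply/eqP => e.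
  by move: big; rewrite -e ltNge hy1.
have b2 : b < y2.
  rewrite lt_neqAle; case/andP: (hb) => _ ->; rewrite andbT; apply/eqP => e.
  by move: big; rewrite e ltNge hy2.
pose z0 := a +i* b.
(* [Re_mean_le] exempts the centre only, so the disc must either be centred at [p] or avoid it. *)
pose q := if z0 == p then 1 else cabs (p - z0) / 2.
have q0 : 0 < q.
  rewrite /q; case: eqVneq => // np; rewrite divr_gt0// cabs_gt0// subr_eq0 eq_sym //.
pose r := Num.min q (Num.min (Num.min (a - x1) (x2 - a)) (Num.min (b - y1) (y2 - b))).
have r0 : 0 < r by rewrite !lt_min q0 !subr_gt0 a1 a2 b1 b2.
have rq : r <= q by rewrite ge_min lexx.
have [r1 r2 r3 r4] : [/\ r <= a - x1, r <= x2 - a, r <= b - y1 & r <= y2 - b].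
  by rewrite /r !ge_min !lexx !orbT.
clearbody r.
have [c c1 cz] := unimodular_conj (h z0).
(* From [|z|^2 - |z0|^2 = |z - z0|^2 + 2 Re (conj z0 (z - z0))] and maximality of [u] at [z0], the
   real part of [k] is at most [|h z0| - E r^2] on the circle, while [k z0 = |h z0|]. *)
pose k z := c * h z + (2 * E)%:C * z0^* * (z - z0).
have : complex.Re (k z0) <= cabs (h z0) - E * r ^+ 2.
  apply: (Re_mean_le r0).
  - move=> z; apply: ccontD.
      by apply: ccontM; [exact: ccont_cst|exact: ch].
    by apply: cdiff_cont; apply: cdiffM; [exact: cdiff_cst|];
      apply: cdiffB; [exact: cdiff_id|exact: cdiff_cst].
  - move=> z zz zr; apply: cdiffD; apply: cdiffM; try exact: cdiff_cst.
      apply: dh; apply/eqP => zp; move: rq; rewrite /q -zp eq_sym (negbTE zz).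
      move: (cabs_gt0 (z := z - z0)); rewrite subr_eq0 zz => /(_ isT).
      by move: zr; lra.
    by apply: cdiffB; [exact: cdiff_id|exact: cdiff_cst].
  - case=> x y zr.
    have zx : `|x - a| <= r by rewrite -zr (le_trans _ (abs_Re_le _)).
    have zy : `|y - b| <= r by rewrite -zr (le_trans _ (abs_Im_le _)).
    have hx : x1 <= x <= x2 by move: zx; rewrite ler_norml; lra.
    have hy : y1 <= y <= y2 by move: zy; rewrite ler_norml; lra.
    have := umax _ _ hx hy; rewrite /u /=.
    have zr2 : (x - a) ^+ 2 + (y - b) ^+ 2 = r ^+ 2 by rewrite -zr cabs_sqr.
    have : complex.Re (c * h (x +i* y)) <= cabs (h (x +i* y)).
      by rewrite (le_trans (ler_norm _))// (le_trans (abs_Re_le _))// cabsM c1 mul1r.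
    rewrite /k ReD; set P := complex.Re (c * _); set Q := cabs _.
    have -> : complex.Re ((2 * E)%:C * z0^* * (x +i* y - z0)) =
       E * (2 * a * (x - a) + 2 * b * (y - b)) by rewrite !(ReM, ImM) /=; ring.
    rewrite -zr2 -/z0; set H0 := cabs (h z0); nra.
rewrite /k subrr mulr0 addr0 cz /=.
have : 0 < E * r ^+ 2 by rewrite mulr_gt0// exprn_gt0.
lra.
Qed.

End MaximumPrinciple.

(** * Exponential growth on rectangles and the local Bernstein inequality *)

Section Growth.
Context {R : realType}.
Implicit Types (g h : R[i] -> R[i]) (z w : R[i]).

(** The factor [cexp (i k z)] has modulus [expR (- (k * y))], which reduces the exponential bounds
    to the maximum principle with the constant [A]. *)
Lemma rect_growth g (k x1 x2 H A : R) : x1 <= x2 -> 0 <= H ->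
  (forall z, cdiff g z) ->
  (forall x, x1 <= x <= x2 -> cabs (g (x +i* 0)) <= A) ->
  (forall x, x1 <= x <= x2 -> cabs (g (x +i* H)) <= A * expR (k * H)) ->
  (forall y, 0 <= y <= H -> cabs (g (x1 +i* y)) <= A * expR (k * y)) ->
  (forall y, 0 <= y <= H -> cabs (g (x2 +i* y)) <= A * expR (k * y)) ->
  forall x y, x1 <= x <= x2 -> 0 <= y <= H ->
    cabs (g (x +i* y)) <= A * expR (k * y).
Proof.
move=> x12 H0 dg gb gt g1 g2 x y hx hy.
pose f z := g z * cexp ((0 +i* k) * z).
have df z : cdiff f z.
  apply: cdiffM => //; apply: (cdiff_comp (h := fun w => (0 +i* k) * w)).
    by apply: cdiffM; [exact: cdiff_cst|exact: cdiff_id].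
  exact: cdiff_cexp.
have fE a b : cabs (f (a +i* b)) = cabs (g (a +i* b)) * expR (- (k * b)).
  by rewrite cabsM cabs_cexp ReM /= mul0r sub0r.
have key a b : (cabs (f (a +i* b)) <= A) =
               (cabs (g (a +i* b)) <= A * expR (k * b)).
  by rewrite fE expRN ler_pdivrMr ?expR_gt0.
rewrite -key; apply: (max_principle (p := 0) x12 H0) hx hy => //.
- by move=> z; exact: cdiff_cont.
- by move=> a ha; rewrite key mulr0 expR0 mulr1; exact: gb.
- by move=> a ha; rewrite key; exact: gt.
- by move=> b hb; rewrite key; exact: g1.
- by move=> b hb; rewrite key; exact: g2.
Qed.

(** This removes a damping parameter [b] by letting it tend to 0; the quantitative input is
    [e^t (1 - t) <= 1]. *)
Lemma ler_expR_lim (a K c : R) : 0 <= K ->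
  (exists2 b0, 0 < b0 & forall b, 0 < b -> b < b0 -> a <= K * expR (b * c)) ->
  a <= K.
Proof.
move=> K0 [b0 b00 H]; rewrite leNgt; apply/negP => Ka.
have a0 : 0 < a by rewrite (le_lt_trans K0).
pose c' := `|c| + 1.
have c0 : 0 < c' by rewrite /c' ltr_wpDl.
have cc : c <= c' by rewrite /c' (le_trans (ler_norm c))// lerDl.
pose b := Num.min (b0 / 2) ((a - K) / (2 * a * c')).
have bgt : 0 < b.
  by rewrite lt_min divr_gt0//= divr_gt0 ?subr_gt0// !mulr_gt0.
have bb : b < b0.
  by rewrite /b gt_min; apply/orP; left; rewrite ltr_pdivrMr// ltr_pMr// ltr1n.
have b2 : b * (2 * a * c') <= a - K.
  by rewrite -ler_pdivlMr ?mulr_gt0// /b ge_min lexx orbT.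
clearbody b c'.
have := H _ bgt bb; rewrite leNgt => /negP; apply.
have bc : b * c' < 1.
  by rewrite -(ltr_pM2l (x := 2 * a)) ?mulr_gt0//; clear -b2 a0 Ka K0; nra.
have h1 : expR (b * c) <= expR (b * c') by rewrite ler_expR ler_pM2l.
have h2 : expR (b * c') * (1 - b * c') <= 1.
  have := expR_ge1Dx (- (b * c')); rewrite -(ler_pM2l (expR_gt0 (b * c'))).
  by rewrite expRN mulfV// gt_eqF// expR_gt0.
have h3 := expR_gt0 (b * c').
have h4 : K < a * (1 - b * c') by clear -b2 a0 Ka K0; nra.
have h5 : K * expR (b * c) <= K * expR (b * c') by rewrite ler_wpM2l.
apply: (le_lt_trans h5); apply: (@lt_le_trans _ _ (a * (1 - b * c') * expR (b * c'))).
  by rewrite ltr_pM2r.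
rewrite -mulrA ger_pMr// mulrC //.
Qed.

Lemma cdiff_near h g z (r : R) : 0 < r ->
  (forall w, cabs (w - z) < r -> h w = g w) -> cdiff h z -> cdiff g z.
Proof.
move=> r0 hg [q cq hq].
exists (fun w => if cabs (w - z) < r then q w else (g w - g z) / (w - z)).
  apply: (ccont_near r0) cq => w wr; by rewrite wr.
move=> w; case: ltP => wr.
  by rewrite -!hg ?subrr ?cabs0.
rewrite divfK//; apply/eqP => wz; move: wr; rewrite wz cabs0; lra.
Qed.

(* The maximum principle for [(g (x + z) - g (x - z)) / z] on a square; the
   symmetric difference gives the constant [e]. *)
Lemma local_bernstein g (k A x h : R) : 0 < k -> 0 <= A -> (forall z, cdiff g z) ->
  (forall a b, `|a| <= k^-1 -> `|b| <= k^-1 ->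
    cabs (g ((x + a) +i* b)) <= A * expR (k * `|b|)) ->
  `|h| <= k^-1 ->
  cabs (g (x + h)%:C - g (x - h)%:C) <= 2 * `|h| * expR 1 * k * A.
Proof.
move=> k0 A0 dg gA hk.
pose r := k^-1; have r0 : 0 < r by rewrite invr_gt0.
pose d z := g (x%:C + z) - g (x%:C - z).
have dd z : cdiff d z.
  apply: cdiffB.
    apply: (cdiff_comp (h := fun w => x%:C + w)) => //.
    by apply: cdiffD; [exact: cdiff_cst|exact: cdiff_id].
  apply: (cdiff_comp (h := fun w => x%:C - w)) => //.
  by apply: cdiffB; [exact: cdiff_cst|exact: cdiff_id].
(* Since [d 0 = 0], Caratheodory's quotient is [d z / z] continued to 0, and 0 is the exceptional
   point allowed by [max_principle]. *)
have [Q cQ hQ] := dd 0.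
have {}hQ w : d w = Q w * w.
  by have := hQ w; rewrite /d subr0 addr0 subrr !subr0.
have dQ z : z != 0 -> cdiff Q z.
  move=> z0; apply: (@cdiff_near (fun w => d w * w^-1) _ _ (cabs z)).
  - exact: cabs_gt0.
  - move=> w wz; rewrite hQ mulfK//.
    by apply/eqP => w0; move: wz; rewrite w0 sub0r cabsN ltxx.
  - by apply: cdiffM => //; exact: cdiffV.
(* On the boundary of the square [|z| >= k^-1], and [|b| <= k^-1] bounds the growth factor by
   [expR 1]. *)
have bd a b : `|a| <= r -> `|b| <= r -> r <= cabs (a +i* b) ->
    cabs (Q (a +i* b)) <= 2 * expR 1 * k * A.
  move=> ha hb hr.
  have ab0 : 0 < cabs (a +i* b) by rewrite (lt_le_trans r0).
  have : cabs (d (a +i* b)) <= 2 * expR 1 * A.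
    rewrite /d; apply: (le_trans (cabsB _ _)).
    have e1 : x%:C + (a +i* b) = ((x + a) +i* b) by simpc.
    have e2 : x%:C - (a +i* b) = ((x + - a) +i* (- b)) by simpc.
    have eb : A * expR (k * `|b|) <= A * expR 1.
      by rewrite ler_wpM2l// ler_expR -(mulfV (lt0r_neq0 k0)) ler_pM2l.
    have := gA _ _ ha hb; rewrite e1 e2.
    have := gA (- a) (- b); rewrite !normrN => /(_ ha hb).
    clear -eb; lra.
  rewrite hQ cabsM => h1.
  have : cabs (Q (a +i* b)) * r <= 2 * expR 1 * A.
    by rewrite (le_trans _ h1)// ler_wpM2l// cabs_ge0.
  by rewrite -ler_pdivlMr// invrK => /le_trans; apply; rewrite mulrAC.
have rr : - r <= r by lra.
have cQQ z : ccont Q z.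
  by have [->//|z0] := eqVneq z 0; exact/cdiff_cont/dQ.
have e1 (t : R) : - r <= t <= r -> `|t| <= r by rewrite ler_norml.
have nr : `|r| = r by rewrite ger0_norm// ltW.
have nNr : `|- r| = r by rewrite normrN.
have e2 (a b : R) : `|a| = r -> r <= cabs (a +i* b).
  by move=> <-; exact: (abs_Re_le (a +i* b)).
have e3 (a b : R) : `|b| = r -> r <= cabs (a +i* b).
  by move=> <-; exact: (abs_Im_le (a +i* b)).
have QH : cabs (Q (h +i* 0)) <= 2 * expR 1 * k * A.
  apply: (max_principle (p := 0) rr rr) => //.
  - by move=> t /e1 ht; apply: bd; rewrite ?nNr ?lexx//; exact: e3.
  - by move=> t /e1 ht; apply: bd; rewrite ?nr ?lexx//; exact: e3.
  - by move=> t /e1 ht; apply: bd; rewrite ?nNr ?lexx//; exact: e2.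
  - by move=> t /e1 ht; apply: bd; rewrite ?nr ?lexx//; exact: e2.
  - by rewrite -ler_norml.
  - by rewrite -ler_norml normr0 ltW.
have -> : g (x + h)%:C - g (x - h)%:C = d h%:C.
  by rewrite /d; congr (g _ - g _); simpc.
rewrite hQ cabsM cabs_real.
have -> : 2 * `|h| * expR 1 * k * A = 2 * expR 1 * k * A * `|h| by ring.
by rewrite ler_wpM2r.
Qed.

End Growth.

(** * The Phragmen-Lindelof bound in a half-plane *)

Section PhragmenLindelof.
Context {R : realType}.
Implicit Types (phi : R[i] -> R[i]) (z : R[i]).

Definition gauss (b : R) z := cexp (- (b%:C * z * z)).

Lemma cdiff_gauss b z : cdiff (gauss b) z.
Proof.
apply: (cdiff_comp (h := fun w => - (b%:C * w * w))); last exact: cdiff_cexp.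
apply: cdiffN; apply: cdiffM; last exact: cdiff_id.
by apply: cdiffM; [exact: cdiff_cst|exact: cdiff_id].
Qed.

Lemma cabs_gauss (b x y : R) :
  cabs (gauss b (x +i* y)) = expR (b * y ^+ 2 - b * x ^+ 2).
Proof.
rewrite cabs_cexp; congr expR; rewrite !(ReN, ReM, ImM) /=; ring.
Qed.

Lemma cabs_le_xy (x y : R) : cabs (x +i* y) <= `|x| + `|y|.
Proof. exact: (cabs_le_ReIm (x +i* y)). Qed.

Lemma cdiff_opp phi : (forall z, cdiff phi z) -> forall z, cdiff (fun w => phi (- w)) z.
Proof.
move=> dphi z; apply: (cdiff_comp (h := fun w => - w)) => //.
by apply: cdiffN; exact: cdiff_id.
Qed.

Definition PLhyp (s C M : R) phi := [/\ 0 < s, 0 <= C & 0 <= M] /\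
  [/\ forall z, cdiff phi z,
  forall z, cabs (phi z) <= C * expR (s * cabs z) &
  forall x : R, cabs (phi x%:C) <= M].

Lemma PLhyp_opp s C M phi : PLhyp s C M phi -> PLhyp s C M (fun z => phi (- z)).
Proof.
move=> [pos [dphi phiC phiM]]; split=> //; split; first exact: cdiff_opp.
  by move=> z; rewrite -(cabsN z).
by move=> x; have := phiM (- x); congr (cabs (phi _) <= _); simpc; rewrite ?oppr0.
Qed.

(** Damping by [gauss b] on [[-r, r] x [0, r]] with [b r = 2 s]: on the vertical sides
    [b r^2 = 2 s r] outweighs the growth, and on top the growth of the Gaussian itself costs
    [2 s r], which is why the exponent is only [4 s]. This exponent does not depend on [b], so [b]
    can tend to 0. *)
Lemma PL_coarse_up s C M phi x y : PLhyp s C M phi -> 0 <= y ->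
  cabs (phi (x +i* y)) <= Num.max M C * expR (4 * s * y).
Proof.
move=> [[s0 C0 M0] [dphi phiC phiM]] y0.
pose A := Num.max M C; rewrite -/A.
have MA : M <= A by rewrite /A le_max lexx.
have CA : C <= A by rewrite /A le_max lexx orbT.
have A0 : 0 <= A by exact: le_trans MA.
clearbody A.
apply: (@ler_expR_lim _ _ _ (x ^+ 2 - y ^+ 2)).
  by rewrite mulr_ge0// expR_ge0.
pose m := `|x| + y + 1.
have m0 : 0 < m by rewrite /m ltr_wpDl// addr_ge0.
exists (2 * s / m) => [|b b0 bm]; first by rewrite divr_gt0// mulr_gt0.
pose r := 2 * s / b; have br : b * r = 2 * s by rewrite /r mulrC divfK// gt_eqF.
have r0 : 0 < r by rewrite divr_gt0// mulr_gt0.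
have mr : m <= r by rewrite /r ler_pdivlMr// mulrC -ler_pdivlMr// ltW.
have [xr yr] : `|x| <= r /\ y <= r.
  by have := normr_ge0 x; rewrite /m in mr; split; lra.
suff H : cabs (phi (x +i* y) * gauss b (x +i* y)) <= A * expR (4 * s * y).
  move: H; rewrite cabsM cabs_gauss mulrBr -(opprB (b * x ^+ 2)) expRN.
  by rewrite ler_pdivrMr ?expR_gt0.
clearbody r; clear m m0 bm mr.
have nr : `|r| = r by rewrite ger0_norm// ltW.
have side (a t : R) : `|a| = r -> 0 <= t <= r ->
    cabs (phi (a +i* t) * gauss b (a +i* t)) <= A * expR (4 * s * t).
  move=> ar /andP[t0 tr]; rewrite cabsM cabs_gauss.
  apply: (le_trans (ler_wpM2r (expR_ge0 _) (phiC _))).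
  rewrite -[leLHS]mulrA -expRD; apply: ler_pM; [exact: C0|exact: expR_ge0|exact: CA|].
  rewrite ler_expR.
  have : s * cabs (a +i* t) <= s * (r + t).
    by rewrite ler_pM2l// (le_trans (cabs_le_xy _ _))// ar (ger0_norm t0).
  have -> : b * a ^+ 2 = 2 * s * r by rewrite -real_normK ?num_real// ar expr2 mulrA br.
  have : b * t ^+ 2 <= 2 * s * t by rewrite -br expr2 mulrA ler_wpM2r// ler_pM2l.
  by have := mulr_gt0 s0 r0; have := mulr_ge0 (ltW s0) t0; clear; lra.
apply: (@rect_growth _ (fun z => phi z * gauss b z) _ (- r) r r) => //.
- lra.
- exact: ltW.
- by move=> z; apply: cdiffM => //; exact: cdiff_gauss.
- move=> a ha; rewrite cabsM cabs_gauss expr0n /= mulr0 sub0r.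
  apply: (le_trans _ MA); rewrite -[M]mulr1; apply: ler_pM; rewrite ?cabs_ge0 ?expR_ge0//.
    exact: phiM.
  by rewrite -expR0 ler_expR oppr_le0 mulr_ge0 ?sqr_ge0// ltW.
- move=> a ha; rewrite cabsM cabs_gauss.
  apply: (le_trans (ler_wpM2r (expR_ge0 _) (phiC _))).
  rewrite -[leLHS]mulrA -expRD; apply: ler_pM; [exact: C0|exact: expR_ge0|exact: CA|].
  rewrite ler_expR.
  have : s * cabs (a +i* r) <= s * (`|a| + r).
    by rewrite ler_pM2l// (le_trans (cabs_le_xy _ _))// nr.
  have -> : b * r ^+ 2 = 2 * s * r by rewrite expr2 mulrA br.
  have -> : b * a ^+ 2 = b * `|a| ^+ 2 by rewrite real_normK ?num_real.
  (* This says [s |a| - b a^2 <= s r / 8]; by [b r = 2 s] it is a perfect square. *)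
  have : s * r - 8 * s * `|a| + 8 * (b * `|a| ^+ 2) >= 0.
    have -> : s * r - 8 * s * `|a| + 8 * (b * `|a| ^+ 2) =
       (b * r * r / 2 - 4 * (b * r) * `|a| + 8 * b * `|a| ^+ 2) by rewrite br; field.
    have -> : b * r * r / 2 - 4 * (b * r) * `|a| + 8 * b * `|a| ^+ 2 =
       b / 2 * (r - 4 * `|a|) ^+ 2 by field.
    by rewrite mulr_ge0 ?sqr_ge0// divr_ge0// ltW.
  by have := mulr_gt0 s0 r0; clear; lra.
- by move=> t; apply: side; rewrite normrN.
- by move=> t; apply: side.
- by rewrite -ler_norml.
- by rewrite y0.
Qed.

(* In the quadrant [0 <= t * x], [0 <= y] (with t = 1 or t = -1) the factor
   [exp (i t eps z^2)] beats the coarse bound on the far sides and has modulus 1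
   on the axes. *)
Lemma PL_quadrant s C M phi (t x y : R) : PLhyp s C M phi -> t = 1 \/ t = -1 ->
  0 <= t * x -> 0 <= y ->
  cabs (phi (x +i* y)) <= Num.max M C * expR (s * y).
Proof.
move=> hphi ht tx y0; have coarse := fun a b => PL_coarse_up a (y := b) hphi.
case: hphi => [[s0 C0 M0] [dphi phiC phiM]].
pose A := Num.max M C; rewrite -/A in coarse *.
have MA : M <= A by rewrite /A le_max lexx.
have CA : C <= A by rewrite /A le_max lexx orbT.
have A0 : 0 <= A by exact: le_trans MA.
clearbody A.
apply: (@ler_expR_lim _ _ _ (2 * (t * x) * y)).
  by rewrite mulr_ge0// expR_ge0.
exists 1 => // e e0 _.
(* With [e r >= 2 s] the factor is at most [expR (- 4 s b)] at height [b] on the far vertical side,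
   which cancels the coarse bound there. *)
pose r := Num.max (Num.max `|x| y) (2 * s / e).
have [xr yr er] : [/\ `|x| <= r, y <= r & 2 * s / e <= r].
  by rewrite /r !le_max !lexx !orbT.
clearbody r.
have {}er : 2 * s <= e * r by rewrite [e * r]mulrC -ler_pdivrMr.
have r0 : 0 <= r by rewrite (le_trans y0).
have t2 : t * t = 1 by case: ht => ->; ring.
pose g z := cexp ((0 +i* (t * e)) * z * z).
have gE a b : cabs (g (a +i* b)) = expR (- (2 * e * (t * a) * b)).
  by rewrite cabs_cexp; congr expR; rewrite !(ReM, ImM) /=; ring.
suff H : cabs (phi (x +i* y) * g (x +i* y)) <= A * expR (s * y).
  move: H; rewrite cabsM gE expRN ler_pdivrMr ?expR_gt0//.
  by congr (_ <= _ * expR _); ring.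
have dg z : cdiff (fun w => phi w * g w) z.
  apply: cdiffM => //.
  apply: (cdiff_comp (h := fun w => (0 +i* (t * e)) * w * w)); last exact: cdiff_cexp.
  apply: cdiffM; last exact: cdiff_id.
  by apply: cdiffM; [exact: cdiff_cst|exact: cdiff_id].
have bottom a : 0 <= t * a -> cabs (phi (a +i* 0) * g (a +i* 0)) <= A.
  by move=> _; rewrite cabsM gE mulr0 oppr0 expR0 mulr1 (le_trans _ MA)//; exact: phiM.
have top a : 0 <= t * a -> cabs (phi (a +i* r) * g (a +i* r)) <= A * expR (s * r).
  move=> ta; rewrite cabsM gE.
  apply: (le_trans (ler_wpM2r (expR_ge0 _) (phiC _))).
  rewrite -[leLHS]mulrA -expRD; apply: ler_pM; [exact: C0|exact: expR_ge0|exact: CA|].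
  rewrite ler_expR.
  have aE : `|a| = t * a.
    by rewrite -(ger0_norm ta) normrM; case: ht => ->; rewrite ?normrN normr1 mul1r.
  have : s * cabs (a +i* r) <= s * (t * a + r).
    by rewrite ler_pM2l// (le_trans (cabs_le_xy _ _))// aE (ger0_norm r0).
  have : s * (t * a) <= 2 * e * (t * a) * r.
    have := ler_wpM2r ta er; have := mulr_ge0 (ltW s0) ta; clear; lra.
  by clear; lra.
have side0 b : 0 <= b <= r -> cabs (phi (0 +i* b) * g (0 +i* b)) <= A * expR (s * b).
  move=> /andP[b0 _]; rewrite cabsM gE !mulr0 mul0r oppr0 expR0 mulr1.
  apply: (le_trans (phiC _)); apply: ler_pM; [exact: C0|exact: expR_ge0|exact: CA|].
  by rewrite ler_expR ler_pM2l// (le_trans (cabs_le_xy _ _))// normr0 add0r ger0_norm.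
have sider b : 0 <= b <= r ->
    cabs (phi (t * r +i* b) * g (t * r +i* b)) <= A * expR (s * b).
  move=> /andP[b0 _]; rewrite cabsM gE.
  apply: (le_trans (ler_wpM2r (expR_ge0 _) (coarse _ _ b0))).
  rewrite -[leLHS]mulrA -expRD ler_wpM2l// ler_expR mulrA t2 mul1r.
  have := ler_wpM2r b0 er; have := mulr_ge0 (ltW s0) b0; clear; lra.
case: ht => ht; rewrite ht ?mul1r ?mulN1r in sider tx.
  apply: (@rect_growth _ (fun z => phi z * g z) _ 0 r r) => //.
  - by move=> a /andP[a0 _]; apply: bottom; rewrite ht mul1r.
  - by move=> a /andP[a0 _]; apply: top; rewrite ht mul1r.
  - by rewrite tx (le_trans (ler_norm x)).
  - by rewrite y0.
apply: (@rect_growth _ (fun z => phi z * g z) _ (- r) 0 r) => //.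
- by rewrite oppr_le0.
- by move=> a /andP[_ a0]; apply: bottom; rewrite ht mulN1r oppr_ge0.
- by move=> a /andP[_ a0]; apply: top; rewrite ht mulN1r oppr_ge0.
- by rewrite -oppr_ge0 tx andbT lerNl (le_trans _ xr)// -normrN ler_norm.
- by rewrite y0.
Qed.

(** It remains to replace the constant [A = M e^L] by [M]. On a rectangle of height [H = e^-1] the
    exponent is raised to [k = s + L e + e]: at the top the surplus [L e H = L] pays for [A] and
    [e H = 1] pays for the growth of the Gaussian, as [b H^2 = 1]. Then [e] tends to 0. *)
Lemma PL_up s C M phi x y : PLhyp s C M phi -> 0 < M -> 0 <= y ->
  cabs (phi (x +i* y)) <= M * expR (s * y).
Proof.
move=> hphi M1 y0.
have half a b : 0 <= b -> cabs (phi (a +i* b)) <= Num.max M C * expR (s * b).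
  move=> b0; case: (leP 0 a) => a0.
    by apply: (PL_quadrant (t := 1)) => //; [left|rewrite mul1r].
  by apply: (PL_quadrant (t := -1)) => //; [right|rewrite mulN1r oppr_ge0 ltW].
case: hphi => [[s0 C0 M0] [dphi phiC phiM]].
pose A := Num.max M C; rewrite -/A in half *.
have MA : M <= A by rewrite /A le_max lexx.
have CA : C <= A by rewrite /A le_max lexx orbT.
clearbody A.
have A1 : 0 < A by exact: lt_le_trans MA.
pose L := ln (A / M).
have AL : A = M * expR L.
  by rewrite /L lnK ?posrE ?divr_gt0// mulrC divfK// gt_eqF.
have L0 : 0 <= L by rewrite ln_ge0// ler_pdivlMr// mul1r.
clearbody L.
apply: (@ler_expR_lim _ _ _ ((L + 1) * y + x ^+ 2)).
  by rewrite mulr_ge0// expR_ge0.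
exists (Num.min 1 (1 + y)^-1) => [|e e0].
  by rewrite lt_min ltr01 invr_gt0 ltr_wpDr.
rewrite lt_min => /andP[e1 ey].
pose H := e^-1; have H0 : 0 < H by rewrite invr_gt0.
have yH : y <= H.
  have : 1 + y < e^-1 by rewrite -[1 + y]invrK ltf_pV2 ?posrE// invr_gt0 ltr_wpDr.
  by rewrite /H; lra.
pose b := e ^+ 2.
have bH2 : b * H ^+ 2 = 1 by rewrite /b /H -exprMn mulfV ?expr1n// gt_eqF.
have b0 : 0 < b by rewrite exprn_gt0.
have be : b <= e by rewrite /b expr2 ger_pMr// ltW.
clearbody b.
pose k := s + L * e + e.
have kH : k * H = s * H + L + 1.
  by rewrite /k /H; field; rewrite gt_eqF.
pose r := Num.max `|x| ((L + 1) / b + 1).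
have [xr br] : `|x| <= r /\ (L + 1) / b + 1 <= r.
  by rewrite /r !le_max !lexx !orbT.
have Lb : 0 <= (L + 1) / b by rewrite divr_ge0// ?ltW// ltr_wpDl.
have r1 : 1 <= r by lra.
have {}br : L + 1 <= b * r ^+ 2.
  rewrite mulrC -ler_pdivrMr//; have : (L + 1) / b <= r by lra.
  by move/le_trans; apply; rewrite expr2 ler_peMr//; lra.
clearbody r.
suff : cabs (phi (x +i* y) * gauss b (x +i* y)) <= M * expR (k * y).
  rewrite cabsM cabs_gauss -(opprB (b * x ^+ 2)) expRN.
  rewrite ler_pdivrMr ?expR_gt0// => /le_trans; apply.
  rewrite -!mulrA ler_pM2l// -!expRD ler_expR /k.
  have : b * x ^+ 2 <= e * x ^+ 2.
    by rewrite ler_wpM2r ?sqr_ge0.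
  have : 0 <= b * y ^+ 2 by rewrite mulr_ge0 ?sqr_ge0// ltW.
  by clear; lra.
have nr : `|r| = r by rewrite ger0_norm//; lra.
have side (a t : R) : `|a| = r -> 0 <= t <= H ->
    cabs (phi (a +i* t) * gauss b (a +i* t)) <= M * expR (k * t).
  move=> ar /andP[t0 tr]; rewrite cabsM cabs_gauss.
  apply: (le_trans (ler_wpM2r (expR_ge0 _) (half _ _ t0))).
  rewrite AL -!mulrA ler_pM2l// -!expRD ler_expR /k.
  have -> : b * a ^+ 2 = b * r ^+ 2 by rewrite -real_normK ?num_real// ar.
  have : b * t ^+ 2 <= 1 by rewrite -bH2 ler_pM2l// lerXn2r ?nnegrE// ltW.
  have := mulr_ge0 (mulr_ge0 L0 (ltW e0)) t0; have := mulr_ge0 (ltW e0) t0.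
  by clear -br; lra.
apply: (@rect_growth _ (fun z => phi z * gauss b z) _ (- r) r H) => //.
- lra.
- exact: ltW.
- by move=> z; apply: cdiffM => //; exact: cdiff_gauss.
- move=> a ha; rewrite cabsM cabs_gauss expr0n /= mulr0 sub0r.
  rewrite -[M]mulr1; apply: ler_pM; rewrite ?cabs_ge0 ?expR_ge0//.
    exact: phiM.
  by rewrite -expR0 ler_expR oppr_le0 mulr_ge0 ?sqr_ge0// ltW.
- move=> a ha; rewrite cabsM cabs_gauss.
  apply: (le_trans (ler_wpM2r (expR_ge0 _) (half _ _ (ltW H0)))).
  rewrite AL -!mulrA ler_pM2l// -!expRD ler_expR kH bH2.
  have : 0 <= b * a ^+ 2 by rewrite mulr_ge0 ?sqr_ge0// ltW.
  by clear; lra.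
- by move=> t; apply: side; rewrite normrN.
- by move=> t; apply: side.
- by rewrite -ler_norml.
- by rewrite y0.
Qed.

End PhragmenLindelof.

(** * Bernstein's inequality in one variable *)

Section Bernstein.
Context {R : realType}.
Implicit Types (phi : R[i] -> R[i]) (z : R[i]).

Definition etype (s : R) phi := (forall z, cdiff phi z) /\
  forall e, 0 < e -> exists C, forall z, cabs (phi z) <= C * expR (s * (1 + e) * cabs z).

(** [PL_up] wants a positive bound and a fixed growth exponent; [M + d] and [s * (1 + e)] supply
    them and both parameters are sent to 0. The lower half-plane is reached through [z |-> - z]. *)
Lemma phragmen_lindelof (s M : R) phi (x y : R) : 0 < s -> etype s phi ->
  (forall x : R, cabs (phi x%:C) <= M) ->
  cabs (phi (x +i* y)) <= M * expR (s * `|y|).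
Proof.
move=> s0 [dphi tphi] phiM.
have M0 : 0 <= M by rewrite (le_trans _ (phiM 0))// cabs_ge0.
suff H e d : 0 < e -> 0 < d ->
    cabs (phi (x +i* y)) <= (M + d) * expR (s * (1 + e) * `|y|).
  apply: (@ler_expR_lim _ _ _ (s * `|y|)); first by rewrite mulr_ge0// expR_ge0.
  exists 1 => // e e0 _.
  have -> : M * expR (s * `|y|) * expR (e * (s * `|y|)) = M * expR (s * (1 + e) * `|y|).
    by rewrite -mulrA -expRD; congr (_ * expR _); ring.
  set E := expR _; have E0 : 0 < E := expR_gt0 _.
  apply/ler_addgt0Pr => d d0.
  have -> : M * E + d = (M + d / E) * E by field; rewrite gt_eqF.
  by apply: H => //; rewrite divr_gt0.
move=> e0 d0; have [C HC] := tphi _ e0.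
have C0 : 0 <= C.
  have := HC 0; rewrite cabs0 mulr0 expR0 mulr1 => /(le_trans _); apply.
  exact: cabs_ge0.
have se : 0 < s * (1 + e) by rewrite mulr_gt0//; lra.
have Md : 0 < M + d by lra.
have hphi : PLhyp (s * (1 + e)) C (M + d) phi.
  by split; split => //; [exact: ltW|move=> t; rewrite (le_trans (phiM t))//; lra].
case: (leP 0 y) => y0.
  by rewrite ger0_norm//; apply: PL_up hphi Md y0.
rewrite ltr0_norm//; have yN : 0 <= - y by lra.
have := PL_up (- x) (PLhyp_opp hphi) Md yN.
by congr (cabs (phi _) <= _); simpc.
Qed.

Lemma expR1_ge2 : 2 <= expR 1 :> R.
Proof. by have := expR_ge1Dx (1 : R); rewrite -natr1. Qed.

(** Short steps are covered by [local_bernstein], centred at the midpoint. For [|h / 2| > s^-1] the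
    trivial bound [2 M] is enough because [2 <= expR 1]. *)
Lemma bernstein (s M : R) phi (x h : R) : 0 < s -> etype s phi ->
  (forall x : R, cabs (phi x%:C) <= M) ->
  cabs (phi (x + h)%:C - phi x%:C) <= expR 1 * s * `|h| * M.
Proof.
move=> s0 tphi phiM.
have M0 : 0 <= M by rewrite (le_trans _ (phiM 0))// cabs_ge0.
have [hs|hs] := leP (`|h / 2|) s^-1.
  have := @local_bernstein R phi s M (x + h / 2) (h / 2) s0 M0 tphi.1.
  have -> : x + h / 2 + h / 2 = x + h by field.
  have -> : x + h / 2 - h / 2 = x by ring.
  have -> : 2 * `|h / 2| * expR 1 * s * M = expR 1 * s * `|h| * M.
    by rewrite normrM normfV [ `|2|]ger0_norm//; field.
  by apply => // a b _ _; exact: phragmen_lindelof.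
apply: (le_trans (cabsB _ _)); apply: (le_trans (lerD (phiM _) (phiM _))).
rewrite -mulr2n -[M *+ 2]mulr_natl ler_wpM2r//.
have hs1 : 1 <= s * `|h|.
  move: hs; rewrite normrM normfV [ `|2|]ger0_norm// -div1r ltr_pdivrMr// => hs.
  by have := mulr_ge0 (ltW s0) (normr_ge0 h); move: hs; clear; lra.
rewrite -mulrA; apply: (le_trans expR1_ge2).
by rewrite ler_peMr// expR_ge0.
Qed.

End Bernstein.

(** * Bernstein's inequality in several variables *)

Section Slices.
Context {R : realType} {m : nat}.

Definition upd (T : Type) (x : m.-tuple T) (j : 'I_m) (t : T) : m.-tuple T :=
  [tuple (if i == j then t else tnth x i) | i < m].

Lemma upd_id (T : Type) (x : m.-tuple T) j : upd x j (tnth x j) = x.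
Proof.
by apply: eq_from_tnth => i; rewrite tnth_mktuple; case: eqP => // ->.
Qed.

Lemma tnth_embedC (x : m.-tuple R) i : tnth (embedC x) i = (tnth x i)%:C.
Proof. by rewrite tnth_map. Qed.

Lemma embedC_upd (x : m.-tuple R) j t : embedC (upd x j t) = upd (embedC x) j t%:C.
Proof.
by apply: eq_from_tnth => i; rewrite tnth_embedC !tnth_mktuple; case: eqP => //; rewrite tnth_embedC.
Qed.

Variable f : m.-tuple R[i] -> R[i].

Lemma slice_cdiff z j w : entire f -> cdiff (fun zeta => f (upd z j zeta)) w.
Proof.
move=> [_ df]; have [L HL] := df (upd z j w) j.
apply: (@cdiffP _ _ _ L) => e /HL[d d0 hd]; exists d => // k k0 kd.
have -> : upd z j (w + k) = shift_coord (upd z j w) j k.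
  by apply: eq_from_tnth => i; rewrite !tnth_mktuple; case: eqP.
exact: hd.
Qed.

Definition gbound (C s : R) :=
  forall z, cabs (f z) <= C * expR (s * \sum_(j < m) cabs (tnth z j)).

Lemma gbound_ge0 C s : gbound C s -> 0 <= C.
Proof.
move=> /(_ [tuple 0 | i < m]) /(le_trans (cabs_ge0 _)).
by rewrite pmulr_lge0// expR_gt0.
Qed.

Lemma sum_upd (z : m.-tuple R[i]) j zeta :
  \sum_(i < m) cabs (tnth (upd z j zeta) i) =
  cabs zeta + \sum_(i < m | i != j) cabs (tnth z i).
Proof.
rewrite (bigD1 j)//= tnth_mktuple eqxx; congr (_ + _).
by apply: eq_bigr => i /negbTE ij; rewrite tnth_mktuple ij.
Qed.

Lemma slice_etype s z j (a : R[i]) : 0 < s -> exp_type s f ->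
  etype s (fun zeta => f (upd z j (a + zeta))).
Proof.
move=> s0 [ef gf]; split=> [w|e e0].
  apply: (cdiff_comp (h := fun w => a + w) (g := fun w => f (upd z j w))).
    by apply: cdiffD; [exact: cdiff_cst|exact: cdiff_id].
  exact: slice_cdiff.
have [C HC] := gf _ e0.
exists (C * expR (s * (1 + e) * (cabs a + \sum_(i < m | i != j) cabs (tnth z i)))) => w.
apply: (le_trans (HC _)); rewrite -[leRHS]mulrA -expRD.
apply: ler_wpM2l; first exact: gbound_ge0 HC.
rewrite ler_expR -mulrDr ler_pM2l ?mulr_gt0//; last by lra.
rewrite sum_upd; have := cabsD a w; lra.
Qed.

End Slices.

Section Bernstein_coordinates.
Context {R : realType} {m : nat}.
Variables (s : R) (f : m.-tuple R[i] -> R[i]).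
Hypotheses (s0 : 0 < s) (tf : exp_type s f).
Implicit Types (x y u : m.-tuple R).

Definition addt x u : m.-tuple R := [tuple tnth x i + tnth u i | i < m].

Lemma etype_sum n (c : 'I_n -> R[i]) (F : 'I_n -> R[i] -> R[i]) :
  (forall i, etype s (F i)) -> etype s (fun w => \sum_(i < n) c i * F i w).
Proof.
move=> tF; split=> [z|e e0].
  apply: (cdiff_sum (F := fun i w => c i * F i w)) => i.
  by apply: cdiffM; [exact: cdiff_cst|exact: (tF i).1].
have [C HC] := choice (fun i => (tF i).2 _ e0).
exists (\sum_(i < n) cabs (c i) * C i) => z.
apply: (le_trans (cabs_sum _ _ _)); rewrite mulr_suml; apply: ler_sum => i _.
by rewrite cabsM -mulrA ler_wpM2l ?cabs_ge0.
Qed.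

(** As a function of the common shift [t] of coordinate [j] the whole combination has type [s],
    whatever the coefficients and the points [Y i]. Arbitrary coefficients are what the duality
    argument for l_q needs. *)
Lemma bernstein_coord n (c : 'I_n -> R[i]) (Y : 'I_n -> m.-tuple R) j (S h : R) :
  (forall t, cabs (\sum_(i < n) c i * f (embedC (upd (Y i) j (tnth (Y i) j + t)))) <= S) ->
  cabs (\sum_(i < n) c i * f (embedC (upd (Y i) j (tnth (Y i) j + h))) -
        \sum_(i < n) c i * f (embedC (Y i))) <= expR 1 * s * `|h| * S.
Proof.
move=> HS.
pose F i w := f (upd (embedC (Y i)) j ((tnth (Y i) j)%:C + w)).
have tF i : etype s (F i) by exact: slice_etype.
have FE i t : F i t%:C = f (embedC (upd (Y i) j (tnth (Y i) j + t))).
  by rewrite /F embedC_upd; congr (f (upd _ _ _)); simpc.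
have := @bernstein _ s S _ 0 h s0 (etype_sum c tF).
rewrite add0r.
under eq_bigr do rewrite FE.
under [X in _ - X]eq_bigr do rewrite FE addr0 upd_id.
apply => t; under eq_bigr do rewrite FE; exact: HS.
Qed.

(** These are the corners of a path from [x] to [y] that changes one coordinate at a time. *)
Definition pre (k : nat) x y : m.-tuple R :=
  [tuple (if (i < k)%N then tnth y i else tnth x i) | i < m].

Lemma pre0 x y : pre 0 x y = x.
Proof. by apply: eq_from_tnth => i; rewrite tnth_mktuple. Qed.

Lemma pre_full x y : pre m x y = y.
Proof. by apply: eq_from_tnth => i; rewrite tnth_mktuple ltn_ord. Qed.

Lemma preS k x y (km : (k < m)%N) :
  pre k.+1 x y = upd (pre k x y) (Ordinal km) (tnth y (Ordinal km)).
Proof.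
apply: eq_from_tnth => i; rewrite !tnth_mktuple ltnS leq_eqVlt -val_eqE /=.
case: eqP => [ik|//]; congr tnth; exact: val_inj.
Qed.

Lemma tnth_pre k x y (km : (k < m)%N) : tnth (pre k x y) (Ordinal km) = tnth x (Ordinal km).
Proof. by rewrite tnth_mktuple /= ltnn. Qed.

(** The shift is reached in [m] coordinate steps of length at most [d]; the hypothesis over all [x]
    bounds the slices through every corner of the path. *)
Lemma bernstein_family n (c : 'I_n -> R[i]) (Y : 'I_n -> m.-tuple R) (S d : R) u :
  (forall x, cabs (\sum_(i < n) c i * f (embedC (addt (Y i) x))) <= S) ->
  (forall j, `|tnth u j| <= d) ->
  cabs (\sum_(i < n) c i * f (embedC (addt (Y i) u)) -
        \sum_(i < n) c i * f (embedC (Y i))) <= expR 1 * s * m%:R * d * S.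
Proof.
move=> HS ud.
have S0 : 0 <= S by rewrite (le_trans _ (HS u))// cabs_ge0.
pose zt : m.-tuple R := [tuple 0 | i < m].
have addt0 x : addt x zt = x.
  by apply: eq_from_tnth => i; rewrite !tnth_mktuple addr0.
have main k : (k <= m)%N ->
  cabs (\sum_(i < n) c i * f (embedC (addt (Y i) (pre k zt u))) -
        \sum_(i < n) c i * f (embedC (Y i))) <= expR 1 * s * k%:R * d * S.
  elim: k => [_|k IH km].
    under eq_bigr do rewrite pre0 addt0.
    by rewrite subrr cabs0 mulr0 !mul0r.
  pose j := Ordinal km; pose v := pre k zt u.
  have E i t : addt (Y i) (upd v j t) = upd (addt (Y i) v) j (tnth (addt (Y i) v) j + t).
    apply: eq_from_tnth => l; rewrite !tnth_mktuple /=.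
    by case: eqP => [->|//]; rewrite ltnn addr0.
  have := @bernstein_coord n c (fun i => addt (Y i) v) j S (tnth u j).
  under eq_bigr do rewrite -E.
  move=> /(_ (fun t => _)).
  have H t : cabs (\sum_(i < n) c i * f (embedC (upd (addt (Y i) v) j (tnth (addt (Y i) v) j + t)))) <= S.
    under eq_bigr do rewrite -E; exact: HS.
  move=> /(_ H) step.
  apply: (le_trans (cabs_tri (\sum_(i < n) c i * f (embedC (addt (Y i) v))) _ _)).
  rewrite (preS _ _ km) -/v -/j.
  apply: (le_trans (lerD step (IH (ltnW km)))).
  rewrite -natr1 -!mulrA -mulrDr ler_pM2l ?expR_gt0// -mulrDr ler_pM2l//.
  rewrite !mulrDl mul1r addrC lerD2l; exact: ler_wpM2r.
by have := main m (leqnn m); under eq_bigr do rewrite pre_full.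
Qed.

End Bernstein_coordinates.

(** * Boundedness on R^m from boundedness on a net *)

Section Numeric.
Context {R : realType}.

(** From [expR (- (1 / 4)) >= 3 / 4] one gets [e <= (4 / 3)^4 = 256 / 81], sharp enough for the
    constant 11 in (c). *)
Lemma expR1_le : expR 1 <= 16 / 5 :> R.
Proof.
have h := expR_ge1Dx (- (1 / 4) : R).
have e4 : expR (1 / 4) ^+ 4 = expR 1 :> R.
  by rewrite -expRM_natl; congr expR; field.
rewrite -e4; set E := expR (1 / 4).
have E0 : 0 < E := expR_gt0 _.
have : E * (3 / 4) <= 1.
  have e1 : E * expR (- (1 / 4)) = 1 by rewrite expRN mulfV// gt_eqF.
  by rewrite -[leRHS]e1 ler_pM2l//; lra.
move=> E1; have {}E1 : E <= 4 / 3 by move: E1; clear; lra.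
apply: (@le_trans _ _ ((4 / 3) ^+ 4)); last by rewrite !exprS expr0; lra.
by apply: lerXn2r => //; rewrite nnegrE ?ltW//; lra.
Qed.

End Numeric.

Section Boundedness.
Context {R : realType} {m : nat}.
Variable f : m.-tuple R[i] -> R[i].
Hypothesis ef : entire f.
Implicit Types (x y : m.-tuple R).

Definition damped (b : R) x : R :=
  cabs (f (embedC x)) * expR (- (b * \sum_(i < m) tnth x i ^+ 2)).

(** In each coordinate the maximum of [s a - b a^2] is [s^2 / (4 b)], which is [s r / (8 mu)]
    because [b r = 2 mu s]. *)
Lemma sum_damp (s b r mu : R) (P : pred 'I_m) x : 0 < s -> 0 < b -> 0 < mu ->
  b * r = 2 * mu * s ->
  s * (\sum_(i < m | P i) `|tnth x i|) - b * \sum_(i < m | P i) tnth x i ^+ 2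
  <= (\sum_(i < m | P i) 1) * (s * r / (8 * mu)).
Proof.
move=> s0 b0 mu0 br; rewrite !mulr_sumr -sumrB mulr_suml; apply: ler_sum => i _.
rewrite mul1r -real_normK ?num_real//; set a := `|_|.
rewrite ler_pdivlMr ?mulr_gt0// -subr_ge0.
have -> : s * r - (s * a - b * a ^+ 2) * (8 * mu) =
  ((2 * mu * s) * r - (4 * a * (2 * mu * s) * mu * 2 - 16 * b * a ^+ 2 * mu ^+ 2)) / (2 * mu).
  by field; rewrite gt_eqF.
apply: divr_ge0; last by rewrite mulr_ge0// ltW.
rewrite -br; have -> : b * r * r - (4 * a * (b * r) * mu * 2 - 16 * b * a ^+ 2 * mu ^+ 2)
  = b * (r - 4 * a * mu) ^+ 2 by ring.
by rewrite mulr_ge0 ?sqr_ge0// ltW.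
Qed.

Lemma damped_upd b x j (t : R) : damped b (upd x j t) =
  cabs (f (upd (embedC x) j t%:C) * gauss b t%:C *
        (expR (- (b * \sum_(i < m | i != j) tnth x i ^+ 2)))%:C).
Proof.
rewrite /damped !cabsM cabs_real ger0_norm ?expR_ge0// embedC_upd -mulrA.
congr (_ * _); rewrite (cabs_gauss b t 0) -expRD; congr expR.
rewrite (bigD1 j)//= tnth_mktuple eqxx expr0n /= mulr0 sub0r mulrDr opprD.
congr (_ - b * _); apply: eq_bigr => i /negbTE ij.
by rewrite tnth_mktuple ij.
Qed.

Variables (s b r mu C A : R).
Hypotheses (s0 : 0 < s) (b0 : 0 < b) (mu1 : 1 <= mu) (mu2 : mu ^+ 2 = m%:R).
Hypotheses (br : b * r = 2 * mu * s) (gf : gbound f C s).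
Hypotheses (CA : C <= A) (dA : forall x, damped b x <= A).

Let mu0 : 0 < mu. Proof. by rewrite (lt_le_trans _ mu1). Qed.

Let r0 : 0 < r.
Proof. by rewrite -(pmulr_rgt0 _ b0) br !mulr_gt0. Qed.

Let C0 : 0 <= C. Proof. exact: gbound_ge0 gf. Qed.

Let A0 : 0 <= A. Proof. exact: le_trans CA. Qed.

Local Notation kappa := (25 / 8 * mu * s).

Let kappa0 : 0 < kappa. Proof. by rewrite !mulr_gt0. Qed.

(** Confines the points where the damped modulus exceeds [C] to the cube of half-side [r / 2]:
    outside it the Gaussian in the large coordinate [j] also pays for the other [m - 1]
    coordinates. *)
Lemma damped_large x j : r / 2 <= `|tnth x j| -> damped b x <= C.
Proof.
move=> hj; rewrite /damped; apply: (le_trans (ler_wpM2r (expR_ge0 _) (gf _))).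
rewrite -[leLHS]mulrA -expRD -[leRHS]mulr1; apply: ler_wpM2l => //.
rewrite -expR0 ler_expR subr_le0 -subr_le0.
under eq_bigr do rewrite tnth_embedC cabs_real.
rewrite (bigD1 j)//= [X in _ - b * X](bigD1 j)//=.
have := sum_damp (fun i => i != j) x s0 b0 mu0 br.
set U := \sum_(i < m | i != j) `|_|; set V := \sum_(i < m | i != j) _ ^+ 2.
have -> : \sum_(i < m | i != j) 1 = m%:R - 1 :> R.
  have : \sum_(i < m) 1 = m%:R :> R by rewrite sumr_const card_ord.
  by rewrite (bigD1 j)//= => H; apply/eqP; rewrite eq_sym subr_eq -H addrC.
have -> : tnth x j ^+ 2 = `|tnth x j| ^+ 2 by rewrite real_normK ?num_real.
set a := `|_| in hj *; rewrite -mu2 => H.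
(* With [mu = sqrt m] the number [m - 1] of other coordinates splits as [(mu - 1) (mu + 1)], and
   [(mu + 1) / (8 mu)] is at most [1 / 2]; so these coordinates cost at most [(mu - 1) s a], while
   [b a^2 >= mu s a]. *)
have h1 : (mu ^+ 2 - 1) * (s * r / (8 * mu)) <= (mu - 1) * (s * a).
  have -> : (mu ^+ 2 - 1) * (s * r / (8 * mu)) =
     (mu - 1) * (s * (r * ((mu + 1) / (8 * mu)))) by field; rewrite gt_eqF.
  apply: ler_wpM2l; first by rewrite subr_ge0.
  rewrite ler_pM2l//; apply: (le_trans _ hj); rewrite ler_pM2l//.
  rewrite ler_pdivrMr ?mulr_gt0// (_ : 2^-1 * (8 * mu) = 4 * mu); last by field.
  by have := mu1; lra.
have h2 : mu * s * a <= b * a ^+ 2.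
  have ra : b * (r / 2) = mu * s by rewrite mulrA br; field.
  by rewrite -ra -mulrA expr2 ler_pM2l// ler_wpM2r// (le_trans _ hj)// divr_ge0// ltW.
rewrite !mulrDr; move: H h1 h2; move: (b * a ^+ 2) (s * U) (b * V) => w1 w2 w3.
by move=> H h1 h2; have := le_trans H h1; lra.
Qed.

(** On the square of half-side [r] the damped slice grows like a function of type [kappa] bounded by
    [A] on the real axis. This is the input of [local_bernstein], with [A] in place of the still
    unknown bound for [f]. *)
Lemma damped_slice_growth x j (phi := fun w => f (upd (embedC x) j w) * gauss b w *
        (expR (- (b * \sum_(i < m | i != j) tnth x i ^+ 2)))%:C) (a t : R) :
  `|a| <= r -> `|t| <= r -> cabs (phi (a +i* t)) <= A * expR (kappa * `|t|).
Proof.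
move=> ha ht.
have bnd a' t' : cabs (phi (a' +i* t')) <= C * expR (s * `|a'| - b * a' ^+ 2 +
    (s * `|t'| + b * t' ^+ 2) +
    (\sum_(i < m | i != j) 1) * (s * r / (8 * mu))).
  rewrite /phi !cabsM cabs_gauss cabs_real ger0_norm ?expR_ge0// -mulrA -expRD.
  apply: (le_trans (ler_wpM2r (expR_ge0 _) (gf _))).
  rewrite -[leLHS]mulrA -expRD; apply: ler_wpM2l => //.
  rewrite ler_expR sum_upd.
  under eq_bigr do rewrite tnth_embedC cabs_real.
  have := sum_damp (fun i => i != j) x s0 b0 mu0 br.
  have := ler_wpM2l (ltW s0) (cabs_le_xy a' t').
  set U := \sum_(i < m | i != j) `|_|; set V := \sum_(i < m | i != j) _ ^+ 2.
  move: (b * a' ^+ 2) (b * t' ^+ 2) ((\sum_(i < m | i != j) 1) * _) (b * V) => w1 w2 w3 w4.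
  rewrite !mulrDr; lra.
have m1E : \sum_(i < m | i != j) 1 = mu ^+ 2 - 1 :> R.
  have : \sum_(i < m) 1 = m%:R :> R by rewrite sumr_const card_ord.
  by rewrite (bigD1 j)//= mu2 => H; apply/eqP; rewrite eq_sym subr_eq -H addrC.
have sr : 0 < s * r by rewrite mulr_gt0.
have m1 : (\sum_(i < m | i != j) 1) * (s * r / (8 * mu)) <= mu * s * r / 8 - s * r / (8 * mu).
  by rewrite m1E le_eqVlt; apply/orP; left; apply/eqP; field; rewrite gt_eqF.
have smu : 0 <= s * r / (8 * mu) by rewrite divr_ge0// ?mulr_ge0// ltW.
have br2 : b * r ^+ 2 = 2 * mu * s * r by rewrite expr2 mulrA br.
have srmu : s * r <= mu * s * r by rewrite -mulrA ler_peMl// ltW.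
have dphi z : cdiff phi z.
  apply: cdiffM; last exact: cdiff_cst.
  by apply: cdiffM; [exact: slice_cdiff|exact: cdiff_gauss].
have bt2 t' : 0 <= t' -> t' <= r -> s * t' + b * t' ^+ 2 <= kappa * t'.
  move=> t0 tr.
  have : b * t' ^+ 2 <= 2 * mu * s * t' by rewrite -br expr2 mulrA ler_wpM2r// ler_pM2l.
  have : s * t' <= mu * s * t' by rewrite -mulrA ler_peMl// mulr_ge0// ltW.
  have : 0 <= mu * s * t' by rewrite !mulr_ge0// ltW.
  by lra.
have side a' t' : `|a'| = r -> 0 <= `|t'| <= r ->
    cabs (phi (a' +i* t')) <= A * expR (kappa * `|t'|).
  move=> ar /andP[t0 tr]; apply: (le_trans (bnd _ _)).
  apply: ler_pM; [exact: C0|exact: expR_ge0|exact: CA|].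
  rewrite ler_expR -(real_normK (num_real a')) ar br2 -(real_normK (num_real t')).
  have := bt2 _ t0 tr; move: m1 smu srmu sr; lra.
(* Here the exponent reaches [s r + 2 mu s r + mu s r / 8 <= 25 / 8 mu s r], the origin of [25 / 8]
   in [kappa]. *)
have top a' t' : `|t'| = r -> `|a'| <= r ->
    cabs (phi (a' +i* t')) <= A * expR (kappa * r).
  move=> tr ar; apply: (le_trans (bnd _ _)).
  apply: ler_pM; [exact: C0|exact: expR_ge0|exact: CA|].
  rewrite ler_expR -(real_normK (num_real t')) tr br2 -(real_normK (num_real a')).
  have H : s * `|a'| - b * `|a'| ^+ 2 <= s * r / (8 * mu).
    have := sum_damp (fun i => i == j) (upd x j a') s0 b0 mu0 br.
    rewrite !big_pred1_eq tnth_mktuple eqxx mul1r.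
    by rewrite real_normK ?num_real.
  move: m1 smu srmu sr H; lra.
have bottom a' : cabs (phi (a' +i* 0)) <= A by rewrite -damped_upd.
have rr : - r <= r by have := r0; lra.
have hr (w : R) : - r <= w <= r -> `|w| <= r by rewrite ler_norml.
case: (leP 0 t) => t0.
  rewrite ger0_norm// in ht *.
  apply: (@rect_growth _ phi _ (- r) r r) => //.
  - exact: ltW.
  - by move=> a' /hr; apply: top; rewrite ger0_norm// ltW.
  - by move=> t' /andP[t1 t2]; rewrite -{2}(ger0_norm t1); apply: side;
      rewrite ?normrN ?ger0_norm ?t1// ltW.
  - by move=> t' /andP[t1 t2]; rewrite -{2}(ger0_norm t1); apply: side;
      rewrite ?normrN ?ger0_norm ?t1// ltW.
  - by rewrite -ler_norml.
  - by rewrite t0.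
have -> : phi (a +i* t) = phi (- (- a +i* `|t|)).
  by rewrite ltr0_norm//; congr phi; simpc.
have opp a' t' : - (a' +i* t') = (- a') +i* (- t') by simpc.
apply: (@rect_growth _ (fun w => phi (- w)) _ (- r) r r) => //.
- exact: ltW.
- exact: cdiff_opp.
- by move=> a' _; rewrite opp oppr0.
- by move=> a' /hr h; rewrite opp; apply: top; rewrite ?normrN// ger0_norm// ltW.
- by move=> t' /andP[t1 t2]; rewrite opp -{2}(ger0_norm t1) -(normrN t'); apply: side;
      rewrite ?normrN ?ger0_norm ?t1// ltW.
- by move=> t' /andP[t1 t2]; rewrite opp -{2}(ger0_norm t1) -(normrN t'); apply: side;
      rewrite ?normrN ?ger0_norm ?t1// ltW.
- by rewrite -ler_norml normrN.
- by rewrite normr_ge0.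
Qed.

Lemma damped_step x j (t1 t2 d : R) : `|t1| <= r / 2 -> `|t2 - t1| <= d ->
  2 * d <= kappa^-1 -> 4 * kappa^-1 <= r ->
  damped b (upd x j t1) <= damped b (upd x j t2) + d * expR 1 * kappa * A.
Proof.
move=> ht1 ht2 dk kr; rewrite !damped_upd.
pose phi w := f (upd (embedC x) j w) * gauss b w *
        (expR (- (b * \sum_(i < m | i != j) tnth x i ^+ 2)))%:C.
rewrite -[X in cabs X <= _]/(phi _) -[X in _ <= cabs X + _]/(phi _).
have k0 : 0 < kappa^-1 by rewrite invr_gt0.
have := @local_bernstein R phi kappa A ((t1 + t2) / 2) ((t2 - t1) / 2) kappa0 A0.
have -> : (t1 + t2) / 2 + (t2 - t1) / 2 = t2 by field.
have -> : (t1 + t2) / 2 - (t2 - t1) / 2 = t1 by field.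
have dphi z : cdiff phi z.
  apply: cdiffM; last exact: cdiff_cst.
  by apply: cdiffM; [exact: slice_cdiff|exact: cdiff_gauss].
have n2 : `|(t2 - t1) / 2| = `|t2 - t1| / 2 by rewrite normrM normfV [ `|2|]ger0_norm.
move=> /(_ dphi) H.
have {}H : cabs (phi t2%:C - phi t1%:C) <= 2 * `|(t2 - t1) / 2| * expR 1 * kappa * A.
  (* The square of half-side [kappa^-1] around the midpoint stays in [|a| <= r], because
     [r / 2 + d / 2 + kappa^-1 <= r]. *)
  apply: H => [a t ha ht|]; last by rewrite n2; lra.
  have tr : `|t| <= r by lra.
  apply: damped_slice_growth tr.
  rewrite (_ : (t1 + t2) / 2 = t1 + (t2 - t1) / 2); last by field.
  rewrite (le_trans (ler_normD _ _))// (le_trans (lerD (ler_normD _ _) (lexx _)))// n2.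
  by lra.
have := cabs_tri (phi t2%:C) (phi t1%:C) 0.
rewrite !subr0 cabsC => /le_trans; apply; rewrite addrC lerD2l.
apply: (le_trans H); rewrite n2 [2 * _]mulrC divfK//.
rewrite !ler_wpM2r ?expR_ge0//; exact: ltW.
Qed.

(** Each step starts from a coordinate that still belongs to [x], so it is enough to confine [x] to
    the cube of half-side [r / 2]. *)
Lemma damped_path x y (d : R) : (forall j, `|tnth x j| <= r / 2) ->
  (forall j, `|tnth y j - tnth x j| <= d) ->
  2 * d <= kappa^-1 -> 4 * kappa^-1 <= r ->
  damped b x <= damped b y + m%:R * (d * expR 1 * kappa * A).
Proof.
move=> hx hy dk kr.
have main k : (k <= m)%N ->
    damped b x <= damped b (pre k x y) + k%:R * (d * expR 1 * kappa * A).
  elim: k => [_|k IH km]; first by rewrite pre0 mul0r addr0.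
  apply: (le_trans (IH (ltnW km))).
  rewrite -[k.+1%:R]natr1 [(_ + 1) * _]mulrDl mul1r [k%:R * _ + _]addrC addrA lerD2r (preS _ _ km).
  rewrite -[X in damped b X <= _](upd_id _ (Ordinal km)) tnth_pre.
  exact: damped_step.
by have := main m (leqnn m); rewrite pre_full.
Qed.

End Boundedness.

Section BoundedOfNet.
Context {R : realType} {m : nat}.
Implicit Types (f : m.-tuple R[i] -> R[i]) (x y : m.-tuple R).

(* The factor [exp (- b |x|^2)] makes [f] bounded on R^m; near a point where the
   damped modulus is almost maximal it oscillates too slowly to be much smaller at
   the nearest point of the net, and the bound obtained does not depend on [b]. *)
Lemma bounded_of_net (sigma d B : R) f : (0 < m)%N -> 0 < sigma -> 0 < d ->
  exp_type sigma f -> 11 * (m%:R * Num.sqrt m%:R) * d * sigma <= 1 ->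
  (forall x, exists2 y, forall j, `|tnth y j - tnth x j| <= d &
                        cabs (f (embedC y)) <= B) ->
  exists M, forall x, cabs (f (embedC x)) <= M.
Proof.
move=> m0 sg0 d0 [ef gf] small net.
(* The type is enlarged by one percent to get a genuine exponential bound; the constant 11 leaves
   room for it. *)
have e0 : 0 < 1 / 100 :> R by lra.
have [C HC] := gf _ e0; pose s := sigma * (1 + 1 / 100).
have {}HC : gbound f C s by [].
have C0 := gbound_ge0 HC.
have s0 : 0 < s by rewrite mulr_gt0//; lra.
have sE : s = 101 / 100 * sigma by rewrite /s; field.
clearbody s.
have mR1 : 1 <= m%:R :> R by rewrite ler1n.
pose mu : R := Num.sqrt m%:R.
have mu1 : 1 <= mu by rewrite -sqrtr1 ler_wsqrtr.
have mu2 : mu ^+ 2 = m%:R by rewrite sqr_sqrtr.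
rewrite -/mu in small; clearbody mu.
have mu0 : 0 < mu by lra.
have B0 : 0 <= B.
  by have [y _] := net [tuple 0 | i < m]; apply: le_trans; exact: cabs_ge0.
pose kappa := 25 / 8 * mu * s.
have k0 : 0 < kappa by rewrite !mulr_gt0.
have mk : m%:R * d * kappa <= 25 / 8 * (101 / 100) / 11.
  have -> : m%:R * d * kappa = 25 / 8 * (101 / 100) / 11 * (11 * (m%:R * mu) * d * sigma).
    by rewrite /kappa sE; field.
  by rewrite -[leRHS]mulr1 ler_pM2l//; lra.
have dk : 2 * d <= kappa^-1.
  rewrite -div1r ler_pdivlMr//.
  have : d * kappa <= m%:R * d * kappa.
    by rewrite -mulrA ler_peMl// mulr_ge0// ltW.
  by lra.
(* The final comparison reads [49/50 A <= B + 101/110 A], where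
   [101/110 = 25/8 * 101/100 / 11 * 16/5]; hence [A <= 275/17 B <= 17 B]. *)
exists (Num.max C (17 * B)) => x.
apply: (@ler_expR_lim _ _ _ (\sum_(i < m) tnth x i ^+ 2)).
  by rewrite le_max C0.
(* For [b] below this threshold [r = 2 mu s / b] is at least [4 kappa^-1], as [damped_path]
   requires. *)
exists (mu * s * kappa / 2) => [|b b0 bb]; first by rewrite divr_gt0// !mulr_gt0.
rewrite -ler_pdivrMr ?expR_gt0// -expRN -/(damped f b x).
pose r := 2 * mu * s / b.
have br : b * r = 2 * mu * s by rewrite /r mulrC divfK// gt_eqF.
have kr : 4 * kappa^-1 <= r.
  rewrite ler_pdivrMr// /r mulrAC ler_pdivlMr//.
  by move: bb; rewrite ltr_pdivlMr//; lra.
clearbody r.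
have bdd y : damped f b y <= C * expR (m%:R * (s * r / (8 * mu))).
  apply: (le_trans (ler_wpM2r (expR_ge0 _) (HC _))).
  rewrite -[leLHS]mulrA -expRD; apply: ler_wpM2l => //; rewrite ler_expR.
  under eq_bigr do rewrite tnth_embedC cabs_real.
  have := sum_damp xpredT y s0 b0 mu0 br.
  by rewrite sumr_const card_ord.
have [hsup0 hsup] : range (damped f b) !=set0 /\ has_ubound (range (damped f b)).
  split; first by exists (damped f b x), x.
  by eexists => _ [y _ <-]; exact: bdd.
pose A := sup (range (damped f b)).
have dA y : damped f b y <= A by apply: ub_le_sup => //; exists y.
case: (leP A C) => AC.
  by rewrite le_max (le_trans (dA x) AC).
rewrite le_max; apply/orP; right; apply: (le_trans (dA x)).
have A0 : 0 < A by exact: le_lt_trans AC.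
(* The almost-maximum point is also taken above [C], so that [damped_large] confines it to the
   cube. *)
have : Num.max C (49 / 50 * A) < A by rewrite gt_max AC; lra.
move=> /(sup_gt hsup0)[_ [x1 _ <-]]; rewrite gt_max => /andP[x1C x1A].
have hx1 j : `|tnth x1 j| <= r / 2.
  rewrite leNgt; apply/negP => /ltW h; move: x1C; rewrite ltNge => /negP; apply.
  exact: (damped_large s0 b0 mu1 mu2 br HC h).
have [y yd yB] := net x1.
have := damped_path ef s0 b0 mu1 mu2 br HC (ltW AC) dA hx1 yd dk kr.
have : damped f b y <= B.
  apply: (le_trans _ yB); rewrite /damped ler_piMr ?cabs_ge0//.
  rewrite -expR0 ler_expR oppr_le0 mulr_ge0//; first exact: ltW.
  by apply: sumr_ge0 => i _; exact: sqr_ge0.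
rewrite -/kappa.
have -> : m%:R * (d * expR 1 * kappa * A) = m%:R * d * kappa * expR 1 * A by ring.
have h : m%:R * d * kappa * expR 1 <= 25 / 8 * (101 / 100) / 11 * (16 / 5).
  apply: ler_pM; [by rewrite !mulr_ge0// ltW|exact: expR_ge0|exact: mk|exact: expR1_le].
have {h} := ler_wpM2r (ltW A0) h.
move: (m%:R * d * kappa * expR 1 * A) (damped f b y) x1A B0 A0; clear; move: (damped f b x1) (A) (B).
move=> *; lra.
Qed.

End BoundedOfNet.

(** * The sup-norm inequality (c) *)

Section SupNorm.
Context {R : realType} {m : nat}.
Implicit Types (f : m.-tuple R[i] -> R[i]) (x y u : m.-tuple R).

Lemma dist_le_linf x y j : `|tnth x j - tnth y j| <= linf_dist x y.
Proof. exact: (le_bigmax _ (fun j => `|tnth x j - tnth y j|) j). Qed.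

Lemma linf_dist_lt x y (d : R) : 0 < d ->
  (forall j, `|tnth x j - tnth y j| < d) -> linf_dist x y < d.
Proof. by move=> d0 H; apply: bigmax_lt. Qed.

Lemma powR_three_half (t : R) : 0 <= t -> t `^ (3 / 2) = t * Num.sqrt t.
Proof.
move=> t0; have -> : 3 / 2 = 1 + 2^-1 :> R by field.
rewrite powRD; last by rewrite gt_eqF//; lra.
by rewrite powRr1// powR12_sqrt.
Qed.

Lemma bernstein_shift (s S d : R) f x u : 0 < s -> exp_type s f ->
  (forall x, cabs (f (embedC x)) <= S) -> (forall j, `|tnth u j| <= d) ->
  cabs (f (embedC (addt x u)) - f (embedC x)) <= expR 1 * s * m%:R * d * S.
Proof.
move=> s0 tf fS ud.
have := @bernstein_family R m s f s0 tf 1 (fun=> 1) (fun=> x) S d u.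
rewrite !big_ord1 !mul1r; apply => // v.
by rewrite big_ord1 mul1r; exact: fS.
Qed.

(* [f (x + 2u) - 2 f (x + u) + f x] is a difference of differences, so that
   Bernstein's inequality applies twice. *)
Lemma bernstein_second (s S d : R) f x u : 0 < s -> exp_type s f ->
  (forall x, cabs (f (embedC x)) <= S) -> (forall j, `|tnth u j| <= d) ->
  2 * cabs (f (embedC (addt x u))) <= cabs (f (embedC (addt (addt x u) u))) +
    cabs (f (embedC x)) + (expR 1 * s * m%:R * d) ^+ 2 * S.
Proof.
move=> s0 tf fS ud.
pose c (i : 'I_2) : R[i] := if i == 0 then 1 else -1.
pose Y (i : 'I_2) := if i == 0 then addt x u else x.
have addtAC a b v : addt (addt a b) v = addt (addt a v) b :> m.-tuple R.
  by apply: eq_from_tnth => i; rewrite !tnth_mktuple addrAC.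
have := @bernstein_family R m s f s0 tf 2 c Y (expR 1 * s * m%:R * d * S) d u.
rewrite !big_ord_recr !big_ord0 /c /Y /= !add0r !mul1r !mulN1r.
set a := f _; set b := f _; set e := f _.
move=> H; have {H} : cabs (a - b - (b - e)) <= expR 1 * s * m%:R * d * (expR 1 * s * m%:R * d * S).
  apply: H => // v; rewrite !big_ord_recr !big_ord0 /c /Y /= !add0r !mul1r !mulN1r.
  by rewrite addtAC; exact: bernstein_shift.
rewrite mulrA -expr2 => H.
have -> : 2 * cabs b = cabs (2%:R * b).
  by rewrite cabsM -(rmorph_nat (real_complex R)) cabs_real ger0_norm.
have -> : 2%:R * b = a + (e - (a - b - (b - e))) by ring.
apply: (le_trans (cabsD _ _)); rewrite -[leRHS]addrA lerD2l.
apply: (le_trans (cabsB _ _)).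
by rewrite lerD2l.
Qed.

(** A first difference would only give the factor [1 - e t]. Instead [x] is the midpoint of the net
    point [x + u] and of [y = x - u], where only [|f y| <= M] is known: [2 |f x| <= P + M + t M].
    Taking the supremum over [x] gives [(1 - t) M <= P]. *)
Lemma sup_norm_estimate (s d : R) (X : nat -> m.-tuple R) f : (0 < m)%N ->
  0 < s -> 0 < d -> exp_type s f -> covering_net d X ->
  11 * m%:R `^ (3 / 2) * d * s <= 1 ->
  (exists M : R, forall nu, cabs (f (embedC (X nu))) <= M) ->
  (exists B : R, forall x, cabs (f (embedC x)) <= B) /\
  (1 - m%:R * d * s) * sup (range (fun x => cabs (f (embedC x))))
  <= sup (range (fun nu => cabs (f (embedC (X nu))))).
Proof.
move=> m0 s0 d0 tf cX small [M0 HM0].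
rewrite powR_three_half// in small.
have bf : exists B, forall x, cabs (f (embedC x)) <= B.
  apply: (bounded_of_net (B := M0) m0 s0 d0 tf small) => x.
  have [nu xnu] := cX x; exists (X nu) => // j.
  by rewrite distrC (le_trans (dist_le_linf _ _ _))// ltW.
split => //; case: bf => B HB.
set M := sup _; set P := sup _; pose t := m%:R * d * s; rewrite -/t.
have fM x : cabs (f (embedC x)) <= M.
  by apply: ub_le_sup; [exists B => _ [y _ <-]; exact: HB|exists x].
have XP nu : cabs (f (embedC (X nu))) <= P.
  by apply: ub_le_sup; [exists M0 => _ [y _ <-]; exact: HM0|exists nu].
have M00 : 0 <= M by rewrite (le_trans _ (fM (X 0)))// cabs_ge0.
have t0 : 0 <= t by rewrite !mulr_ge0// ltW.
have t1 : 11 * t <= 1.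
  apply: (le_trans _ small).
  have -> : 11 * (m%:R * Num.sqrt m%:R) * d * s = Num.sqrt m%:R * (11 * t).
    by rewrite /t; ring.
  have sq1 : 1 <= Num.sqrt m%:R :> R by rewrite -[leLHS]sqrtr1 ler_wsqrtr// ler1n.
  by apply: ler_peMl => //; rewrite mulr_ge0.
(* The square is [e^2 t^2], and [e^2 <= (16/5)^2 < 11] with [11 t <= 1] makes it at most [t]. *)
have Lt : (expR 1 * s * m%:R * d) ^+ 2 <= t.
  have -> : (expR 1 * s * m%:R * d) ^+ 2 = expR 1 ^+ 2 * t * t by rewrite /t; ring.
  rewrite -[leRHS]mul1r; apply: ler_wpM2r => //.
  have e2 : expR 1 ^+ 2 <= (16 / 5) ^+ 2 :> R.
    by apply: lerXn2r (expR1_le); rewrite nnegrE ?expR_ge0//; lra.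
  apply: (le_trans (ler_wpM2r t0 e2)); rewrite expr2; move: t1; clear; lra.
have key x : cabs (f (embedC x)) <= (P + M + t * M) / 2.
  have [nu xnu] := cX x.
  pose u : m.-tuple R := [tuple tnth (X nu) i - tnth x i | i < m].
  pose y : m.-tuple R := [tuple tnth x i - tnth u i | i < m].
  have yu : addt y u = x.
    by apply: eq_from_tnth => i; rewrite !tnth_mktuple subrK.
  have xu : addt x u = X nu.
    by apply: eq_from_tnth => i; rewrite !tnth_mktuple addrC subrK.
  have ud j : `|tnth u j| <= d.
    by rewrite tnth_mktuple distrC (le_trans (dist_le_linf _ _ _))// ltW.
  have := bernstein_second y s0 tf fM ud; rewrite yu xu => H.
  have := ler_wpM2r M00 Lt; have := XP nu; have := fM y.
  rewrite ler_pdivlMr// mulrC.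
  by move: H; lra.
have : M <= (P + M + t * M) / 2.
  apply: ge_sup; first by exists (cabs (f (embedC (X 0)))), (X 0).
  by move=> _ [x _ <-]; exact: key.
by clear; lra.
Qed.

End SupNorm.

(** * Finite l_q norms *)

Section FiniteLq.
Context {R : realType}.
Variable q : R.
Hypothesis q1 : 1 <= q.

Let q0 : 0 < q. Proof. exact: lt_le_trans q1. Qed.

Lemma young_powR (a b : R) : 0 <= a -> 0 <= b ->
  a `^ (q - 1) * b <= (1 - q^-1) * a `^ q + q^-1 * b `^ q.
Proof.
move=> a0 b0; have [qE|qn1] := eqVneq q 1.
  by rewrite qE subrr powRr0 invr1 subrr mul0r add0r !mul1r powRr1.
have qq : 1 < q by rewrite lt_neqAle eq_sym qn1.
have q10 : 0 < q - 1 by rewrite subr_gt0.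
have p0 : 0 < q / (q - 1) by rewrite divr_gt0.
have := @conjugate_powR R (a `^ (q - 1)) b (q / (q - 1)) q (powR_ge0 _ _) b0 p0 q0.
have -> : (q / (q - 1))^-1 = 1 - q^-1 by field; rewrite !gt_eqF.
rewrite subrK -powRrM => /(_ erefl).
have -> : (q - 1) * (q / (q - 1)) = q by field; rewrite gt_eqF.
by rewrite ![_ * q^-1]mulrC [_ `^ q * (1 - _)]mulrC.
Qed.

Definition nq n (u : 'I_n -> R) : R := (\sum_(i < n) u i `^ q) `^ q^-1.

Lemma sum_powR_ge0 n (u : 'I_n -> R) : 0 <= \sum_(i < n) u i `^ q.
Proof. by apply: sumr_ge0 => i _; exact: powR_ge0. Qed.

Lemma nq_ge0 n (u : 'I_n -> R) : 0 <= nq u.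
Proof. exact: powR_ge0. Qed.

Lemma nq_powR n (u : 'I_n -> R) : nq u `^ q = \sum_(i < n) u i `^ q.
Proof. by rewrite /nq -powRrM mulVf ?gt_eqF// powRr1// sum_powR_ge0. Qed.

Lemma nq_le n (u : 'I_n -> R) (c : R) : 0 <= c ->
  (nq u <= c) = (\sum_(i < n) u i `^ q <= c `^ q).
Proof.
move=> c0; rewrite -nq_powR; apply/idP/idP => [h|h].
  by apply: ge0_ler_powR; rewrite ?nnegrE ?nq_ge0// ltW.
rewrite leNgt; apply/negP => h'; move: h; rewrite leNgt => /negP; apply.
by apply: gt0_ltr_powR; rewrite ?nnegrE ?nq_ge0.
Qed.

Lemma nq_eq0 n (u : 'I_n -> R) : (forall i, 0 <= u i) -> nq u = 0 -> forall i, u i = 0.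
Proof.
move=> u0 nu i; have := nq_powR u; rewrite nu powR0 ?gt_eqF// => /esym/eqP.
rewrite psumr_eq0 => [/allP/(_ i)|j _]; last exact: powR_ge0.
by rewrite mem_index_enum /= => /(_ isT)/eqP/powR_eq0_eq0.
Qed.

Lemma nq_mono n (u v : 'I_n -> R) : (forall i, 0 <= u i <= v i) -> nq u <= nq v.
Proof.
move=> uv; rewrite nq_le ?nq_ge0// nq_powR; apply: ler_sum => i _.
have /andP[ui uvi] := uv i.
by apply: ge0_ler_powR; rewrite ?nnegrE//; [exact: ltW q0|exact: le_trans uvi].
Qed.

(** Hoelder's inequality written with the exponent [q - 1] instead of the conjugate exponent, so
    that [q = 1] is included and [u] can be the vector whose norm is being computed. *)
Lemma hoelder_nq n (u v : 'I_n -> R) : (forall i, 0 <= u i) -> (forall i, 0 <= v i) ->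
  \sum_(i < n) u i `^ (q - 1) * v i <= nq u `^ (q - 1) * nq v.
Proof.
move=> u0 v0.
have [qE|qn1] := eqVneq q 1.
  rewrite /nq qE subrr powRr0 mul1r invr1 powRr1; last first.
    by apply: sumr_ge0 => i _; exact: powR_ge0.
  by apply: ler_sum => i _; rewrite powRr0 mul1r powRr1.
have [/nq_eq0-/(_ u0) uE|nu0] := eqVneq (nq u) 0.
  rewrite big1 ?mulr_ge0 ?powR_ge0// => i _.
  by rewrite uE powR0 ?mul0r// subr_eq0.
have [/nq_eq0-/(_ v0) vE|nv0] := eqVneq (nq v) 0.
  by rewrite big1 ?mulr_ge0 ?powR_ge0// => i _; rewrite vE mulr0.
have U0 : 0 < nq u by rewrite lt_neqAle eq_sym nu0 nq_ge0.
have V0 : 0 < nq v by rewrite lt_neqAle eq_sym nv0 nq_ge0.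
have := nq_powR u; have := nq_powR v.
move: (nq u) (nq v) U0 V0 {nu0 nv0} => U V U0 V0 hV hU.
pose u' i := u i / U; pose v' i := v i / V.
have u'0 i : 0 <= u' i by rewrite divr_ge0// ltW.
have v'0 i : 0 <= v' i by rewrite divr_ge0// ltW.
have uE i : u i = U * u' i by rewrite mulrC divfK// gt_eqF.
have vE i : v i = V * v' i by rewrite mulrC divfK// gt_eqF.
have su : \sum_(i < n) u' i `^ q = 1.
  move: hU; under eq_bigr do rewrite uE powRM ?(ltW U0)//.
  rewrite -mulr_sumr => h.
  by apply: (mulfI (lt0r_neq0 (powR_gt0 q U0))); rewrite mulr1 -h.
have sv : \sum_(i < n) v' i `^ q = 1.
  move: hV; under eq_bigr do rewrite vE powRM ?(ltW V0)//.
  rewrite -mulr_sumr => h.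
  by apply: (mulfI (lt0r_neq0 (powR_gt0 q V0))); rewrite mulr1 -h.
have -> : \sum_(i < n) u i `^ (q - 1) * v i =
    U `^ (q - 1) * V * \sum_(i < n) u' i `^ (q - 1) * v' i.
  rewrite mulr_sumr; apply: eq_bigr => i _.
  by rewrite uE vE powRM ?(ltW U0)//; ring.
rewrite ler_piMr ?mulr_ge0 ?powR_ge0//; first exact: ltW.
apply: (@le_trans _ _ (\sum_(i < n) ((1 - q^-1) * u' i `^ q + q^-1 * v' i `^ q))).
  by apply: ler_sum => i _; exact: young_powR.
by rewrite big_split /= -!mulr_sumr su sv !mulr1 subrK.
Qed.

Lemma powR_split (x : R) : 0 <= x -> x `^ q = x `^ (q - 1) * x.
Proof.
move=> x0; have [->|xn0] := eqVneq x 0.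
  by rewrite mulr0 powR0// gt_eqF.
rewrite -{3}(powRr1 x0) -powRD ?subrK//.
by apply/implyP.
Qed.

Lemma minkowski_nq n (u v : 'I_n -> R) : (forall i, 0 <= u i) -> (forall i, 0 <= v i) ->
  nq (fun i => u i + v i) <= nq u + nq v.
Proof.
move=> u0 v0; pose w i := u i + v i; rewrite -/(nq w).
have w0 i : 0 <= w i by rewrite addr_ge0.
have [->|nw0] := eqVneq (nq w) 0; first by rewrite addr_ge0 ?nq_ge0.
have W0 : 0 < nq w by rewrite lt_neqAle eq_sym nw0 nq_ge0.
have h : nq w `^ (q - 1) * nq w <= nq w `^ (q - 1) * (nq u + nq v).
  rewrite -powR_split ?nq_ge0// nq_powR mulrDr.
  under eq_bigr do rewrite powR_split// /w mulrDr -/(w _).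
  rewrite big_split /=; apply: lerD; exact: hoelder_nq.
by move: h; rewrite ler_pM2l// powR_gt0.
Qed.

Lemma nq_sum n p (g : nat -> 'I_n -> R) : (forall k i, 0 <= g k i) ->
  nq (fun i => \sum_(k < p) g k i) <= \sum_(k < p) nq (g k).
Proof.
move=> g0; elim: p => [|p IH].
  rewrite big_ord0 nq_le// big1 ?powR_ge0// => i _.
  by rewrite big_ord0 powR0// gt_eqF.
rewrite big_ord_recr /=.
have -> : (fun i => \sum_(k < p.+1) g k i) = fun i => (\sum_(k < p) g k i) + g p i.
  by apply/funext => i; rewrite big_ord_recr.
apply: (le_trans (minkowski_nq _ _)) => // [i|]; first exact: sumr_ge0.
by rewrite lerD2r.
Qed.

(** The factor [n] is crude but harmless: it occurs only where finiteness is at stake or where [c]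
    tends to 0 for fixed [n]. *)
Lemma nq_cst n (c : R) : 0 <= c -> nq (fun _ : 'I_n => c) <= n%:R * c.
Proof.
move=> c0; case: n => [|n].
  by rewrite mul0r nq_le// big_ord0 powR_ge0.
rewrite nq_le ?mulr_ge0// sumr_const card_ord -[leLHS]mulr_natl powRM//.
apply: ler_wpM2r; first exact: powR_ge0.
by rewrite -[leLHS]powRr1//; apply: ler_powR => //; rewrite ler1n.
Qed.

End FiniteLq.

(** * Independent perturbation of a finite family in l_q *)

Section LqPerturbation.
Context {R : realType} {m : nat}.
Variables (q s M : R) (f : m.-tuple R[i] -> R[i]).
Hypotheses (q1 : 1 <= q) (s0 : 0 < s) (tf : exp_type s f).
Hypothesis fM : forall x : m.-tuple R, cabs (f (embedC x)) <= M.
Implicit Types (x y u : m.-tuple R) (S d : R).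

Local Notation F x := (f (embedC x)).
Local Notation K := (expR 1 * s * m%:R).

Let K0 : 0 <= K. Proof. by rewrite !mulr_ge0 ?expR_ge0// ltW. Qed.

Let M0 : 0 <= M. Proof. by rewrite (le_trans _ (fM [tuple 0 | i < m]))// cabs_ge0. Qed.

(** The bound over all translates plays for l_q families the part that the sup norm plays for a
    single function. *)
Definition lqbd n (Y : 'I_n -> m.-tuple R) S :=
  forall x, nq q (fun i => cabs (F (addt (Y i) x))) <= S.

Lemma lqbd_ge0 n (Y : 'I_n -> m.-tuple R) S : lqbd Y S -> 0 <= S.
Proof. by move=> /(_ [tuple 0 | i < m]); apply: le_trans; exact: nq_ge0. Qed.

Lemma addt_swap x y u : addt (addt x y) u = addt (addt x u) y.
Proof. by apply: eq_from_tnth => i; rewrite !tnth_mktuple addrAC. Qed.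

Lemma addtA x y u : addt (addt x y) u = addt x (addt y u).
Proof. by apply: eq_from_tnth => i; rewrite !tnth_mktuple addrA. Qed.

Lemma addt0 x : addt x [tuple 0 | i < m] = x.
Proof. by apply: eq_from_tnth => i; rewrite !tnth_mktuple addr0. Qed.

Lemma lqbd_shift n (Y : 'I_n -> m.-tuple R) S u :
  lqbd Y S -> lqbd (fun i => addt (Y i) u) S.
Proof. by move=> YS x; under eq_fun do rewrite addtA. Qed.

(* By duality: test Bernstein's inequality on the combination of translates of [f]
   whose coefficients norm the vector of differences. *)
Lemma lq_bernstein n (Y : 'I_n -> m.-tuple R) S d u : lqbd Y S ->
  (forall j, `|tnth u j| <= d) ->
  nq q (fun i => cabs (F (addt (Y i) u) - F (Y i))) <= K * d * S.
Proof.
move=> YS ud; pose b i := F (addt (Y i) u) - F (Y i).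
pose T := nq q (fun i => cabs (b i)); rewrite -/T.
have S0 := lqbd_ge0 YS.
have T0 : 0 <= T by exact: nq_ge0.
(* For [T = 0] only [0 <= K * d * S] is at stake: any coordinate shows [0 <= d], and without
   coordinates [K] vanishes. *)
have [TE|Tn0] := eqVneq T 0.
  have [j _|j0] := pickP 'I_m; last first.
    have m0 : m%:R = 0 :> R by case: (m) j0 => // k /(_ ord0).
    by rewrite TE m0 mulr0 !mul0r.
  by rewrite TE !mulr_ge0 ?expR_ge0// ?(ltW s0)// (le_trans _ (ud j)).
have Tgt : 0 < T by rewrite lt_neqAle eq_sym Tn0.
have [c hc] := choice (fun i => let: ex_intro2 c c1 cb := unimodular_conj (b i) in
  ex_intro (fun c => cabs c = 1 /\ c * b i = (cabs (b i))%:C) c (conj c1 cb)).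
pose C i := (cabs (b i) `^ (q - 1))%:C * c i.
have CB (v : 'I_n -> R[i]) : cabs (\sum_(i < n) C i * v i) <=
    T `^ (q - 1) * nq q (fun i => cabs (v i)).
  apply: (le_trans (cabs_sum _ _ _)).
  apply: (le_trans _ (hoelder_nq q1 (fun i => cabs_ge0 (b i)) (fun i => cabs_ge0 (v i)))).
  apply: ler_sum => i _; rewrite !cabsM (hc i).1 mulr1 cabs_real ger0_norm//.
  exact: powR_ge0.
have := @bernstein_family R m s f s0 tf n C Y (T `^ (q - 1) * S) d u.
move=> /(_ (fun x => le_trans (CB _) (ler_wpM2l (powR_ge0 _ _) (YS x))) ud).
rewrite -sumrB; under eq_bigr do rewrite -mulrBr -/(b _) /C -mulrA (hc _).2 -rmorphM.
rewrite -rmorph_sum cabs_real ger0_norm; last first.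
  by apply: sumr_ge0 => i _; rewrite mulr_ge0 ?powR_ge0 ?cabs_ge0.
under eq_bigr do rewrite -(powR_split q1 (cabs_ge0 _)).
rewrite -(nq_powR q1) -/T (powR_split q1)// => h.
have Tp : 0 < T `^ (q - 1) by rewrite powR_gt0.
by rewrite -(ler_pM2l Tp) (le_trans h)//; rewrite le_eqVlt; apply/orP; left; apply/eqP; ring.
Qed.

Definition shiftj x j (t : R) := upd x j (tnth x j + t).

Lemma shiftjE x j t : shiftj x j t = addt x (upd [tuple 0 | i < m] j t).
Proof.
apply: eq_from_tnth => i; rewrite !tnth_mktuple.
by case: eqP => [->|]; rewrite ?addr0.
Qed.

Lemma shiftjD x j t t' : shiftj (shiftj x j t) j t' = shiftj x j (t + t').
Proof.
by apply: eq_from_tnth => i; rewrite !tnth_mktuple; case: eqP => // _; rewrite eqxx addrA.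
Qed.

Lemma unit_shift_le j (t d : R) : `|t| <= d ->
  forall i, `|tnth (upd [tuple 0 | i < m] j t) i| <= d.
Proof.
by move=> td i; rewrite !tnth_mktuple; case: eqP => // _; rewrite normr0 (le_trans _ td).
Qed.

Lemma grid_approx (t D : R) p : (0 < p)%N -> 0 < D -> 0 <= t <= D ->
  exists2 k, (k <= p)%N & `|t - k%:R * (D / p%:R)| <= D / p%:R.
Proof.
move=> p0 D0 /andP[t0 tD].
have pR : 0 < p%:R :> R by rewrite ltr0n.
have h0 : 0 < D / p%:R by rewrite divr_gt0.
have th : 0 <= t / (D / p%:R) by rewrite divr_ge0// ltW.
have /andP[k1 k2] := truncn_itv th; set k := Num.truncn _ in k1 k2.
rewrite ler_pdivlMr// in k1; rewrite ltr_pdivrMr// in k2.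
exists k.
  rewrite -(ler_nat R) -(ler_pM2r h0); apply: (le_trans k1).
  by rewrite mulrC divfK// gt_eqF.
rewrite ler_norml; move: k1 k2; rewrite -[k.+1%:R]natr1 [(_ + 1) * _]mulrDl mul1r.
by move: (k%:R * (D / p%:R)) (D / p%:R) h0 => a b; lra.
Qed.

(* Shifts depending on the index are compared through a common grid of [p] steps:
   the difference is at most the sum of the increments along the whole grid. *)
Lemma lq_step n (Z : 'I_n -> m.-tuple R) (j : 'I_m) (t t' : 'I_n -> R) D S :
  lqbd Z S -> 0 < D -> (forall i, 0 <= t i <= D) -> (forall i, 0 <= t' i <= D) ->
  nq q (fun i => cabs (F (shiftj (Z i) j (t i)) - F (shiftj (Z i) j (t' i)))) <= K * D * S.
Proof.
move=> ZS D0 tD t'D.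
have S0 := lqbd_ge0 ZS.
have lip x (a b e : R) : `|a - b| <= e -> cabs (F (shiftj x j a) - F (shiftj x j b)) <= K * e * M.
  move=> ab; have -> : shiftj x j a = addt (shiftj x j b) (upd [tuple 0 | i < m] j (a - b)).
    by rewrite -shiftjE shiftjD addrC subrK.
  by apply: bernstein_shift => //; exact: unit_shift_le.
(* The last term is the cost of rounding [t] and [t'] to the grid, estimated member by member with
   the sup bound [M]. It grows with [n], but [n] is fixed while [p] tends to infinity. *)
suff H p : (0 < p)%N -> nq q (fun i => cabs (F (shiftj (Z i) j (t i)) - F (shiftj (Z i) j (t' i))))
    <= K * D * S + 2 * n%:R * K * D * M / p%:R.
  apply/ler_addgt0Pr => e e0.
  pose p := (Num.truncn (2 * n%:R * K * D * M / e)).+1.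
  have G0 : 0 <= 2 * n%:R * K * D * M by rewrite !mulr_ge0// ltW.
  apply: (le_trans (H p _)) => //; rewrite lerD2l ler_pdivrMr ?ltr0n// [e * _]mulrC -ler_pdivrMr//.
  by apply: ltW; apply: truncnS_gt.
move=> p0; pose h := D / p%:R.
have pR : 0 < p%:R :> R by rewrite ltr0n.
have h0 : 0 < h by rewrite divr_gt0.
pose g i (k : nat) := F (shiftj (Z i) j (k%:R * h)).
pose V (k : nat) i := cabs (g i k.+1 - g i k).
have V0 k i : 0 <= V k i by exact: cabs_ge0.
have gk i a b : (a <= b)%N -> (b <= p)%N -> cabs (g i b - g i a) <= \sum_(k < p) V k i.
  move=> ab bp; apply: (@le_trans _ _ (\sum_(a <= k < b) V k i)).
    elim: b ab {bp} => [|b IH]; first by rewrite leqn0 => /eqP ->; rewrite subrr cabs0 big_geq.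
    rewrite leq_eqVlt => /predU1P[->|]; first by rewrite subrr cabs0 big_geq.
    rewrite ltnS => ab; rewrite big_nat_recr//=.
    apply: (le_trans (cabs_tri (g i b) _ _)); rewrite [leLHS]addrC; apply: lerD => //; exact: IH.
  rewrite -(big_mkord xpredT (fun k => V k i)) (big_cat_nat (n := b) (p := p))//=.
  rewrite (big_cat_nat (n := a) (p := b) (m := 0))//= -addrA.
  have pos (u v : nat) : 0 <= \sum_(u <= k < v) V k i by apply: sumr_ge0.
  have := pos 0%N a; have := pos b p; lra.
have bound i : cabs (F (shiftj (Z i) j (t i)) - F (shiftj (Z i) j (t' i))) <=
    \sum_(k < p) V k i + 2 * K * h * M.
  have [k kp /lip-/(_ (Z i)) hk] := grid_approx p0 D0 (tD i).
  have [k' kp' /lip-/(_ (Z i)) hk'] := grid_approx p0 D0 (t'D i).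
  have gg : cabs (g i k - g i k') <= \sum_(k < p) V k i.
    by case: (leqP k' k) => kk; [exact: gk|rewrite cabsC; apply: gk => //; exact: ltnW].
  apply: (le_trans (cabs_tri (g i k) _ _)).
  apply: (le_trans (lerD hk (cabs_tri (g i k') _ _))).
  rewrite [cabs (g i k' - _)]cabsC.
  by move: hk' gg; rewrite -/h /g; lra.
have c0 : 0 <= 2 * K * h * M by rewrite !mulr_ge0 ?expR_ge0 ?M0// ltW.
apply: (le_trans (nq_mono q1 (v := fun i => \sum_(k < p) V k i + 2 * K * h * M) _)).
  by move=> i; rewrite cabs_ge0 bound.
apply: (le_trans (minkowski_nq q1 _ _)) => // [i|]; first exact: sumr_ge0.
apply: lerD.
  apply: (le_trans (@nq_sum R q q1 n p V V0)).
  apply: (@le_trans _ _ (\sum_(k < p) K * h * S)); last first.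
    rewrite sumr_const card_ord -[leLHS]mulr_natl /h le_eqVlt; apply/orP; left; apply/eqP.
    by field; rewrite gt_eqF.
  apply: ler_sum => k _.
  have ZkS : lqbd (fun i => shiftj (Z i) j (k%:R * h)) S.
    by move=> x; under eq_fun do rewrite shiftjE addtA; exact: ZS.
  have hh : `|h| <= h by rewrite ger0_norm// ltW.
  have E i : addt (shiftj (Z i) j (k%:R * h)) (upd [tuple 0 | i < m] j h) =
      shiftj (Z i) j (k.+1%:R * h).
    by rewrite -shiftjE shiftjD -[k.+1%:R]natr1 mulrDl mul1r.
  by have := lq_bernstein ZkS (unit_shift_le j hh); under eq_fun do rewrite E.
apply: (le_trans (nq_cst q1 n c0)).
by rewrite /h le_eqVlt; apply/orP; left; apply/eqP; field; rewrite gt_eqF.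
Qed.

(** Coordinates are displaced one after another, and each multiplies the bound over the translates
    by [1 + L]. The induction is carried out for every translate [x] because [lq_step] asks for a
    bound of this kind. *)
Lemma lq_perturb n (Y Y' : 'I_n -> m.-tuple R) d S :
  lqbd Y S -> 0 < d -> (forall i j, `|tnth (Y' i) j - tnth (Y i) j| <= d) ->
  nq q (fun i => cabs (F (Y' i) - F (Y i))) <= ((1 + K * (2 * d)) ^+ m - 1) * S.
Proof.
move=> YS d0 YY'; have S0 := lqbd_ge0 YS.
pose L := K * (2 * d); rewrite -/L.
have L0 : 0 <= L by rewrite !mulr_ge0 ?expR_ge0// ltW.
pose P k i := pre k (Y i) (Y' i).
suff main k : (k <= m)%N -> forall x,
    nq q (fun i => cabs (F (addt (P k i) x) - F (addt (Y i) x))) <= ((1 + L) ^+ k - 1) * S.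
  have := main m (leqnn m) [tuple 0 | i < m].
  by under eq_fun do rewrite !addt0 /P pre_full.
elim: k => [_ x|k IH km x].
  rewrite expr0 subrr mul0r nq_le// big1 ?powR_ge0// => i _.
  by rewrite /P pre0 subrr cabs0 powR0// gt_eqF// (lt_le_trans _ q1).
have {}IH := IH (ltnW km).
pose j := Ordinal km.
have PS : lqbd (P k) ((1 + L) ^+ k * S).
  move=> y; apply: (le_trans (nq_mono q1 (v := fun i => cabs (F (addt (P k i) y) - F (addt (Y i) y))
     + cabs (F (addt (Y i) y))) _)).
    move=> i; rewrite cabs_ge0 /= (le_trans _ (cabsD _ _))// subrK //.
  apply: (le_trans (minkowski_nq q1 _ _)) => [i|i|]; try exact: cabs_ge0.
  apply: (le_trans (lerD (IH y) (YS y))).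
  by rewrite mulrBl mul1r subrK.
(* Shifting the base by [- d] turns displacements in [[- d, d]] into parameters in [[0, 2 d]]; the
   undisplaced family is the parameter [d]. This is where the factor 2 in [L] arises. *)
pose Z i := addt (shiftj (P k i) j (- d)) x.
have ZS : lqbd Z ((1 + L) ^+ k * S).
  apply: lqbd_shift => y; under eq_fun do rewrite shiftjE addtA; exact: PS.
have D0 : 0 < 2 * d by rewrite mulr_gt0.
pose t i := tnth (Y' i) j - tnth (Y i) j + d.
have ht i : 0 <= t i <= 2 * d.
  by have := YY' i j; rewrite ler_norml /t; lra.
have hd (i : 'I_n) : 0 <= d <= 2 * d by move: d0; lra.
have := lq_step j ZS D0 ht hd.
have E1 i : shiftj (Z i) j (t i) = addt (P k.+1 i) x.
  rewrite shiftjE /Z addt_swap -shiftjE shiftjD /P (preS _ _ km) -/j; congr addt.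
  rewrite /shiftj; congr upd; rewrite tnth_pre /t -/j; ring.
have E2 i : shiftj (Z i) j d = addt (P k i) x.
  rewrite shiftjE /Z addt_swap -shiftjE shiftjD addNr; congr addt.
  by rewrite /shiftj addr0 upd_id.
under eq_fun do rewrite E1 E2.
rewrite -/L => st.
apply: (le_trans (nq_mono q1 (v := fun i => cabs (F (addt (P k.+1 i) x) - F (addt (P k i) x))
     + cabs (F (addt (P k i) x) - F (addt (Y i) x))) _)).
  by move=> i; rewrite cabs_ge0 /= cabs_tri.
apply: (le_trans (minkowski_nq q1 _ _)) => [i|i|]; try exact: cabs_ge0.
apply: (le_trans (lerD st (IH x))).
by rewrite le_eqVlt; apply/orP; left; apply/eqP; rewrite exprS; ring.
Qed.

End LqPerturbation.

(** * Iterated integrals and step functions on a cubical grid *)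

Section StepFunctions.
Context {R : realType}.
Variable eta : R.
Hypothesis eta0 : 0 < eta.
Local Notation mu := (@lebesgue_measure R).

(** The integral of a nonnegative function is a supremum over the simple functions below it, hence
    monotone for arbitrary functions; so [|f|^q] can be compared directly with step functions. *)
Lemma ge0_le_integralT (f g : R -> \bar R) : (forall x, 0 <= f x)%E ->
  (forall x, f x <= g x)%E ->
  (\int[mu]_(x in [set: R]) f x <= \int[mu]_(x in [set: R]) g x)%E.
Proof.
move=> f0 fg; have g0 x : (0 <= g x)%E by exact: le_trans (fg x).
rewrite !ge0_integralTE//; apply: le_ereal_sup => _ [h hf <-].
by exists h => // x; exact: le_trans (fg x).
Qed.

Lemma iter_integral_ge0 m (g : m.-tuple R -> \bar R) :
  (forall x, 0 <= g x)%E -> (0 <= iter_integral g)%E.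
Proof.
elim: m g => [|m IH] g g0 /=; first exact: g0.
by apply: integral_ge0 => x _; apply: IH => t; exact: g0.
Qed.

Lemma le_iter_integral m (f g : m.-tuple R -> \bar R) : (forall x, 0 <= f x)%E ->
  (forall x, f x <= g x)%E -> (iter_integral f <= iter_integral g)%E.
Proof.
elim: m f g => [|m IH] f g f0 fg /=; first exact: fg.
apply: ge0_le_integralT => x; first by apply: iter_integral_ge0 => t; exact: f0.
by apply: IH => t; [exact: f0|exact: fg].
Qed.

Definition cellE (k : int) : set R := [set x | Num.floor (x / eta) = k].

Lemma cellE_itv k : cellE k = `[k%:~R * eta, (k + 1)%:~R * eta[%classic.
Proof.
apply/seteqP; split => x /=; rewrite in_itv /=.
  by move=> <-; have := floor_itv (x / eta); rewrite ler_pdivlMr// ltr_pdivrMr.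
move=> h; apply: floor_def; rewrite ler_pdivlMr// ltr_pdivrMr//.
Qed.

Lemma measurable_cellE k : measurable (cellE k).
Proof. by rewrite cellE_itv; exact: measurable_itv. Qed.

Lemma mu_cellE k : (mu (cellE k) = eta%:E)%E.
Proof.
rewrite cellE_itv lebesgue_measure_itv /= lte_fin ltr_pM2r// ltr_int ltzD1 lexx.
by rewrite -EFinD -mulrBl intrD addrAC subrr add0r mul1r.
Qed.

(** One inequality follows from finite partial sums; the other is the same inequality applied with
    [c^-1]. *)
Lemma esum_mulr (T : choiceType) (a : T -> \bar R) (c : R) : 0 < c ->
  (forall i, 0 <= a i)%E ->
  (\esum_(i in [set: T]) (a i * c%:E) = (\esum_(i in [set: T]) a i) * c%:E)%E.
Proof.
have H (b : T -> \bar R) (e : R) : 0 < e -> (forall i, 0 <= b i)%E ->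
  (\esum_(i in [set: T]) (b i * e%:E) <= (\esum_(i in [set: T]) b i) * e%:E)%E.
  move=> e0 b0; apply: ge_ereal_sup => _ [X hX <-].
  rewrite -ge0_mule_fsuml//; apply: lee_wpmul2r; first by rewrite lee_fin ltW.
  by apply: esum_ge; exists X.
move=> c0 a0; apply/eqP; rewrite eq_le H//=.
have ci : 0 < c^-1 by rewrite invr_gt0.
have h := H (fun i => a i * c%:E)%E c^-1 ci.
have e1 i : (a i * c%:E * (c^-1)%:E = a i)%E.
  by rewrite -muleA -EFinM mulfV ?gt_eqF// mule1.
rewrite (eq_esum (b := a)) in h; last by move=> i _; exact: e1.
have {}h := h (fun i => mule_ge0 (a0 i) (ltW c0 : (0 <= c%:E)%E)).
have := lee_wpmul2r (ltW c0 : (0 <= c%:E)%E) h.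
by rewrite -muleA -EFinM mulVf ?gt_eqF// mule1.
Qed.

(** The cells are enumerated by [pickle]; a natural number that is not a code gets an empty cell and
    an empty index set, so both sides are series over [nat] with equal terms. *)
Lemma integral_step (S : int -> \bar R) : (forall k, 0 <= S k)%E ->
  (\int[mu]_(x in [set: R]) S (Num.floor (x / eta)) =
   \esum_(k in [set: int]) (S k * eta%:E))%E.
Proof.
move=> S0.
pose F (n : nat) := [set x : R | pickle (Num.floor (x / eta)) = n].
pose J (n : nat) := [set k : int | pickle k = n].
have JP n : (exists k, J n = [set k] /\ F n = cellE k) \/ (J n = set0 /\ F n = set0).
  have [[k kn]|nk] := pselect (exists k : int, pickle k = n).
    left; exists k; split; apply/seteqP; split => x /=.
    - by move=> xn; apply: (pcan_inj pickleK); rewrite xn kn.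
    - by move=> ->.
    - by move=> xn; apply: (pcan_inj pickleK); rewrite xn kn.
    - by move=> e; rewrite -kn -e.
  right; split; apply/seteqP; split => x //= xn; apply: nk; by eexists; exact: xn.
have mF n : measurable (F n).
  have [[k [_ ->]]|[_ ->]] := JP n; first exact: measurable_cellE.
  exact: measurable0.
have tF : trivIset setT F by move=> i j _ _ [x [/= <- <-]].
have tJ : trivIset setT J by move=> i j _ _ [x [/= <- <-]].
have FT : \bigcup_n F n = setT.
  by apply/seteqP; split => // x _; exists (pickle (Num.floor (x / eta))).
have JT : \bigcup_n J n = setT.
  by apply/seteqP; split => // k _; exists (pickle k).
pose f (x : R) : \bar R := S (Num.floor (x / eta)).
have mf : measurable_fun setT f.
  rewrite -FT; apply/measurable_fun_bigcup => // n.
  have [[k [_ Fk]]|[_ ->]] := JP n; last exact: measurable_fun_set0.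
  apply: (eq_measurable_fun (cst (S k))); last exact: measurable_cst.
  by move=> x /set_mem; rewrite Fk /f => e; rewrite /= -[in LHS]e.
have := @ge0_integral_bigcup _ _ _ mu F f mF.
rewrite /= FT => /(_ mf (fun x _ => S0 _) tF) ->.
rewrite -JT nneseries_sum_bigcup//; last by move=> k; rewrite mule_ge0// lee_fin ltW.
apply: eq_eseriesr => n _.
have [[k [-> ->]]|[-> ->]] := JP n; last by rewrite integral_set0 esum_set0.
rewrite esum_set1; last by rewrite mule_ge0// lee_fin ltW.
rewrite -(mu_cellE k) -integral_cst; last exact: measurable_cellE.
by apply: eq_integral => x /set_mem e; rewrite /f /= -[in RHS]e.
Qed.

Definition cidx m (x : m.-tuple R) : m.-tuple int :=
  [tuple Num.floor (tnth x i / eta) | i < m].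

Lemma cidx_cons m (a : R) (t : m.-tuple R) :
  cidx [tuple of a :: t] = [tuple of Num.floor (a / eta) :: cidx t].
Proof.
apply: eq_from_tnth => i; rewrite tnth_mktuple.
by case: (unliftP ord0 i) => [j ->|->]; rewrite ?tnthS ?tnth0// tnth_mktuple.
Qed.

Lemma iter_integral_step m (h : m.-tuple int -> \bar R) : (forall k, 0 <= h k)%E ->
  (iter_integral (fun x => h (cidx x)) =
   (\esum_(k in [set: m.-tuple int]) h k) * (eta ^+ m)%:E)%E.
Proof.
elim: m h => [|m IH] h h0 /=.
  rewrite expr0 mule1 (_ : [set: 0.-tuple int] = [set [tuple]]); last first.
    by apply/seteqP; split => // t _ /=; rewrite tuple0.
  by rewrite esum_set1//; congr h; apply: eq_from_tnth => -[].
pose S (k : int) := ((\esum_(k' in [set: m.-tuple int]) h [tuple of k :: k']) * (eta ^+ m)%:E)%E.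
have S0 k : (0 <= S k)%E.
  by rewrite mule_ge0 ?lee_fin ?exprn_ge0 ?(ltW eta0)//; exact: esum_ge0.
have -> : (\int[mu]_(x in [set: R])
     iter_integral (fun t : m.-tuple R => h (cidx [tuple of x :: t])) =
   \int[mu]_(x in [set: R]) S (Num.floor (x / eta)))%E.
  apply: eq_integral => x _; rewrite /S.
  rewrite -(IH (fun k' => h [tuple of Num.floor (x / eta) :: k']))//.
  by congr iter_integral; apply/funext => t; rewrite cidx_cons.
rewrite integral_step// /S esum_mulr//.
rewrite esum_mulr ?exprn_gt0//; last by move=> k; exact: esum_ge0.
rewrite -muleA -EFinM -exprSr; congr (_ * _)%E.
rewrite esum_esum//.
rewrite (reindex_esum (setT `*`` (fun=> setT)) _
  (fun p : int * m.-tuple int => [tuple of p.1 :: p.2]))//.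
split => //=.
- by move=> [a t] [b u] _ _ /= /(congr1 val) /= [-> /val_inj ->].
- by move=> t _; exists (thead t, [tuple of behead t]) => //=; rewrite -tuple_eta.
Qed.

End StepFunctions.

Section CellBounds.
Context {R : realType} {m : nat}.
Variable eta : R.
Hypothesis eta0 : 0 < eta.
Implicit Types (g : m.-tuple R -> R) (k : m.-tuple int).

Definition corner k : m.-tuple R := [tuple (tnth k i)%:~R * eta | i < m].

Lemma cidxP (x : m.-tuple R) k : cidx eta x = k <->
  forall i, (tnth k i)%:~R * eta <= tnth x i < ((tnth k i)%:~R + 1) * eta.
Proof.
split => [<- i|H].
  rewrite tnth_mktuple; have := floor_itv (tnth x i / eta).
  by rewrite ler_pdivlMr// ltr_pdivrMr// intrD.
apply: eq_from_tnth => i; rewrite tnth_mktuple; apply: floor_def.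
by rewrite ler_pdivlMr// ltr_pdivrMr// intrD.
Qed.

Lemma cidx_corner k : cidx eta (corner k) = k.
Proof.
apply/cidxP => i; rewrite tnth_mktuple lexx /= ltr_pM2r//.
by rewrite ltrDl.
Qed.

Lemma cidx_dist (x y : m.-tuple R) : cidx eta x = cidx eta y ->
  forall i, `|tnth x i - tnth y i| < eta.
Proof.
move=> xy i; have /cidxP/(_ i) := xy; have /cidxP/(_ i) := erefl (cidx eta y).
rewrite !mulrDl mul1r ltr_norml; move: (_%:~R * eta) => a; lra.
Qed.

Lemma iter_integral_ge_cells g (h : m.-tuple int -> R) (s : seq (m.-tuple int)) :
  (forall k, 0 <= h k) -> (forall x, h (cidx eta x) <= g x) -> uniq s ->
  (((\sum_(k <- s) h k) * eta ^+ m)%:E <= iter_integral (fun x => (g x)%:E))%E.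
Proof.
move=> h0 hg us.
apply: (@le_trans _ _ (iter_integral (fun x : m.-tuple R => (h (cidx eta x))%:E))); last first.
  by apply: le_iter_integral => x; rewrite lee_fin.
rewrite (iter_integral_step eta0 (h := fun k => (h k)%:E)) => [|k]; last by rewrite lee_fin.
rewrite EFinM; apply: lee_wpmul2r; first by rewrite lee_fin exprn_ge0// ltW.
apply: esum_ge; exists [set` s]; first by split => //; exact: finite_seq.
by rewrite -fsbig_seq// sumEFin.
Qed.

(** [g] is dominated by its supremum on each cell. Finite sums of these suprema are approximated by
    values at one point per cell, which is all the hypothesis speaks about. *)
Lemma iter_integral_le_cells g (B : R) : (forall x, 0 <= g x) ->
  (forall (s : seq (m.-tuple int)) (w : m.-tuple int -> m.-tuple R), uniq s ->
     (forall k, cidx eta (w k) = k) -> \sum_(k <- s) g (w k) <= B) ->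
  (iter_integral (fun x => (g x)%:E) <= (B * eta ^+ m)%:E)%E.
Proof.
move=> g0 H.
pose G k := [set g x | x in [set x | cidx eta x = k]].
have gB x : g x <= B.
  (* The one-cell case of the hypothesis bounds [g] by [B], which makes the suprema finite; the
     other cells receive their corner as a default point. *)
  have := H [:: cidx eta x] (fun k => if k == cidx eta x then x else corner k) isT.
  rewrite big_seq1 eqxx; apply => k; case: eqP => [->//|_]; exact: cidx_corner.
have hG k : has_sup (G k).
  split; first by exists (g (corner k)), (corner k) => //; exact: cidx_corner.
  by exists B => _ [x _ <-].
pose h k := sup (G k).
have gh x : g x <= h (cidx eta x).
  by apply: ub_le_sup; [exact: (hG _).2|exists x].
have h0 k : 0 <= h k by rewrite -(cidx_corner k) (le_trans _ (gh _)).
apply: (@le_trans _ _ (iter_integral (fun x : m.-tuple R => (h (cidx eta x))%:E))).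
  by apply: le_iter_integral => x; rewrite lee_fin.
rewrite (iter_integral_step eta0 (h := fun k => (h k)%:E)) => [|k]; last by rewrite lee_fin.
rewrite EFinM; apply: lee_wpmul2r; first by rewrite lee_fin exprn_ge0// ltW.
apply: ge_ereal_sup => _ [X [finX _] <-].
rewrite fsbig_finite//= sumEFin lee_fin.
set s := (X in \sum_(i <- X) _).
have us : uniq s by exact: finmap.fset_uniq.
clearbody s; apply/ler_addgt0Pr => e e0.
pose e' := e / (size s).+1%:R.
have e'0 : 0 < e' by rewrite divr_gt0.
have near k : exists x, cidx eta x = k /\ h k - e' < g x.
  have [_ [x xk <-] hx] := sup_adherent e'0 (hG k).
  by exists x; split.
have [w hw] := choice near.
have := H s w us (fun k => (hw k).1).
suff : \sum_(k <- s) h k <= \sum_(k <- s) g (w k) + e by lra.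
apply: (@le_trans _ _ (\sum_(k <- s) (g (w k) + e'))).
  by apply: ler_sum => k _; have := (hw k).2; lra.
rewrite big_split /= lerD2l big_const_seq count_predT iter_addr_0.
rewrite -[leLHS]mulr_natr /e' -mulrA ger_pMr// ler_pdivrMl// mulr1 ler_nat leqnSn //.
Qed.

Lemma sum_multiplicity n N (h : m.-tuple int -> R) (ks : 'I_n -> m.-tuple int) :
  (forall k, 0 <= h k) -> (forall k, (#|[pred i | ks i == k]| <= N)%N) ->
  \sum_(i < n) h (ks i) <= N%:R * \sum_(k <- undup (codom ks)) h k.
Proof.
move=> h0 hN; set s := undup _.
have us : uniq s by exact: undup_uniq.
have -> : \sum_(i < n) h (ks i) = \sum_(i < n) \sum_(k <- s) (if ks i == k then h k else 0).
  apply: eq_bigr => i _; rewrite (bigD1_seq (ks i)) //=; last first.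
    by rewrite mem_undup codom_f.
  by rewrite eqxx big1 ?addr0// => k /negbTE; rewrite eq_sym => ->.
rewrite exchange_big /= mulr_sumr; apply: ler_sum => k _.
rewrite -big_mkcond /= sumr_const -[leLHS]mulr_natl; apply: ler_wpM2r => //.
by rewrite ler_nat; exact: hN.
Qed.

End CellBounds.

(** * Comparison of samples with integrals *)

Section Sampling.
Context {R : realType} {m : nat}.
Variables (q s M : R) (f : m.-tuple R[i] -> R[i]).
Hypotheses (q1 : 1 <= q) (s0 : 0 < s) (tf : exp_type s f).
Hypothesis fM : forall x : m.-tuple R, cabs (f (embedC x)) <= M.
Implicit Types (x y u : m.-tuple R) (S d : R).

Local Notation F x := (f (embedC x)).

Let q0 : 0 < q. Proof. exact: lt_le_trans q1. Qed.

Definition defect d : R := (1 + expR 1 * s * m%:R * (2 * d)) ^+ m - 1.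

(** Boundedness of [f] makes the supremum finite; a translate that almost attains it lets the error
    [defect d * S] be absorbed into the main term. *)
Lemma lqbd_sup n (Y : 'I_n -> m.-tuple R) : exists S, lqbd q f Y S /\
  forall e, 0 < e -> exists x, S - e < nq q (fun i => cabs (F (addt (Y i) x))).
Proof.
pose T x := nq q (fun i => cabs (F (addt (Y i) x))).
have M0 : 0 <= M by rewrite (le_trans _ (fM [tuple 0 | i < m]))// cabs_ge0.
have hT : has_sup (range T).
  split; first by exists (T [tuple 0 | i < m]), [tuple 0 | i < m].
  exists (n%:R * M) => _ [x _ <-]; apply: (le_trans _ (nq_cst q1 n M0)).
  by apply: nq_mono => // i; rewrite cabs_ge0 fM.
exists (sup (range T)); split => [x|e e0].
  by apply: ub_le_sup; [exact: hT.2|exists x].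
by have [_ [x _ <-] hx] := sup_adherent e0 hT; exists x.
Qed.

Lemma nq_perturb_le n (Y Y' : 'I_n -> m.-tuple R) d S : lqbd q f Y S -> 0 < d ->
  (forall i j, `|tnth (Y' i) j - tnth (Y i) j| <= d) ->
  nq q (fun i => cabs (F (Y i))) <= nq q (fun i => cabs (F (Y' i))) + defect d * S /\
  nq q (fun i => cabs (F (Y' i))) <= nq q (fun i => cabs (F (Y i))) + defect d * S.
Proof.
move=> YS d0 YY'; have P := lq_perturb q1 s0 tf fM YS d0 YY'.
have tri (A B : 'I_n -> R[i]) : nq q (fun i => cabs (A i)) <=
    nq q (fun i => cabs (B i)) + nq q (fun i => cabs (A i - B i)).
  apply: (le_trans (nq_mono q1 (v := fun i => cabs (B i) + cabs (A i - B i)) _)).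
    by move=> i; rewrite cabs_ge0 (le_trans _ (cabsD _ _))// addrC subrK.
  by apply: minkowski_nq => // i; exact: cabs_ge0.
split; last by apply: (le_trans (tri _ (fun i => F (Y i)))); rewrite lerD2l.
apply: (le_trans (tri _ (fun i => F (Y' i)))); rewrite lerD2l.
by under eq_fun do rewrite cabsC.
Qed.

(* The points of the net are compared with points of their cells where |f| is
   smallest, after the translation that makes the sampled l_q norm almost maximal. *)
Lemma packing_estimate (delta1 I : R) (N n : nat) (X : nat -> m.-tuple R) :
  0 < delta1 -> packing_net delta1 N X ->
  (iter_integral (fun x : m.-tuple R => (cabs (F x) `^ q)%:E) <= I%:E)%E ->
  nq q (fun i : 'I_n => cabs (F (X i))) * (1 - defect (delta1 / 2)) <=
    (N.+1%:R * (I / (delta1 / 2) ^+ m)) `^ q^-1.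
Proof.
move=> dl0 pX hI.
pose eta := delta1 / 2; have eta0 : 0 < eta by rewrite divr_gt0.
rewrite -/eta; have etam : 0 < eta ^+ m by rewrite exprn_gt0.
have I0 : 0 <= I.
  rewrite -lee_fin; apply: (le_trans _ hI); apply: iter_integral_ge0 => x.
  by rewrite lee_fin powR_ge0.
pose Q := N.+1%:R * (I / eta ^+ m); rewrite -/Q.
have Q0 : 0 <= Q by rewrite mulr_ge0// divr_ge0// ltW.
pose D := defect eta; rewrite -/D.
have [D1|D1] := leP 1 D.
  apply: (@le_trans _ _ 0); last exact: powR_ge0.
  by rewrite mulr_ge0_le0 ?nq_ge0// subr_le0.
have [S [XS Sx]] := lqbd_sup (fun i : 'I_n => X i).
have S0 := lqbd_ge0 XS.
have XS0 : nq q (fun i : 'I_n => cabs (F (X i))) <= S.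
  by have := XS [tuple 0 | i < m]; under eq_fun do rewrite addt0.
apply: (@le_trans _ _ (S * (1 - D))).
  by rewrite ler_wpM2r// subr_ge0 ltW.
rewrite leNgt; apply/negP => gap.
(* Half the gap, so that [V] still exceeds the [q]-th root of [Q]. The displaced points [W] keep l_q
   norm at least [V], whereas their cells allow a sum of [q]-th powers of barely more than [Q]. *)
pose e := (S * (1 - D) - Q `^ q^-1) / 2.
have e0 : 0 < e by rewrite divr_gt0// subr_gt0.
pose V := S * (1 - D) - e.
have VQ : Q `^ q^-1 < V.
  by move: gap; rewrite /V /e; move: (Q `^ q^-1) (S * (1 - D)) => a b; lra.
have QV : Q < V `^ q.
  have <- : (Q `^ q^-1) `^ q = Q by rewrite -powRrM mulVf ?gt_eqF// powRr1.
  by apply: gt0_ltr_powR; rewrite ?nnegrE ?powR_ge0// (le_trans (powR_ge0 _ _) (ltW VQ)).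
have [x0 hx0] := Sx _ e0.
pose Y (i : 'I_n) := addt (X i) x0.
have YS : lqbd q f Y S by exact: lqbd_shift.
pose G k := [set cabs (F x) `^ q | x in [set x | cidx eta x = k]].
have hG k : has_inf (G k).
  split; first by exists (cabs (F (corner eta k)) `^ q), (corner eta k) => //; exact: cidx_corner.
  by exists 0 => _ [x _ <-]; exact: powR_ge0.
pose h k := inf (G k).
have hg x : h (cidx eta x) <= cabs (F x) `^ q.
  by apply: ge_inf; [exact: (hG _).2|exists x].
have h0 k : 0 <= h k.
  by apply: lb_le_inf; [exact: (hG k).1|move=> _ [x _ <-]; exact: powR_ge0].
pose e' := (V `^ q - Q) / n.+1%:R.
have e'0 : 0 < e' by rewrite divr_gt0// subr_gt0.
have near i : exists w, cidx eta w = cidx eta (Y i) /\ cabs (F w) `^ q < h (cidx eta (Y i)) + e'.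
  have [_ [w wk <-] hw] := inf_adherent e'0 (hG (cidx eta (Y i))).
  by exists w; split.
have [W hW] := choice near.
have [] := @nq_perturb_le n Y W eta S YS eta0.
  by move=> i j; apply: ltW; apply: (cidx_dist eta0); exact: (hW i).1.
move=> YW _.
have VW : V <= nq q (fun i => cabs (F (W i))).
  have hVW := lt_le_trans hx0 YW.
  by rewrite /V mulrBr mulr1 addrAC lerBlDr [S * D]mulrC; exact: ltW.
have : V `^ q <= nq q (fun i => cabs (F (W i))) `^ q.
  apply: ge0_ler_powR; rewrite ?nnegrE ?nq_ge0 ?(ltW q0)//.
  by rewrite (le_trans (powR_ge0 _ _) (ltW VQ)).
rewrite nq_powR// => VqW.
(* Two translated points in one cell differ by less than [delta1 / 2] in each coordinate; the
   translation [x0] cancels, so the packing condition allows at most [N + 1] of them. *)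
have hcard k : (#|[pred i | cidx eta (Y i) == k]| <= N.+1)%N.
  have [i0 hi0|] := pickP [pred i | cidx eta (Y i) == k]; last first.
    by move/eq_card0 ->.
  have := pX (i0 : nat) (map (@nat_of_ord n) (enum [pred i | cidx eta (Y i) == k])).
  rewrite size_map -cardE; apply.
    by rewrite map_inj_uniq ?enum_uniq//; exact: val_inj.
  apply/allP => v /mapP [l]; rewrite mem_enum => /eqP lk ->.
  apply: linf_dist_lt => // j.
  have := cidx_dist eta0 (etrans lk (esym (eqP hi0))) j.
  by rewrite !tnth_mktuple; congr (`|_| < _); ring.
have main : \sum_(i < n) h (cidx eta (Y i)) <= Q.
  apply: (le_trans (sum_multiplicity h0 hcard)).
  rewrite /Q ler_wpM2l// ler_pdivlMr// -lee_fin; apply: (le_trans _ hI).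
  by apply: iter_integral_ge_cells => //; exact: undup_uniq.
have : \sum_(i < n) cabs (F (W i)) `^ q <= \sum_(i < n) (h (cidx eta (Y i)) + e').
  by apply: ler_sum => i _; exact: ltW (hW i).2.
rewrite big_split /= sumr_const card_ord => sumW.
have : e' *+ n < V `^ q - Q.
  rewrite -mulr_natr /e' -mulrA gtr_pMr ?subr_gt0// mulrC.
  by rewrite ltr_pdivrMr// mul1r ltr_nat.
move: VqW main sumW; move: (\sum_(i < n) cabs _ `^ q) (\sum_(i < n) h _) (e' *+ n) (V `^ q).
by clear; move=> *; lra.
Qed.

End Sampling.

Section Covering.
Context {R : realType} {m : nat}.
Implicit Types (x y u : m.-tuple R) (S d : R).

(** The mesh is [2 * delta], so each cell contains the open [delta]-cube around its centre and with
    it a point of the net. Arbitrary points [W] of the cells are compared with the corners [Y], and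
    an almost extremal translate of the corners is compared with these net points. *)
Lemma covering_estimate (q s M delta P : R) (f : m.-tuple R[i] -> R[i])
    (X : nat -> m.-tuple R) : 1 <= q -> 0 < s -> exp_type s f ->
  (forall x, cabs (f (embedC x)) <= M) ->
  0 < delta -> 0 <= P -> covering_net delta X ->
  (forall n (nu : 'I_n -> nat), injective nu ->
     nq q (fun i => cabs (f (embedC (X (nu i))))) <= P) ->
  defect (m := m) s (3 * delta) <= 1 / 3 ->
  (iter_integral (fun x : m.-tuple R => (cabs (f (embedC x)) `^ q)%:E) <=
    ((2 * P) `^ q * (2 * delta) ^+ m)%:E)%E.
Proof.
move=> q1 s0 tf fM d0 P0 cX hP small.
pose eta := 2 * delta; have eta0 : 0 < eta by rewrite mulr_gt0.
have dd0 : 0 < 3 * delta by rewrite mulr_gt0.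
have ee : eta = delta + delta by rewrite /eta mulr_natl mulr2n.
have e3 : 3 * delta = eta + delta by rewrite ee; ring.
rewrite -/eta; clearbody eta.
apply: (iter_integral_le_cells eta0) => [x|sq w us hw]; first exact: powR_ge0.
pose n := size sq; pose ks (i : 'I_n) := tnth (in_tuple sq) i.
have ksI : injective ks by apply/tuple_uniqP; exact: us.
pose Y (i : 'I_n) : m.-tuple R := corner eta (ks i).
pose W (i : 'I_n) := w (ks i).
have -> : \sum_(k <- sq) cabs (f (embedC (w k))) `^ q = \sum_(i < n) cabs (f (embedC (W i))) `^ q.
  by rewrite big_tnth.
rewrite -nq_le//; last by rewrite mulr_ge0.
have [S [YS Sx]] := lqbd_sup q1 fM Y.
have S0 := lqbd_ge0 YS.
pose D := defect (m := m) s (3 * delta); rewrite -/D in small.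
have WY i j : `|tnth (W i) j - tnth (Y i) j| <= 3 * delta.
  have := cidx_dist eta0 (etrans (hw (ks i)) (esym (cidx_corner eta0 (ks i)))) j.
  move/ltW/le_trans; apply; rewrite e3 lerDl; exact: ltW.
have [_ WS] := nq_perturb_le q1 s0 tf fM YS dd0 WY.
have YS0 : nq q (fun i => cabs (f (embedC (Y i)))) <= S.
  by have := YS [tuple 0 | i < m]; under eq_fun do rewrite addt0.
(* With [D <= 1 / 3] one has [(1 + D) S <= 2 (1 - D) S <= 2 P], the origin of the factor 2. *)
suff SP : S * (1 - D) <= P.
  apply: (le_trans WS); apply: (le_trans (lerD YS0 (lexx _))); rewrite -/D.
  move: (D) small SP S0 P0 => D' h1 h2 h3 h4.
  have : D' * S <= 1 / 3 * S by rewrite ler_wpM2r.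
  by move: h2; rewrite mulrBr mulr1 [S * D']mulrC; move: (D' * S) h3 h4 => a; clear; lra.
apply/ler_addgt0Pr => e e0; have [x0 hx0] := Sx _ e0.
pose kap := cidx eta x0.
have /(cidxP eta0) hkap := erefl kap; clearbody kap.
(* The translate moves every corner into the cell shifted by the same index [kap]; distinct corners
   thus give distinct cells, and [nu] becomes injective. *)
pose kk i : m.-tuple int := [tuple tnth (ks i) j + tnth kap j | j < m].
have near (i : 'I_n) : exists nu, forall j,
    `|tnth (X nu) j - (tnth (corner eta (kk i)) j + delta)| < delta.
  have [nu hnu] := cX [tuple tnth (corner eta (kk i)) j + delta | j < m].
  exists nu => j; apply: (le_lt_trans _ hnu).
  by have := dist_le_linf [tuple tnth (corner eta (kk i)) j + delta | j < m] (X nu) j;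
    rewrite tnth_mktuple distrC.
have [nu hnu] := choice near.
have cell i : cidx eta (X (nu i)) = kk i.
  apply/(cidxP eta0) => j; have := hnu i j; rewrite !tnth_mktuple mulrDl mul1r ltr_norml ee.
  by move: (_%:~R * _) (tnth (X _) j) => a b; clear; lra.
have nuI : injective nu.
  move=> i i' ii; apply: ksI; have := cell i; rewrite ii cell => /esym kki.
  apply: eq_from_tnth => j; have := congr1 (fun t => tnth t j) kki.
  by rewrite !tnth_mktuple => /addIr.
have Y0S : lqbd q f (fun i => addt (Y i) x0) S by exact: lqbd_shift.
have [] := nq_perturb_le q1 s0 tf fM (Y' := fun i => X (nu i)) Y0S dd0.
  move=> i j; have := hnu i j; rewrite !tnth_mktuple intrD mulrDl.
  have := hkap j; rewrite mulrDl mul1r e3.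
  rewrite ltr_norml ler_norml ee.
  move: (_%:~R * _) (_%:~R * _) (tnth (X _) j) (tnth x0 j) d0 => a b c d; clear; lra.
move=> h _; have {h} := lt_le_trans hx0 h; rewrite -/D.
move=> h; have {h} := lt_le_trans h (lerD (hP n nu nuI) (lexx (D * S))).
by rewrite mulrBr mulr1 [S * D]mulrC; move: (D * S) => a; clear; lra.
Qed.

End Covering.

(** * Constants and the sampling inequalities (a) and (b) *)

Section SamplingInequalities.
Context {R : realType} {m : nat}.
Implicit Types (q V : R) (f : m.-tuple R[i] -> R[i]) (X : nat -> m.-tuple R).

Lemma sample_lq_norm_le q V f X : 1 <= q -> 0 <= V ->
  (forall n, nq q (fun i : 'I_n => cabs (f (embedC (X i)))) <= V) ->
  (sample_lq_norm q f X <= V%:E)%E.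
Proof.
move=> q1 V0 h; have q0 : 0 < q by apply: lt_le_trans q1.
have : (\sum_(0 <= nu <oo) ((cabs (f (embedC (X nu)))) `^ q)%:E <= (V `^ q)%:E)%E.
  apply: lime_le; first by apply: is_cvg_nneseries => n _ _; rewrite lee_fin powR_ge0.
  by apply: nearW => n; rewrite big_mkord sumEFin lee_fin -nq_le.
move=> /(@gt0_ler_poweR _ q^-1) -/(_ _ _ _)/wrap[]//.
- by rewrite invr_ge0 ltW.
- by rewrite in_itv/= leey andbT nneseries_ge0// => n _ _; rewrite lee_fin powR_ge0.
- by rewrite in_itv/= leey andbT lee_fin powR_ge0.
by rewrite /sample_lq_norm poweR_EFin -powRrM mulfV ?gt_eqF// powRr1.
Qed.

Lemma Lq_normE q I f : iter_integral (fun x : m.-tuple R => (cabs (f (embedC x)) `^ q)%:E) = I%:E ->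
  Lq_norm q f = (I `^ q^-1)%:E.
Proof. by rewrite /Lq_norm => ->; rewrite poweR_EFin. Qed.

(** [(1 + a t)^m - 1] is convex in [t] and vanishes at 0, so on [[0, 1]] it lies below its chord;
    the factorization of [x^m - 1] makes this elementary. *)
Lemma defect_le (s d : R) : 0 < s -> 0 < d -> 2 * (d * s) <= 1 ->
  defect (m := m) s d <= ((1 + expR 1 * m%:R) ^+ m - 1) * (2 * (d * s)).
Proof.
move=> s0 d0 t1.
have -> : defect (m := m) s d = (1 + expR 1 * m%:R * (2 * (d * s))) ^+ m - 1 by rewrite /defect; congr ((1 + _) ^+ _ - 1); ring.
have : 0 <= 2 * (d * s) by rewrite mulr_ge0// mulr_ge0// ltW.
move: t1; move: (2 * (d * s)) => t t1 t0.
have a0 : 0 <= expR 1 * m%:R :> R by rewrite mulr_ge0// expR_ge0.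
move: (expR 1 * m%:R) a0 => a a0.
rewrite !subrX1 !(addrC 1 _) !addrK.
rewrite [leRHS]mulrAC ler_wpM2l ?mulr_ge0//.
apply: ler_sum => i _; rewrite lerXn2r ?nnegrE ?addr_ge0 ?mulr_ge0// lerD2r.
by rewrite -[leRHS]mulr1 ler_wpM2l.
Qed.

Lemma defect_const_ge1 : (0 < m)%N -> 1 <= (1 + expR 1 * m%:R) ^+ m - 1 :> R.
Proof.
move=> m0; have e2 := @expR1_ge2 R.
have m1 : 1 <= m%:R :> R by rewrite ler1n.
have h : 1 <= expR 1 * m%:R :> R by nra.
case: m m0 h {m1} => // n _ h.
have : 1 <= (1 + expR 1 * n.+1%:R) ^+ n :> R by rewrite exprn_ege1// lerDl (le_trans _ h).
rewrite exprS; move: (_ ^+ n) => b b1; nra.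
Qed.

(** Otherwise [g] would exceed [I / eta^m + 1] on a whole cell and its integral would exceed [I].
    The [+ 1] gives the strict inequality that the contradiction needs. *)
Lemma cell_small_value (eta I : R) (g : m.-tuple R -> R) k : 0 < eta ->
  (forall x, 0 <= g x) -> (iter_integral (fun x => (g x)%:E) <= I%:E)%E ->
  exists2 y, cidx eta y = k & g y <= I / eta ^+ m + 1.
Proof.
move=> eta0 g0 gI; apply: contrapT => no.
have I0 : 0 <= I.
  by rewrite -lee_fin; apply: le_trans gI; apply: iter_integral_ge0 => x; rewrite lee_fin.
have em0 : 0 < eta ^+ m by rewrite exprn_gt0.
pose h k' := if k' == k then I / eta ^+ m + 1 else 0.
have := @iter_integral_ge_cells _ _ _ eta0 g h [:: k].
move=> /(_ _ _ _)/wrap[]//.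
- by move=> k'; rewrite /h; case: ifP => // _; rewrite addr_ge0// divr_ge0// ltW.
- move=> x; rewrite /h; case: eqP => // xk.
  by rewrite leNgt; apply/negP => lt; apply: no; exists x => //; exact: ltW.
move=> /le_trans /(_ gI); rewrite lee_fin big_seq1 /h eqxx mulrDl mul1r divfK ?gt_eqF//.
by rewrite gerDl leNgt em0.
Qed.

(** Points where [|f|^q] is not much larger than its mean over their cell form a net on which [f] is
    bounded; the mesh is chosen with equality in the smallness condition of [bounded_of_net]. *)
Lemma bounded_of_integrable (q sigma I : R) f : (0 < m)%N -> 1 <= q -> 0 < sigma ->
  exp_type sigma f ->
  (iter_integral (fun x : m.-tuple R => (cabs (f (embedC x)) `^ q)%:E) <= I%:E)%E ->
  exists M, forall x, cabs (f (embedC x)) <= M.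
Proof.
move=> m0 q1 s0 tf fI; have q0 : 0 < q by apply: lt_le_trans q1.
have m0R : 0 < m%:R :> R by rewrite ltr0n.
have a0 : 0 < 11 * (m%:R * Num.sqrt m%:R) :> R by rewrite !mulr_gt0// sqrtr_gt0.
pose d := (11 * (m%:R * Num.sqrt m%:R) * sigma)^-1.
have d0 : 0 < d by rewrite invr_gt0 mulr_gt0.
apply: (@bounded_of_net _ _ sigma d ((I / d ^+ m + 1) `^ q^-1)) => //.
  by rewrite mulrAC /d mulfV// gt_eqF// mulr_gt0.
move=> x.
have [|y yk yle] := @cell_small_value d I _ (cidx d x) d0 _ fI; first by move=> y; exact: powR_ge0.
exists y; first by move=> j; rewrite ltW// (cidx_dist d0).
have <- : (cabs (f (embedC y)) `^ q) `^ q^-1 = cabs (f (embedC y)).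
  by rewrite -powRrM mulfV ?gt_eqF// powRr1// cabs_ge0.
apply: ge0_ler_powR => //; first by rewrite invr_ge0 ltW.
  by rewrite nnegrE powR_ge0.
by rewrite nnegrE; apply: le_trans yle; exact: powR_ge0.
Qed.

Lemma packing_net_sub (d d' : R) N X : d' <= d -> packing_net d N X -> packing_net d' N X.
Proof.
move=> dd hX nu s us /allP H; apply: (hX nu s us); apply/allP => mu /H /lt_le_trans; apply.
by rewrite ler_pM2r ?invr_gt0.
Qed.

(** The property of [dexp] through which large [delta1 * sigma] is handled. *)
Lemma le_dexp q : (0 < m)%N -> 1 <= q -> m%:R / q <= (dexp m q)%:R.
Proof.
move=> m0 q1; have q0 : 0 < q by apply: lt_le_trans q1.
rewrite /dexp; case: eqP => [->|_]; last by rewrite ltW// truncnS_gt.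
by rewrite div1r invf_le1.
Qed.

Lemma cell_root (q c I eta : R) : 1 <= q -> 0 <= c -> 0 <= I -> 0 < eta ->
  (c * (I / eta ^+ m)) `^ q^-1 = eta `^ (- (m%:R / q)) * c `^ q^-1 * I `^ q^-1.
Proof.
move=> q1 c0 I0 e0.
have ge := ltW e0; have gem := exprn_ge0 m ge.
have giem : 0 <= (eta ^+ m)^-1 by rewrite invr_ge0.
rewrite (powRM _ c0 (mulr_ge0 I0 giem)) (powRM _ I0 giem).
rewrite -(powR_mulrn m ge) -powRN -powRrM mulNr; ring.
Qed.

(** With [c = C delta1 sigma <= 1/2] bounding the defect, [packing_estimate] is divided by [1 - c],
    and [(1 - c)^-1 <= 1 + 2 c]. *)
Lemma packing_small (q sigma delta1 I : R) N X f : (0 < m)%N -> 1 <= q ->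
  0 < sigma -> 0 < delta1 -> exp_type sigma f -> packing_net delta1 N X ->
  iter_integral (fun x : m.-tuple R => (cabs (f (embedC x)) `^ q)%:E) = I%:E ->
  let C := (1 + expR 1 * m%:R) ^+ m - 1 in C * (delta1 * sigma) <= 1 / 2 ->
  (sample_lq_norm q f X <= ((delta1 / 2) `^ (- (m%:R / q)) * N.+1%:R `^ q^-1 * I `^ q^-1 *
     (1 + 2 * C * (delta1 * sigma)))%:E)%E.
Proof.
move=> m0 q1 s0 d0 tf pX fI C small.
have C1 : 1 <= C by apply: defect_const_ge1.
have I0 : 0 <= I.
  by rewrite -lee_fin -fI; apply: iter_integral_ge0 => x; rewrite lee_fin powR_ge0.
have t0 : 0 < delta1 * sigma by rewrite mulr_gt0.
have h0 : 0 < delta1 / 2 by rewrite divr_gt0.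
have [M fM] : exists M, forall x, cabs (f (embedC x)) <= M.
  by apply: (bounded_of_integrable m0 q1 s0 tf (I := I)); rewrite fI.
rewrite -cell_root//.
have V0 : 0 <= (N.+1%:R * (I / (delta1 / 2) ^+ m)) `^ q^-1 by exact: powR_ge0.
have Ct0 : 0 <= C * (delta1 * sigma) by rewrite mulr_ge0 ?ltW// (lt_le_trans _ C1).
apply: sample_lq_norm_le => //.
  by rewrite mulr_ge0// addr_ge0// -mulrA mulr_ge0.
move=> n.
have fI' : (iter_integral (fun x : m.-tuple R => (cabs (f (embedC x)) `^ q)%:E) <= I%:E)%E by rewrite fI.
have := packing_estimate q1 s0 tf fM n d0 pX fI'.
have D : defect (m := m) sigma (delta1 / 2) <= C * (delta1 * sigma).
  have e : 2 * (delta1 / 2 * sigma) = delta1 * sigma by field.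
  rewrite -e; apply: defect_le => //; rewrite e.
  have := ler_peMl (ltW t0) C1; move: small; move: (C * (delta1 * sigma)) (delta1 * sigma) => c t; lra.
have := nq_ge0 q (fun i : 'I_n => cabs (f (embedC (X i)))).
move: small Ct0 D V0; rewrite -mulrA.
move: (C * _) (defect _ _) (nq _ _) (_ `^ _) => c D v V cs c0 Dc V0 v0 H.
have c1 : 0 < 1 - c by lra.
rewrite -(ler_pM2r c1); apply: (@le_trans _ _ V); first by nra.
by rewrite -mulrA ler_peMr//; nra.
Qed.

Lemma powR_le_max (t t0 a : R) d : 0 < t0 -> t0 <= 1 -> t0 <= t -> 0 <= a -> a <= d%:R ->
  t `^ a <= Num.max t (t ^+ d) / t0.
Proof.
move=> t00 t01 tt a0 ad; have tp : 0 < t by apply: lt_le_trans tt.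
rewrite ler_pdivlMr//; have [t1|t1] := leP 1 t.
  rewrite le_max; apply/orP; right.
  rewrite (@le_trans _ _ (t `^ a))//; first by rewrite ler_piMr// powR_ge0.
  by rewrite -(powR_mulrn _ (ltW tp)) ler_powR.
rewrite le_max; apply/orP; left; apply: le_trans tt; apply: (ler_piMl (ltW t00)).
by rewrite -[leRHS](powRr0 t) ger_powR// tp ltW.
Qed.

(** Lowering the packing parameter to [t0 / sigma] costs [(delta1 sigma / t0)^(m/q)]; since
    [delta1 sigma >= t0], the maximum in the theorem absorbs it up to a constant. The factor 2 on
    the left is [1 + 2 c] at the threshold [c = 1/2]. *)
Lemma packing_factor (q C delta1 sigma : R) : (0 < m)%N -> 1 <= q -> 1 <= C ->
  0 < sigma -> 0 < delta1 -> 1 / 2 < C * (delta1 * sigma) ->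
  let t0 := (2 * C)^-1 in
  (t0 / sigma / 2) `^ (- (m%:R / q)) * 2 <= (delta1 / 2) `^ (- (m%:R / q)) *
    (2 * t0 `^ (- (m%:R / q)) / t0 * Num.max (delta1 * sigma) ((delta1 * sigma) ^+ dexp m q)).
Proof.
move=> m0 q1 C1 s0 d0 big /=; set t0 := (2 * C)^-1; have q0 : 0 < q by apply: lt_le_trans q1.
have C0 : 0 < C by apply: lt_le_trans C1.
have t00 : 0 < t0 by rewrite invr_gt0 mulr_gt0.
have t01 : t0 <= 1 by rewrite invf_le1 ?mulr_gt0//; lra.
have tt : t0 <= delta1 * sigma.
  rewrite /t0 -[_^-1]div1r ler_pdivrMr ?mulr_gt0//.
  have -> : delta1 * sigma * (2 * C) = 2 * (C * (delta1 * sigma)) by ring.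
  by move: big; move: (C * _) => c; lra.
have tp : 0 < delta1 * sigma by rewrite mulr_gt0.
have h := powR_le_max t00 t01 tt (divr_ge0 (ler0n _ _) (ltW q0)) (le_dexp m0 q1).
have -> : t0 / sigma / 2 = delta1 / 2 * (t0 * (delta1 * sigma)^-1).
  by field; rewrite ?gt_eqF.
have h2 : 0 <= delta1 / 2 by rewrite divr_ge0// ltW.
have it : 0 <= (delta1 * sigma)^-1 by rewrite invr_ge0 ltW.
rewrite (powRM _ h2 (mulr_ge0 (ltW t00) it)) (powRM _ (ltW t00) it).
have -> : ((delta1 * sigma)^-1) `^ (- (m%:R / q)) = (delta1 * sigma) `^ (m%:R / q).
  by rewrite -(powR_inv1 (ltW tp)) -powRrM mulN1r opprK.
rewrite -mulrA ler_wpM2l ?powR_ge0//.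
move: h; move: (powR_ge0 t0 (- (m%:R / q))).
move: (t0 `^ _) ((_ * _) `^ _) (Num.max _ _) => a b M a0 h.
have -> : 2 * a / t0 * M = a * (M / t0) * 2 by ring.
by rewrite ler_pM2r// ler_wpM2l.
Qed.

(** Above the threshold the net is treated as a packing net with parameter [t0 / sigma], the largest
    that [packing_small] admits. The constant is the sum of those from the two ranges. *)
Lemma packing_case (q sigma delta1 I : R) N X f : (0 < m)%N -> 1 <= q ->
  0 < sigma -> 0 < delta1 -> exp_type sigma f -> packing_net delta1 N X ->
  iter_integral (fun x : m.-tuple R => (cabs (f (embedC x)) `^ q)%:E) = I%:E ->
  let C := (1 + expR 1 * m%:R) ^+ m - 1 in let t0 := (2 * C)^-1 in
  (sample_lq_norm q f X <= ((delta1 / 2) `^ (- (m%:R / q)) * N.+1%:R `^ q^-1 *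
     (1 + (2 * C + 2 * t0 `^ (- (m%:R / q)) / t0) *
       Num.max (delta1 * sigma) ((delta1 * sigma) ^+ dexp m q)) * I `^ q^-1)%:E)%E.
Proof.
move=> m0 q1 s0 d0 tf pX fI /=; set C := _ - 1; set t0 := (2 * C)^-1.
have C1 : 1 <= C by apply: defect_const_ge1.
have C0 : 0 < C by apply: lt_le_trans C1.
have t00 : 0 < t0 by rewrite invr_gt0 mulr_gt0.
have tp : 0 < delta1 * sigma by rewrite mulr_gt0.
pose E := Num.max (delta1 * sigma) ((delta1 * sigma) ^+ dexp m q).
have tE : delta1 * sigma <= E by rewrite le_max lexx.
have E0 : 0 <= E by apply: le_trans tE; exact: ltW.
rewrite -/E; have K0 : 0 <= 2 * t0 `^ (- (m%:R / q)) / t0.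
  by rewrite divr_ge0 ?mulr_ge0 ?powR_ge0// ltW.
have [small|big] := leP (C * (delta1 * sigma)) (1 / 2).
  apply: (le_trans (packing_small m0 q1 s0 d0 tf pX fI small)); rewrite -/C lee_fin.
  rewrite -!mulrA; do 2 (apply: ler_wpM2l; first exact: powR_ge0).
  rewrite mulrC; apply: ler_wpM2r; first exact: powR_ge0.
  rewrite lerD2l mulrA; apply: ler_pM => //; first by rewrite mulr_ge0// ltW.
    exact: ltW.
  by rewrite lerDl mulrA.
have d'0 : 0 < t0 / sigma by rewrite divr_gt0.
have dd : t0 / sigma <= delta1.
  rewrite ler_pdivrMr// /t0 -[_^-1]div1r ler_pdivrMr ?mulr_gt0//.
  have -> : delta1 * sigma * (2 * C) = 2 * (C * (delta1 * sigma)) by ring.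
  by move: big; move: (C * _) => c; lra.
have e : C * (t0 / sigma * sigma) = 1 / 2.
  by rewrite /t0; field; rewrite ?gt_eqF.
have e1 : C * (t0 / sigma * sigma) <= 1 / 2 by rewrite e.
apply: (le_trans (packing_small m0 q1 s0 d'0 tf (packing_net_sub dd pX) fI e1)).
rewrite -/C lee_fin -[2 * C * _]mulrA e.
have := packing_factor m0 q1 C1 s0 d0 big; rewrite -/t0 -/E /=.
have := powR_ge0 (delta1 / 2) (- (m%:R / q)); have := powR_ge0 N.+1%:R q^-1; have := powR_ge0 I q^-1.
move: K0 E0; rewrite -mulrA.
set k := 2 * _; set D := _ `^ _; set B := _ `^ _; set A := _ `^ _; set A' := _ `^ _.
move: k A B D A' E {tE} => k A B D A' F k0 F0 D0 B0 A0 h.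
have C20 : 0 <= 2 * C by rewrite mulr_ge0// ltW.
have -> : A' * B * D * (1 + 2 * (1 / 2)) = A' * 2 * (B * D) by field.
have -> : A * B * (1 + (2 * C + k) * F) * D = (A + A * ((2 * C + k) * F)) * (B * D) by ring.
apply: ler_wpM2r; first exact: mulr_ge0.
apply: (le_trans h); rewrite [(_ + k) * F]mulrDl mulrDr addrA lerDr.
by rewrite addr_ge0// mulr_ge0// mulr_ge0.
Qed.

(** [covering_estimate] picks net points in no particular order, so the bound is stated for
    arbitrary injective finite families and obtained from the unordered sum. *)
Lemma sample_lq_norm_fin q f X : 1 <= q -> (sample_lq_norm q f X < +oo)%E ->
  exists2 P : R, 0 <= P & sample_lq_norm q f X = P%:E /\
    forall n (nu : 'I_n -> nat), injective nu ->
      nq q (fun i => cabs (f (embedC (X (nu i))))) <= P.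
Proof.
move=> q1; have q0 : 0 < q by apply: lt_le_trans q1.
rewrite /sample_lq_norm; set T := (\sum_(0 <= nu <oo) _)%E.
have T0 : (0 <= T)%E by apply: nneseries_ge0 => n _ _; rewrite lee_fin powR_ge0.
move=> /lty_poweRy Toy; have {}Toy : (T < +oo)%E by apply: Toy; rewrite invr_neq0// gt_eqF.
have Tf : T \is a fin_num by rewrite ge0_fin_numE.
have TE := fineK Tf; rewrite -TE poweR_EFin.
exists (fine T `^ q^-1); first exact: powR_ge0.
split => // n nu nuI.
rewrite nq_le ?powR_ge0// -powRrM mulVf ?gt_eqF// powRr1 ?fine_ge0//.
rewrite -lee_fin TE /T nneseries_esumT => [|k]; last by rewrite lee_fin powR_ge0.
have us : uniq (codom nu) by rewrite map_inj_uniq ?enum_uniq.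
apply: esum_ge; exists [set` codom nu]; first by split => //; exact: finite_seq.
by rewrite -fsbig_seq// sumEFin big_map big_enum/=.
Qed.

Lemma root_le (q A B : R) : 1 <= q -> 0 <= A -> 0 <= B -> A <= B `^ q -> A `^ q^-1 <= B.
Proof.
move=> q1 A0 B0 AB; have q0 : 0 < q by apply: lt_le_trans q1.
have <- : (B `^ q) `^ q^-1 = B by rewrite -powRrM mulfV ?gt_eqF// powRr1.
by apply: ge0_ler_powR AB; rewrite ?nnegrE ?powR_ge0// invr_ge0 ltW.
Qed.

(** The constant 18 makes the defect at [3 * delta], at most [6 C delta sigma], no larger than
    [1 / 3]; the second smallness condition is that of [bounded_of_net]. *)
Lemma covering_bound (q sigma delta P : R) X f : (0 < m)%N -> 1 <= q ->
  0 < sigma -> 0 < delta -> exp_type sigma f -> covering_net delta X -> 0 <= P ->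
  (forall n (nu : 'I_n -> nat), injective nu ->
      nq q (fun i => cabs (f (embedC (X (nu i))))) <= P) ->
  delta * sigma <= (18 * ((1 + expR 1 * m%:R) ^+ m - 1))^-1 ->
  delta * sigma <= (11 * (m%:R * Num.sqrt m%:R))^-1 ->
  (iter_integral (fun x : m.-tuple R => (cabs (f (embedC x)) `^ q)%:E) <=
    ((2 * P) `^ q * (2 * delta) ^+ m)%:E)%E.
Proof.
move=> m0 q1 s0 d0 tf cX P0 hP; set C := _ - 1 => t1 t2.
have q0 : 0 < q by apply: lt_le_trans q1.
have C1 : 1 <= C by apply: defect_const_ge1.
have C0 : 0 < C by apply: lt_le_trans C1.
have m0R : 0 < m%:R :> R by rewrite ltr0n.
have [M fM] : exists M, forall x, cabs (f (embedC x)) <= M.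
  apply: (@bounded_of_net _ _ sigma delta P) => //.
    move: t2; rewrite -[_^-1]div1r ler_pdivlMr; last by rewrite !mulr_gt0// sqrtr_gt0.
    by congr (_ <= _); ring.
  move=> x; have [nu xnu] := cX x; exists (X nu).
    move=> j; rewrite distrC; apply: le_trans (ltW xnu); exact: dist_le_linf.
  have := hP 1%N (fun=> nu) (fun i j _ => etrans (ord1 i) (esym (ord1 j))).
  by rewrite /nq big_ord1 -powRrM mulfV ?gt_eqF// powRr1// cabs_ge0.
apply: (covering_estimate q1 s0 tf fM d0 P0 cX hP).
have t0 : 0 < delta * sigma by rewrite mulr_gt0.
have Ct : 18 * (C * (delta * sigma)) <= 1.
  by move: t1; rewrite -[_^-1]div1r ler_pdivlMr ?mulr_gt0// [_ * (18 * C)]mulrC mulrA.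
have tC := ler_peMl (ltW t0) C1.
have e : 2 * (3 * delta * sigma) = 6 * (delta * sigma) by ring.
apply: (@le_trans _ _ (C * (2 * (3 * delta * sigma)))).
  apply: defect_le => //; first by rewrite mulr_gt0.
  rewrite e; move: Ct tC; move: (C * (delta * sigma)) (delta * sigma) => c t; lra.
have -> : C * (2 * (3 * delta * sigma)) = 6 * (C * (delta * sigma)) by ring.
by move: Ct; move: (C * (delta * sigma)) => c; lra.
Qed.

(** The bound on [I] already gives [(2 delta)^(-m/q) I^(1/q) <= 2 P]. Passing to [4 * delta]
    contributes [2^(-m/q)], which compensates [2^(1/q)] because [m >= 1], and [2^(-1)] cancels the
    2. *)
Lemma covering_const (q delta P I K : R) : 1 <= q -> 0 < delta -> 0 <= P -> 0 <= I ->
  0 <= K -> K <= 1 -> I <= (2 * P) `^ q * (2 * delta) ^+ m -> (0 < m)%N ->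
  (4 * delta) `^ (- (m%:R / q)) * 2 `^ (q^-1 - 1) * K `^ q^-1 * I `^ q^-1 <= P.
Proof.
move=> q1 d0 P0 I0 K0 K1 hI m0; have q0 : 0 < q by apply: lt_le_trans q1.
have d20 : 0 < 2 * delta by rewrite mulr_gt0.
have em0 := exprn_gt0 m d20.
have P2 : 0 <= 2 * P by rewrite mulr_ge0.
have K1' : K `^ q^-1 <= 1.
  have <- : 1 `^ q^-1 = 1 :> R by rewrite powR1.
  apply: ge0_ler_powR; rewrite ?nnegrE//.
  by rewrite invr_ge0 ltW.
have h : (I / (2 * delta) ^+ m) `^ q^-1 <= 2 * P.
  by apply: root_le => //; rewrite ?divr_ge0 ?ler_pdivrMr// ltW.
rewrite -[I / _]mul1r cell_root// powR1 mulr1 in h.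
have e4 : (4 * delta) `^ (- (m%:R / q)) = 2 `^ (- (m%:R / q)) * (2 * delta) `^ (- (m%:R / q)).
  rewrite -powRM ?ltW//; congr (_ `^ _); ring.
have e2 : 2 `^ (q^-1 - 1) = 2 `^ q^-1 / 2 :> R.
  by rewrite powRD ?pnatr_eq0 ?implybT// powRN powRr1.
have h2 : 2 `^ (- (m%:R / q)) * 2 `^ q^-1 <= 1 :> R.
  rewrite -powRD ?pnatr_eq0 ?implybT// -[leRHS](powRr0 2) ler_powR ?ler1n//.
  rewrite addrC subr_le0 ler_peMl// ?ler1n// invr_ge0 ltW//.
rewrite e4 e2.
have := powR_ge0 (2 * delta) (- (m%:R / q)); have := powR_ge0 2 (- (m%:R / q)) : 0 <= _ :> R.
have := powR_ge0 2 (q^-1) : 0 <= _ :> R.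
have := powR_ge0 K q^-1; have := powR_ge0 I q^-1.
move: h h2 K1'.
move: (K `^ _) (I `^ _) (2 `^ q^-1) ((2 * _) `^ _) (2 `^ _) => k i c b a h h2 k1 i0 k0 c0 a0 b0.
have -> : a * b * (c / 2) * k * i = ((a * c) * k) * (b * i / 2) by field.
have bi0 : 0 <= b * i by rewrite mulr_ge0.
apply: (@le_trans _ _ (1 * (b * i / 2))); last by rewrite mul1r; lra.
apply: ler_wpM2r; first by rewrite divr_ge0.
by rewrite -[leRHS]mulr1; apply: ler_pM => //; rewrite mulr_ge0.
Qed.

Lemma packing_inequality q : (0 < m)%N -> 1 <= q -> exists2 C : R, 0 < C &
  forall (sigma delta1 : R) N X f, 0 < sigma -> 0 < delta1 -> exp_type sigma f ->
    packing_net delta1 N X ->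
    (sample_lq_norm q f X <= ((delta1 / 2) `^ (- (m%:R / q)) * N.+1%:R `^ q^-1 *
       (1 + C * Num.max (delta1 * sigma) ((delta1 * sigma) ^+ dexp m q)))%:E
        * Lq_norm q f)%E.
Proof.
move=> m0 q1; have q0 : 0 < q by apply: lt_le_trans q1.
pose C := (1 + expR 1 * m%:R) ^+ m - 1 : R; pose t0 := (2 * C)^-1.
have C0 : 0 < C by apply: lt_le_trans (defect_const_ge1 m0).
have C2 : 0 < 2 * C + 2 * t0 `^ (- (m%:R / q)) / t0.
  rewrite ltr_pwDl ?mulr_gt0// divr_ge0 ?mulr_ge0 ?powR_ge0//.
  by rewrite invr_ge0 mulr_ge0// ltW.
exists (2 * C + 2 * t0 `^ (- (m%:R / q)) / t0) => // s d N X f s0 d0 tf pX.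
set A := _ * _ * _; have A0 : 0 < A.
  rewrite !mulr_gt0 ?powR_gt0 ?divr_gt0// ltr_pwDl// mulr_ge0 ?(ltW C2)//.
  by rewrite le_max (ltW (mulr_gt0 d0 s0)).
have J0 := iter_integral_ge0 (m := m) (fun x => powR_ge0 (cabs (f (embedC x))) q : (0 <= (_ `^ _)%:E)%E).
case E : (iter_integral (fun x : m.-tuple R => (cabs (f (embedC x)) `^ q)%:E)) J0 => [I| |] // J0.
  by rewrite (Lq_normE E) -EFinM; exact: packing_case.
(* If the norm of [f] is infinite, the positive factor [A] makes the right-hand side infinite as
   well. *)
by rewrite /Lq_norm E poweRyr ?invr_neq0 ?gt_eqF// gt0_muley ?lte_fin// leey.
Qed.

Lemma covering_inequality q : (0 < m)%N -> 1 <= q -> exists c0 C : R, [/\ 0 < c0, 0 < C &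
  forall (sigma delta : R) X f, 0 < sigma -> 0 < delta -> exp_type sigma f ->
    covering_net delta X -> delta * sigma <= c0 -> (sample_lq_norm q f X < +oo)%E ->
    let K := 1 - C * Num.max ((delta * sigma) `^ q) ((delta * sigma) `^ ((dexp m q)%:R * q)) in
    [/\ 0 < K, (Lq_norm q f < +oo)%E &
      (((4 * delta) `^ (- (m%:R / q)) * 2 `^ (q^-1 - 1) * K `^ q^-1)%:E
          * Lq_norm q f <= sample_lq_norm q f X)%E]].
Proof.
move=> m0 q1; have q0 : 0 < q by apply: lt_le_trans q1.
pose C := (1 + expR 1 * m%:R) ^+ m - 1 : R.
have C1 : 1 <= C := defect_const_ge1 m0.
have C0 : 0 < C by apply: lt_le_trans C1.
have C18 : 0 < 18 * C by rewrite mulr_gt0.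
have m0R : 0 < m%:R :> R by rewrite ltr0n.
(* [covering_const] accepts every [K] in [[0, 1]], so [C] only has to keep [K] positive: for
   [delta * sigma <= 1] the maximum is at most 1, and [1 / 2] gives [K >= 1 / 2]. *)
exists (Num.min (18 * C)^-1 (11 * (m%:R * Num.sqrt m%:R))^-1), (1 / 2).
split=> //; first by rewrite lt_min !invr_gt0 C18 !mulr_gt0// sqrtr_gt0.
move=> s d X f s0 d0 tf cX; rewrite le_min => /andP[t1 t2] fin K.
have tp : 0 < d * s by rewrite mulr_gt0.
have tle1 : d * s <= 1 by rewrite (le_trans t1)// invf_le1//; lra.
have pow1 (r : R) : 0 <= r -> (d * s) `^ r <= 1.
  by move=> r0; rewrite -[leRHS](powRr0 (d * s)) ger_powR// tp.
have [K0 K1] : 0 < K /\ K <= 1.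
  have := pow1 _ (ltW q0); have := pow1 _ (mulr_ge0 (ler0n _ (dexp m q)) (ltW q0)).
  have := powR_ge0 (d * s) q; rewrite /K.
  move: (_ `^ q) (_ `^ (_ * q)) => a b a0 b1 a1.
  have : Num.max a b <= 1 by rewrite ge_max a1.
  have : 0 <= Num.max a b by rewrite le_max a0.
  by move: (Num.max a b) => M; lra.
have [P P0 [sE hP]] := sample_lq_norm_fin q1 fin.
have bnd := covering_bound m0 q1 s0 d0 tf cX P0 hP t1 t2.
have J0 := iter_integral_ge0 (m := m) (fun x => powR_ge0 (cabs (f (embedC x))) q : (0 <= (_ `^ _)%:E)%E).
case E : (iter_integral (fun x : m.-tuple R => (cabs (f (embedC x)) `^ q)%:E)) J0 bnd => [I| |] // J0 bnd.
rewrite (Lq_normE E) ltry; split => //.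
by rewrite sE -EFinM lee_fin; apply: covering_const => //; exact: ltW.
Qed.

End SamplingInequalities.

Theorem theoremT1p1 (R : realType) (m : nat) : (0 < m)%N ->
  (* (a) *)
  (forall q : R, 1 <= q -> exists2 C : R, 0 < C &
    forall (sigma delta1 : R) (N : nat) (X : nat -> m.-tuple R)
           (f : m.-tuple R[i] -> R[i]),
      0 < sigma -> 0 < delta1 -> injective X -> exp_type sigma f ->
      packing_net delta1 N X ->
      (sample_lq_norm q f X <=
        ((delta1 / 2) `^ (- (m%:R / q)) * (N.+1%:R) `^ q^-1 *
         (1 + C * Num.max (delta1 * sigma)
                          ((delta1 * sigma) ^+ dexp m q)))%:E
        * Lq_norm q f)%E) /\
  (* (b) *)
  (forall q : R, 1 <= q -> exists c0 : R, exists C : R,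
    [/\ 0 < c0, 0 < C &
    forall (sigma delta : R) (X : nat -> m.-tuple R)
           (f : m.-tuple R[i] -> R[i]),
      0 < sigma -> 0 < delta -> injective X -> exp_type sigma f ->
      covering_net delta X -> delta * sigma <= c0 ->
      (sample_lq_norm q f X < +oo)%E ->
      let K := 1 - C * Num.max ((delta * sigma) `^ q)
                               ((delta * sigma) `^ ((dexp m q)%:R * q)) in
      [/\ 0 < K, (Lq_norm q f < +oo)%E &
        (((4 * delta) `^ (- (m%:R / q)) * 2 `^ (q^-1 - 1) * K `^ q^-1)%:E
          * Lq_norm q f <= sample_lq_norm q f X)%E]]) /\
  (* (c) *)
  (forall (sigma delta : R) (X : nat -> m.-tuple R)
          (f : m.-tuple R[i] -> R[i]),
      0 < sigma -> 0 < delta -> injective X -> exp_type sigma f ->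
      covering_net delta X ->
      11 * m%:R `^ (3 / 2) * delta * sigma <= 1 ->
      (exists M : R, forall nu, cabs (f (embedC (X nu))) <= M) ->
      (exists B : R, forall x : m.-tuple R, cabs (f (embedC x)) <= B) /\
      (1 - m%:R * delta * sigma)
        * sup (range (fun x : m.-tuple R => cabs (f (embedC x))))
      <= sup (range (fun nu => cabs (f (embedC (X nu)))))).
Proof.
move=> m0; split; last split.
- by move=> q q1; have [C C0 H] := packing_inequality m0 q1; exists C => // s d N X f s0 d0 _; exact: H.
- move=> q q1; have [c0 [C [c00 C0 H]]] := covering_inequality m0 q1; exists c0, C; split => // s d X f s0 d0 _; exact: H.
- move=> s d X f s0 d0 _; exact: sup_norm_estimate.
Qed.
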